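(* Let $0<\alpha<1$, $0<\beta<\infty$, $u\in H(\mathbb{D})$, $\varphi\in S(\mathbb{D})$, and suppose $uC_\varphi:\mathcal{B}^\alpha\to\mathcal{Z}_\beta$ is bounded. Then $$\|uC_\varphi\|_{e,\mathcal{B}^\alpha\to\mathcal{Z}_\beta}\asymp\max\Big\{\limsup_{n\to\infty}(n+1)^\alpha\|(2u'\varphi'+u\varphi'')\varphi^n\|_{\nu_\beta},\ \limsup_{n\to\infty}(n+1)^{\alpha+1}\|u(\varphi')^2\varphi^n\|_{\nu_\beta}\Big\}.$$
   Context: $\mathbb{D}$ is the open unit disk, $H(\mathbb{D})$ the holomorphic functions on $\mathbb{D}$, $S(\mathbb{D})$ the holomorphic self-maps of $\mathbb{D}$; $uC_\varphi f(z)=u(z)f(\varphi(z))$, and $\varphi^n$ is the $n$-th power of $\varphi$. $\mathcal{B}^\alpha$ is the space of $f\in H(\mathbb{D})$ with $\sup_z(1-|z|^2)^\alpha|f'(z)|<\infty$, normed by $|f(0)|+\sup_z(1-|z|^2)^\alpha|f'(z)|$. $\mathcal{Z}_\beta$ is the space of $f\in H(\mathbb{D})$ with $\sup_z(1-|z|^2)^\beta|f''(z)|<\infty$, normed by $|f(0)|+|f'(0)|+\sup_z(1-|z|^2)^\beta|f''(z)|$. For $g\in H(\mathbb{D})$, $\|g\|_{\nu_\beta}=\sup_z(1-|z|^2)^\beta|g(z)|$. The essential norm of a bounded operator $T:X\to Y$ is $\inf\{\|T-K\|:K:X\to Y\text{ compact}\}$. $A\asymp B$ means $B/C\le A\le CB$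 for a positive constant $C$ independent of $u,\varphi$. *)

(* Defs.v *)
From Stdlib Require Import Reals.
From Coquelicot Require Import Coquelicot.
Open Scope R_scope.

Definition inD (z : C) : Prop := Cmod z < 1.

Definition holo (f : C -> C) : Prop :=
  forall z : C, inD z -> @ex_derive C_AbsRing C_NormedModule f z.

Definition selfmap (phi : C -> C) : Prop :=
  holo phi /\ forall z, inD z -> inD (phi z).

(* complex derivative (agrees with the true derivative wherever f is
   complex differentiable, see is_C_derive_unique) *)
Definition d1 (f : C -> C) : C -> C := C_derive f.
Definition d2 (f : C -> C) : C -> C := C_derive (C_derive f).

Definition wt (a : R) (z : C) : R := Rpower (1 - Cmod z ^ 2) a.

Definition wsup (a : R) (g : C -> C) : Rbar :=
  Rbar_lub (fun x => exists z, inD z /\ x = Finite (wt a z * Cmod (g z))).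

Definition nu_norm (b : R) (g : C -> C) : Rbar := wsup b g.

Definition inBloch (a : R) (f : C -> C) : Prop :=
  holo f /\ exists M : R, forall z, inD z -> wt a z * Cmod (d1 f z) <= M.
Definition bloch_norm (a : R) (f : C -> C) : Rbar :=
  Rbar_plus (Finite (Cmod (f 0%C))) (wsup a (d1 f)).

Definition inZyg (b : R) (f : C -> C) : Prop :=
  holo f /\ exists M : R, forall z, inD z -> wt b z * Cmod (d2 f z) <= M.
Definition zyg_norm (b : R) (f : C -> C) : Rbar :=
  Rbar_plus (Finite (Cmod (f 0%C) + Cmod (d1 f 0%C))) (wsup b (d2 f)).

Definition wcomp (u phi : C -> C) (f : C -> C) : C -> C :=
  fun z => (u z * f (phi z))%C.

Definition wcomp_bounded (a b : R) (u phi : C -> C) : Prop :=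
  (forall f, inBloch a f -> inZyg b (wcomp u phi f)) /\
  exists M : R, forall f, inBloch a f ->
    Rbar_le (zyg_norm b (wcomp u phi f)) (Rbar_mult (Finite M) (bloch_norm a f)).

Definition lin_op (a b : R) (T : (C -> C) -> (C -> C)) : Prop :=
  (forall f, inBloch a f -> inZyg b (T f)) /\
  (forall f g (c : C), inBloch a f -> inBloch a g ->
     forall z, inD z -> T (fun w => f w + c * g w)%C z = (T f z + c * T g z)%C).

Definition compact_op (a b : R) (K : (C -> C) -> (C -> C)) : Prop :=
  lin_op a b K /\
  forall (fs : nat -> C -> C) (M : R),
    (forall n, inBloch a (fs n) /\ Rbar_le (bloch_norm a (fs n)) (Finite M)) ->
    exists (s : nat -> nat) (g : C -> C),
      (forall n, (s n < s (S n))%nat) /\ inZyg b g /\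
      forall eps : R, 0 < eps -> exists N : nat, forall n, (N <= n)%nat ->
        Rbar_le (zyg_norm b (fun z => K (fs (s n)) z - g z)%C) (Finite eps).

Definition op_norm_diff (a b : R) (T K : (C -> C) -> (C -> C)) : Rbar :=
  Rbar_lub (fun x => exists f, inBloch a f /\ Rbar_le (bloch_norm a f) (Finite 1) /\
     x = zyg_norm b (fun z => T f z - K f z)%C).

Definition ess_norm (a b : R) (T : (C -> C) -> (C -> C)) : Rbar :=
  Rbar_glb (fun x => exists K, compact_op a b K /\ x = op_norm_diff a b T K).

Definition limsupRbar (x : nat -> Rbar) : Rbar :=
  Rbar_glb (fun y => exists n : nat,
     y = Rbar_lub (fun v => exists k : nat, (n <= k)%nat /\ v = x k)).

Definition Rbar_max2 (x y : Rbar) : Rbar := Rbar_lub (fun v => v = x \/ v = y).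

Definition quantA (a b : R) (u phi : C -> C) : Rbar :=
  limsupRbar (fun n => Rbar_mult (Finite (Rpower (INR n + 1) a))
    (nu_norm b (fun z => ((2 * d1 u z * d1 phi z + u z * d2 phi z) * (phi z) ^ n)%C))).
Definition quantB (a b : R) (u phi : C -> C) : Rbar :=
  limsupRbar (fun n => Rbar_mult (Finite (Rpower (INR n + 1) (a + 1)))
    (nu_norm b (fun z => (u z * (d1 phi z) ^ 2 * (phi z) ^ n)%C))).

(* Main.v *)
From Stdlib Require Import Reals Lra Lia Psatz ssreflect FunctionalExtensionality ClassicalEpsilon Classical.
From Coquelicot Require Import Coquelicot.
(* Imported last because Reals also exports a name d1. *)
Require Import Defs.
Open Scope R_scope.

(* The second derivative of u f(phi) is u'' f(phi) + A f'(phi) + B f''(phi) with A = 2u'phi' + u phi'' and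
   B = u phi'^2. Since alpha < 1, the unit ball of the Bloch space is uniformly bounded with a common modulus of
   continuity, so the identity is approximated by finite-rank operators Q (truncated Taylor polynomials of dilations
   f(rz)) with f - Qf uniformly small on the disk and of bounded Bloch norm. For the compact K = u C_phi Q only the
   part of the disk where |phi| is close to 1 matters, and there the powers n ~ 1/(1-|phi|) bound the weighted
   coefficients A and B.

   Conversely, fix a compact K and points z_k with |phi(z_k)| -> 1, put n_k = floor(1/(1-|phi(z_k)|)), and test on
   multiples of n^(alpha-1) (z^n - c z^(2n)), n = n_k, where c is chosen so that f' (or f'') vanishes at phi(z_k); this
   isolates B (or A). The tests are bounded in the Bloch space and tend to 0 pointwise.

   Holomorphy only means complex differentiability at each point. Cauchy's formula comes from Goursat's bisection
   argument, run in the parameter rectangle of a homotopy deforming the circle |z| = rho into a small circle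
   around w. *)

(** * Complex differentiability *)

(** Both estimates pass through an intermediate quantity: the weighted |A| (1-|phi|)^(-alpha) and
    |B| (1-|phi|)^(-alpha-1) on the set where |phi| is close to 1. It is comparable to the limsup
    over powers, because t^n with n about 1/(1-t) stays above e^(-2), while n^p (1-t)^p t^n is
    bounded uniformly in n and t. This is where the factors e^2 come from.

    The term u'' f(phi) has no counterpart in the maximum, so it must be negligible in both
    directions. Here alpha < 1 is decisive twice: the remainders f - Qf are small on the whole disk,
    and the test functions are O(n^(alpha-1)) in sup norm.

    Truncating the Taylor series alone need not keep Bloch norms bounded, and a dilation alone has
    infinite rank; their composition has both properties.

    The coefficient c of a test function has modulus at most e^2 because |phi(z_k)|^n >= e^(-2), so
    all test functions share one Bloch bound. The degrees n and 2n are comparable, yet f' and f''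
    weigh them differently, so a choice of c that cancels one derivative leaves the other large. *)

Definition cdiff (f : C -> C) (z l : C) : Prop :=
  forall eps, 0 < eps -> exists d, 0 < d /\
    forall w, Cmod (w - z) < d -> Cmod (f w - f z - l * (w - z)) <= eps * Cmod (w - z).

Lemma cdiff_is_derive f z l :
  cdiff f z l <-> @is_derive C_AbsRing C_NormedModule f z l.
Proof.
  split.
  - move=> H; split; first by apply: is_linear_scal_l.
    move=> x Hx eps.
    have Hzx := @is_filter_lim_locally_unique C_AbsRing (AbsRing_NormedModule C_AbsRing) z x Hx; subst x.
    case: (H eps (cond_pos eps)) => d [Hd Hw].
    exists (mkposreal d Hd) => w Hb.
    have E : minus (minus (f w) (f z)) (scal (minus w z) l) = (f w - f z - l * (w - z))%C.
    { by rewrite /minus /plus /opp /scal /= /mult /=; ring. }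
    rewrite E. exact: (Hw w Hb).
  - move=> [_ H] eps He.
    case: (H z (fun P HP => HP) (mkposreal eps He)) => d Hd.
    exists d; split; first by apply: cond_pos.
    move=> w Hw.
    have E : minus (minus (f w) (f z)) (scal (minus w z) l) = (f w - f z - l * (w - z))%C.
    { by rewrite /minus /plus /opp /scal /= /mult /=; ring. }
    have := Hd w Hw. rewrite E. by [].
Qed.

Lemma Cmod_minus_sym x y : Cmod (x - y) = Cmod (y - x).
Proof. by rewrite -Cmod_opp; f_equal; ring. Qed.

Lemma Cmod_triangle_minus x y : Cmod (x - y) <= Cmod x + Cmod y.
Proof. rewrite -(Cmod_opp y); exact: Cmod_triangle. Qed.

Lemma Cmod_triangle_inv x y : Cmod x - Cmod y <= Cmod (x - y).
Proof.
  have := Cmod_triangle (x - y) y. have -> : (x - y + y = x)%C by ring. lra.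
Qed.

Lemma cdiff_const c z : cdiff (fun _ => c) z 0.
Proof.
  move=> eps He; exists 1; split; first lra. move=> w _.
  have -> : (c - c - 0 * (w - z) = 0)%C by ring.
  rewrite Cmod_0. have := Cmod_ge_0 (w - z). nra.
Qed.

Lemma cdiff_id z : cdiff (fun w => w) z 1.
Proof.
  move=> eps He; exists 1; split; first lra. move=> w _.
  have -> : (w - z - 1 * (w - z) = 0)%C by ring.
  rewrite Cmod_0. have := Cmod_ge_0 (w - z). nra.
Qed.

Lemma cdiff_lip f z l : cdiff f z l -> exists d, 0 < d /\
    forall w, Cmod (w - z) < d -> Cmod (f w - f z) <= (Cmod l + 1) * Cmod (w - z).
Proof.
  move=> H. case: (H 1 Rlt_0_1) => d [Hd Hw]. exists d; split => // w Hwz.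
  have := Hw w Hwz.
  have := Cmod_triangle (f w - f z - l * (w - z)) (l * (w - z)).
  have -> : (f w - f z - l * (w - z) + l * (w - z) = f w - f z)%C by ring.
  rewrite Cmod_mult. lra.
Qed.

Lemma cdiff_cont f z l : cdiff f z l -> forall eps, 0 < eps -> exists d, 0 < d /\
    forall w, Cmod (w - z) < d -> Cmod (f w - f z) <= eps.
Proof.
  move=> /cdiff_lip [d [Hd Hw]] eps He.
  have Hl : 0 < Cmod l + 1 by have := Cmod_ge_0 l; lra.
  exists (Rmin d (eps / (Cmod l + 1))); split.
  { apply: Rmin_glb_lt => //. exact: Rdiv_lt_0_compat. }
  move=> w Hm. have H1 := Rmin_l d (eps / (Cmod l + 1)). have H2 := Rmin_r d (eps / (Cmod l + 1)).
  have := Hw w ltac:(lra).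
  have : (Cmod l + 1) * Cmod (w - z) <= (Cmod l + 1) * (eps / (Cmod l + 1)).
  { apply: Rmult_le_compat_l; lra. }
  have -> : (Cmod l + 1) * (eps / (Cmod l + 1)) = eps by field; lra. lra.
Qed.

Lemma cdiff_plus f g z l m : cdiff f z l -> cdiff g z m -> cdiff (fun w => f w + g w)%C z (l + m).
Proof.
  move=> Hf Hg eps He.
  case: (Hf (eps / 2) ltac:(lra)) => d [Hd Hw]. case: (Hg (eps / 2) ltac:(lra)) => d' [Hd' Hw'].
  exists (Rmin d d'); split; first by apply: Rmin_glb_lt.
  move=> w Hm. have H1 := Rmin_l d d'. have H2 := Rmin_r d d'.
  have := Hw w ltac:(lra). have := Hw' w ltac:(lra).
  have -> : (f w + g w - (f z + g z) - (l + m) * (w - z) =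
    (f w - f z - l * (w - z)) + (g w - g z - m * (w - z)))%C by ring.
  have := Cmod_triangle (f w - f z - l * (w - z)) (g w - g z - m * (w - z)). lra.
Qed.

Lemma cdiff_mult f g z l m : cdiff f z l -> cdiff g z m ->
  cdiff (fun w => f w * g w)%C z (l * g z + f z * m).
Proof.
  move=> Hf Hg eps He.
  set A := Cmod (f z) + Cmod (g z) + Cmod l + 1.
  have Pf := Cmod_ge_0 (f z). have Pg := Cmod_ge_0 (g z). have Pl := Cmod_ge_0 l.
  have HA : 0 < A by rewrite /A; lra.
  have He0 : 0 < eps / A by apply: Rdiv_lt_0_compat; lra.
  set e := Rmin 1 (eps / A).
  have Hep : 0 < e by apply: Rmin_glb_lt; lra.
  have He1 : e <= 1 by apply: Rmin_l.
  have HeA : e * A <= eps.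
  { have := Rmin_r 1 (eps / A); rewrite -/e => H.
    have : e * A <= eps / A * A by apply: Rmult_le_compat_r; lra.
    have -> : eps / A * A = eps by field; lra. by []. }
  case: (Hf _ Hep) => d1 [Hd1 Hw1]. case: (Hg _ Hep) => d2 [Hd2 Hw2].
  case: (cdiff_cont _ _ _ Hg _ Hep) => d3 [Hd3 Hw3].
  exists (Rmin d1 (Rmin d2 d3)); split; first by repeat apply: Rmin_glb_lt.
  move=> w Hm. have H1 := Rmin_l d1 (Rmin d2 d3). have H2 := Rmin_r d1 (Rmin d2 d3).
  have H3 := Rmin_l d2 d3. have H4 := Rmin_r d2 d3.
  have E1 := Hw1 w ltac:(lra). have E2 := Hw2 w ltac:(lra). have E3 := Hw3 w ltac:(lra).
  have -> : (f w * g w - f z * g z - (l * g z + f z * m) * (w - z) =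
    (f w - f z - l * (w - z)) * g w + (f z * (g w - g z - m * (w - z)) + l * (w - z) * (g w - g z)))%C by ring.
  set W := Cmod (w - z) in E1 E2 *.
  have HW : 0 <= W by apply: Cmod_ge_0.
  eapply Rle_trans; first apply: Cmod_triangle.
  eapply Rle_trans; first (apply: Rplus_le_compat_l; apply: Cmod_triangle).
  rewrite !Cmod_mult -/W.
  have Hgw : Cmod (g w) <= Cmod (g z) + e by have := Cmod_triangle_inv (g w) (g z); lra.
  have Q1 : Cmod (f w - f z - l * (w - z)) * Cmod (g w) <= e * W * Cmod (g w).
  { apply: Rmult_le_compat_r => //. exact: Cmod_ge_0. }
  have Q2 : Cmod (f z) * Cmod (g w - g z - m * (w - z)) <= Cmod (f z) * (e * W).
  { by apply: Rmult_le_compat_l. }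
  have Q3 : Cmod l * W * Cmod (g w - g z) <= Cmod l * W * e.
  { apply: Rmult_le_compat_l => //. exact: Rmult_le_pos. }
  have HeW : 0 <= e * W by nra.
  have : e * W * (Cmod (g w) + Cmod (f z) + Cmod l) <= e * W * A.
  { apply: Rmult_le_compat_l => //; rewrite /A; lra. }
  have : e * A * W <= eps * W by apply: Rmult_le_compat_r.
  lra.
Qed.

Lemma cdiff_comp f g z l m : cdiff f (g z) l -> cdiff g z m ->
  cdiff (fun w => f (g w)) z (l * m).
Proof.
  move=> Hf Hg eps He.
  have Pl := Cmod_ge_0 l. have Pm := Cmod_ge_0 m.
  set A := Cmod l + Cmod m + 2.
  have HA : 0 < A by rewrite /A; lra.
  have He0 : 0 < eps / A by apply: Rdiv_lt_0_compat; lra.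
  case: (Hf _ He0) => d1 [Hd1 Hw1]. case: (Hg _ He0) => d2 [Hd2 Hw2].
  case: (cdiff_lip _ _ _ Hg) => d3 [Hd3 Hw3].
  have Hd4 : 0 < d1 / (Cmod m + 1) by apply: Rdiv_lt_0_compat; lra.
  exists (Rmin d2 (Rmin d3 (d1 / (Cmod m + 1)))); split; first by repeat apply: Rmin_glb_lt.
  move=> w /Rmin_Rgt_l [Hm2 /Rmin_Rgt_l [Hm3 Hm4]].
  have E2 := Hw2 w Hm2. have E3 := Hw3 w Hm3.
  set W := Cmod (w - z) in Hm2 Hm3 Hm4 E2 E3 *.
  have HW : 0 <= W by apply: Cmod_ge_0.
  have Hgd : Cmod (g w - g z) < d1.
  { eapply Rle_lt_trans; first exact: E3.
    have : (Cmod m + 1) * W < (Cmod m + 1) * (d1 / (Cmod m + 1)) by apply: Rmult_lt_compat_l; lra.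
    have -> : (Cmod m + 1) * (d1 / (Cmod m + 1)) = d1 by field; lra. by []. }
  have E1 := Hw1 _ Hgd.
  have -> : (f (g w) - f (g z) - l * m * (w - z) =
    (f (g w) - f (g z) - l * (g w - g z)) + l * (g w - g z - m * (w - z)))%C by ring.
  eapply Rle_trans; first apply: Cmod_triangle.
  rewrite Cmod_mult.
  have Q1 : eps / A * Cmod (g w - g z) <= eps / A * ((Cmod m + 1) * W).
  { apply: Rmult_le_compat_l => //; lra. }
  have Q2 : Cmod l * Cmod (g w - g z - m * (w - z)) <= Cmod l * (eps / A * W).
  { by apply: Rmult_le_compat_l. }
  have Q3 : eps / A * W * (Cmod l + Cmod m + 1) <= eps / A * W * A.
  { apply: Rmult_le_compat_l; [nra | rewrite /A; lra]. }
  have : eps / A * W * A = eps * W by field; lra.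
  lra.
Qed.

Lemma cdiff_inv (z : C) : z <> 0%C -> cdiff Cinv z (- / (z * z)).
Proof.
  move=> Hz eps He.
  have Pz : 0 < Cmod z := proj1 (Cmod_gt_0 z) Hz.
  set Z := Cmod z in Pz.
  (* The remainder is exactly (w - z)^2 / (w z^2). The first bound gives |w| >= Z / 2, so the
     remainder is at most 2 |w - z|^2 / Z^3, and the second bound finishes. *)
  set d := Rmin (Z / 2) (eps * Z ^ 3 / 2).
  have HZ3 : 0 < Z ^ 3 by apply: pow_lt.
  have Hd : 0 < d by apply: Rmin_glb_lt; [lra | nra].
  exists d; split => // w /Rmin_Rgt_l [H1 H2].
  have Hw : Z / 2 <= Cmod w.
  { have := Cmod_triangle_inv z w. rewrite Cmod_minus_sym -/Z. lra. }
  have Hw0 : w <> 0%C.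
  { move=> E; move: Hw; rewrite E Cmod_0; lra. }
  have -> : (/ w - / z - - / (z * z) * (w - z) = (w - z) * (w - z) / (w * (z * z)))%C by field.
  rewrite Cmod_div; last by repeat apply: Cmult_neq_0.
  rewrite !Cmod_mult -/Z.
  set W := Cmod (w - z) in H1 H2 *.
  have HW : 0 <= W by apply: Cmod_ge_0.
  have P : 0 < Cmod w * (Z * Z) by apply: Rmult_lt_0_compat; nra.
  apply: (Rmult_le_reg_r _ _ _ P).
  have -> : W * W / (Cmod w * (Z * Z)) * (Cmod w * (Z * Z)) = W * W by field; lra.
  have : W * W <= W * (eps * Z ^ 3 / 2) by apply: Rmult_le_compat_l; lra.
  have : eps * W * (Z / 2 * (Z * Z)) <= eps * W * (Cmod w * (Z * Z)).
  { apply: Rmult_le_compat_l; nra. }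
  lra.
Qed.

Lemma cdiff_ext f g z l d : 0 < d -> (forall w, Cmod (w - z) < d -> f w = g w) ->
  cdiff f z l -> cdiff g z l.
Proof.
  move=> Hd E H eps He. case: (H eps He) => d' [Hd' Hw].
  exists (Rmin d d'); split; first exact: Rmin_glb_lt.
  move=> w /Rmin_Rgt_l [H1 H2]. rewrite -E // -E; first exact: Hw.
  have -> : (z - z = 0)%C by ring. by rewrite Cmod_0.
Qed.

Lemma cdiff_eq f z l m : cdiff f z l -> l = m -> cdiff f z m.
Proof. by move=> H <-. Qed.

Lemma cdiff_scal f z l c : cdiff f z l -> cdiff (fun w => c * f w)%C z (c * l).
Proof.
  move=> H. apply: (cdiff_eq _ _ _ _ (cdiff_mult _ _ _ _ _ (cdiff_const c z) H)). ring.
Qed.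

Lemma cdiff_minus f g z l m : cdiff f z l -> cdiff g z m -> cdiff (fun w => f w - g w)%C z (l - m).
Proof.
  move=> Hf Hg. have := cdiff_plus _ _ _ _ _ Hf (cdiff_scal _ _ _ (- (1))%C Hg).
  move=> H eps He. case: (H eps He) => d [Hd Hw]. exists d; split => // w Hm.
  have := Hw w Hm. congr (_ <= _). congr Cmod. ring.
Qed.

(** At [n = 0] the truncated exponent [n - 1] is harmless because the factor [INR n] vanishes. *)
Lemma cdiff_pow n z : cdiff (fun w => w ^ n)%C z (INR n * z ^ (n - 1)).
Proof.
  elim: n => [|n IH].
  - apply: (cdiff_eq _ _ _ _ (cdiff_const 1 z)). simpl; ring.
  - apply: (cdiff_eq _ _ _ _ (cdiff_mult _ _ _ _ _ (cdiff_id z) IH)).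
    rewrite S_INR RtoC_plus. case: n {IH} => [|n]; first by simpl; ring.
    have -> : (S (S n) - 1 = S n)%nat by lia. have -> : (S n - 1 = n)%nat by lia.
    rewrite !Cpow_S. ring.
Qed.

Lemma cdiff_d1 f z l : cdiff f z l -> d1 f z = l.
Proof. move=> /cdiff_is_derive H. exact: is_C_derive_unique. Qed.

Lemma holo_cdiff f : holo f <-> forall z, inD z -> cdiff f z (d1 f z).
Proof.
  split => H z Hz.
  - case: (H z Hz) => l /cdiff_is_derive Hl. by rewrite (cdiff_d1 _ _ _ Hl).
  - exists (d1 f z). apply/cdiff_is_derive. exact: H.
Qed.

Lemma inD_open z : inD z -> exists d, 0 < d /\ forall w, Cmod (w - z) < d -> inD w.
Proof.
  rewrite /inD => H. exists (1 - Cmod z); split; first lra.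
  move=> w Hw. have := Cmod_triangle_inv w z. lra.
Qed.

(** Holomorphy and the linearity of compact operators constrain values on the disk only, so
    derivatives have to be transferred between functions that may differ outside it. *)
Lemma cdiff_ext_D f g z l : inD z -> (forall w, inD w -> f w = g w) -> cdiff f z l -> cdiff g z l.
Proof.
  move=> Hz E. case: (inD_open z Hz) => d [Hd Hw]. apply: (cdiff_ext _ _ _ _ d Hd) => w Hm.
  by apply: E; apply: Hw.
Qed.

(** * Integrals of complex-valued functions *)

Definition rcont (f : R -> C) (t : R) : Prop :=
  continuous (fun x => Re (f x)) t /\ continuous (fun x => Im (f x)) t.

Definition rdiff (f : R -> C) (t : R) (l : C) : Prop :=
  is_derive (fun x => Re (f x)) t (Re l) /\ is_derive (fun x => Im (f x)) t (Im l).

(** Taken componentwise, so that each integration rule reduces to its real counterpart for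
    [RInt]. *)
Definition CI (f : R -> C) (a b : R) : C :=
  (RInt (fun t => Re (f t)) a b, RInt (fun t => Im (f t)) a b).

Lemma Cmod_le_abs (z : C) : Cmod z <= Rabs (Re z) + Rabs (Im z).
Proof.
  rewrite /Cmod /Re /Im.
  have H1 := Rabs_pos (fst z). have H2 := Rabs_pos (snd z).
  rewrite -(sqrt_pow2 (Rabs (fst z) + Rabs (snd z))); last lra.
  apply: sqrt_le_1_alt. rewrite -(pow2_abs (fst z)) -(pow2_abs (snd z)). nra.
Qed.

Lemma Im_le_Cmod (z : C) : Rabs (Im z) <= Cmod z.
Proof. have := Rmax_Cmod z. have := Rmax_r (Rabs (fst z)) (Rabs (snd z)). rewrite /Im. lra. Qed.

Lemma continuous_eps (f : R -> R) t : continuous f t <-> forall eps, 0 < eps -> exists d, 0 < d /\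
  forall s, Rabs (s - t) < d -> Rabs (f s - f t) < eps.
Proof.
  split.
  - move=> H eps He. case: (proj1 (filterlim_locally _ _) H (mkposreal eps He)) => d Hd.
    exists d; split; first exact: cond_pos. move=> s Hs. exact: (Hd s Hs).
  - move=> H. apply/filterlim_locally => eps.
    case: (H eps (cond_pos eps)) => d [Hd Hs]. exists (mkposreal d Hd) => s Hb. exact: (Hs s Hb).
Qed.

Lemma rcont_eps f t : rcont f t <-> forall eps, 0 < eps -> exists d, 0 < d /\
  forall s, Rabs (s - t) < d -> Cmod (f s - f t) < eps.
Proof.
  split.
  - move=> [/continuous_eps H1 /continuous_eps H2] eps He.
    case: (H1 (eps / 2) ltac:(lra)) => d [Hd Hs]. case: (H2 (eps / 2) ltac:(lra)) => d' [Hd' Hs'].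
    exists (Rmin d d'); split; first exact: Rmin_glb_lt. move=> s /Rmin_Rgt_l [A1 A2].
    have := Hs s A1. have := Hs' s A2. have := Cmod_le_abs (f s - f t).
    rewrite /Cminus /Cplus /Copp /Re /Im /=. rewrite /Rminus. lra.
  - move=> H. split; apply/continuous_eps => eps He; case: (H eps He) => d [Hd Hs];
    exists d; split => // s A1; have := Hs s A1.
    + have := re_le_Cmod (f s - f t). rewrite {1}/Cminus /Cplus /Copp /Re /Im /= /Rminus. lra.
    + have := Im_le_Cmod (f s - f t). rewrite {1}/Cminus /Cplus /Copp /Re /Im /= /Rminus. lra.
Qed.

Lemma rcont_const c t : rcont (fun _ => c) t.
Proof. split; exact: continuous_const. Qed.

Lemma rcont_plus f g t : rcont f t -> rcont g t -> rcont (fun x => f x + g x)%C t.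
Proof.
  move=> [H1 H2] [H3 H4]; split.
  - exact: (continuous_plus (fun x => Re (f x)) (fun x => Re (g x))).
  - exact: (continuous_plus (fun x => Im (f x)) (fun x => Im (g x))).
Qed.

Lemma rcont_minus f g t : rcont f t -> rcont g t -> rcont (fun x => f x - g x)%C t.
Proof.
  move=> [H1 H2] [H3 H4]; split.
  - exact: (continuous_minus (fun x => Re (f x)) (fun x => Re (g x))).
  - exact: (continuous_minus (fun x => Im (f x)) (fun x => Im (g x))).
Qed.

Lemma rcont_mult f g t : rcont f t -> rcont g t -> rcont (fun x => f x * g x)%C t.
Proof.
  move=> [H1 H2] [H3 H4]; split; rewrite /Cmult /Re /Im /=.
  - apply: (continuous_minus (fun x => fst (f x) * fst (g x)) (fun x => snd (f x) * snd (g x)));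
    exact: (continuous_mult (fun x => _ (f x)) (fun x => _ (g x))).
  - apply: (continuous_plus (fun x => fst (f x) * snd (g x)) (fun x => snd (f x) * fst (g x)));
    exact: (continuous_mult (fun x => _ (f x)) (fun x => _ (g x))).
Qed.

Lemma rcont_comp (g : C -> C) f t l : cdiff g (f t) l -> rcont f t -> rcont (fun x => g (f x)) t.
Proof.
  move=> Hg /rcont_eps Hf. apply/rcont_eps => eps He.
  case: (cdiff_cont _ _ _ Hg (eps / 2) ltac:(lra)) => d [Hd Hw].
  case: (Hf d Hd) => d' [Hd' Hs]. exists d'; split => // s A1.
  have := Hw _ (Hs s A1). lra.
Qed.

Lemma rdiff_rcont f t l : rdiff f t l -> rcont f t.
Proof. by move=> [H1 H2]; split; apply: ex_derive_continuous; eexists; eassumption. Qed.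

Lemma rdiff_mult f g t l m : rdiff f t l -> rdiff g t m ->
  rdiff (fun x => f x * g x)%C t (l * g t + f t * m).
Proof.
  move=> [H1 H2] [H3 H4]. split.
  - have -> : Re (l * g t + f t * m) = (Re l * Re (g t) + Re (f t) * Re m) - (Im l * Im (g t) + Im (f t) * Im m).
    { rewrite /Re /Im /=. ring. }
    apply: (is_derive_minus (fun x => Re (f x) * Re (g x)) (fun x => Im (f x) * Im (g x)));
    apply: is_derive_mult => //; exact: Rmult_comm.
  - have -> : Im (l * g t + f t * m) = (Re l * Im (g t) + Re (f t) * Im m) + (Im l * Re (g t) + Im (f t) * Re m).
    { rewrite /Re /Im /=. ring. }
    apply: (is_derive_plus (fun x => Re (f x) * Im (g x)) (fun x => Im (f x) * Re (g x)));
    apply: is_derive_mult => //; exact: Rmult_comm.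
Qed.

Lemma rdiff_plus f g t l m : rdiff f t l -> rdiff g t m -> rdiff (fun x => f x + g x)%C t (l + m).
Proof.
  move=> [H1 H2] [H3 H4]; split.
  - exact: (is_derive_plus (fun x => Re (f x)) (fun x => Re (g x))).
  - exact: (is_derive_plus (fun x => Im (f x)) (fun x => Im (g x))).
Qed.

Lemma rdiff_const c t : rdiff (fun _ => c) t 0.
Proof. split; exact: is_derive_const. Qed.

Lemma rdiff_of_cdiff (F : C -> C) (t : R) l : cdiff F (RtoC t) l -> rdiff (fun s => F (RtoC s)) t l.
Proof.
  move=> H.
  have K : forall eps : posreal, exists d, 0 < d /\ forall s, Rabs (s - t) < d ->
    Cmod (F (RtoC s) - F (RtoC t) - l * (s - t)) <= eps * Rabs (s - t).
  { move=> eps. case: (H eps (cond_pos eps)) => d [Hd Hw]. exists d; split => // s A1.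
    have := Hw (RtoC s). rewrite -RtoC_minus Cmod_R => Q. exact: (Q A1). }
  split; (split; [exact: is_linear_scal_l|]); move=> x Hx eps;
  have Hzx := @is_filter_lim_locally_unique R_AbsRing (AbsRing_NormedModule R_AbsRing) t x Hx; subst x;
  case: (K eps) => d [Hd Hs]; exists (mkposreal d Hd) => s A1.
  - have E : Re (F (RtoC s) - F (RtoC t) - l * (RtoC s - RtoC t)) =
      minus (minus (Re (F (RtoC s))) (Re (F (RtoC t)))) (scal (minus s t) (Re l)).
    { rewrite /minus /plus /opp /scal /= /mult /Re /Im /=; ring. }
    rewrite -E. exact: (Rle_trans _ _ _ (re_le_Cmod _) (Hs s A1)).
  - have E : Im (F (RtoC s) - F (RtoC t) - l * (RtoC s - RtoC t)) =
      minus (minus (Im (F (RtoC s))) (Im (F (RtoC t)))) (scal (minus s t) (Im l)).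
    { rewrite /minus /plus /opp /scal /= /mult /Re /Im /=; ring. }
    rewrite -E. exact: (Rle_trans _ _ _ (Im_le_Cmod _) (Hs s A1)).
Qed.

Definition rcont_on (f : R -> C) a b : Prop := forall t, a <= t <= b -> rcont f t.

Lemma rcont_on_ex f a b : a <= b -> rcont_on f a b ->
  ex_RInt (fun t => Re (f t)) a b /\ ex_RInt (fun t => Im (f t)) a b.
Proof.
  move=> Hab H; split; apply: (@ex_RInt_continuous R_CompleteNormedModule) => z;
  rewrite Rmin_left // Rmax_right // => Hz; by case: (H z Hz).
Qed.

Lemma CI_bound f a b M : a <= b -> rcont_on f a b ->
  (forall t, a <= t <= b -> Cmod (f t) <= M) -> Cmod (CI f a b) <= (b - a) * M.
Proof.
  move=> Hab Hc HM. case: (rcont_on_ex f a b Hab Hc) => H1 H2.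
  (* The product norm on pairs is Euclidean, hence equal to [Cmod]; estimating the two components
     separately would lose a constant factor. *)
  have N : forall z : C, @norm R_AbsRing C_R_NormedModule z = Cmod z.
  { move=> z. rewrite /norm /= /prod_norm /= /norm /= /abs /= /Cmod.
    rewrite !Rmult_1_r -!Rabs_mult. have P : forall x, Rabs (x * x) = x * x by move=> x; apply: Rabs_pos_eq; nra.
    rewrite !P. congr sqrt. ring. }
  rewrite -N. apply: (@norm_RInt_le_const C_R_NormedModule f a b _ M Hab).
  - move=> t Ht. rewrite N. exact: HM.
  - apply: (@is_RInt_fct_extend_pair R_NormedModule R_NormedModule).
    + exact: (@RInt_correct R_CompleteNormedModule).
    + exact: (@RInt_correct R_CompleteNormedModule).
Qed.

Lemma CI_Chasles f a b c : a <= b -> b <= c -> rcont_on f a c -> (CI f a b + CI f b c)%C = CI f a c.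
Proof.
  move=> H1 H2 H.
  case: (rcont_on_ex f a b H1) => [t Ht|E1 E2]; first by apply: H; lra.
  case: (rcont_on_ex f b c H2) => [t Ht|E3 E4]; first by apply: H; lra.
  by rewrite /CI /Cplus /=; congr (_, _); apply: (@RInt_Chasles R_CompleteNormedModule).
Qed.

Lemma CI_minus f g a b : a <= b -> rcont_on f a b -> rcont_on g a b ->
  CI (fun t => f t - g t)%C a b = (CI f a b - CI g a b)%C.
Proof.
  move=> Hab Hf Hg. case: (rcont_on_ex f a b Hab Hf) => E1 E2. case: (rcont_on_ex g a b Hab Hg) => E3 E4.
  rewrite /CI /Cminus /Cplus /Copp /=; congr (_, _).
  - exact: (@RInt_minus R_CompleteNormedModule (fun t => Re (f t)) (fun t => Re (g t))).
  - exact: (@RInt_minus R_CompleteNormedModule (fun t => Im (f t)) (fun t => Im (g t))).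
Qed.

Lemma CI_plus f g a b : a <= b -> rcont_on f a b -> rcont_on g a b ->
  CI (fun t => f t + g t)%C a b = (CI f a b + CI g a b)%C.
Proof.
  move=> Hab Hf Hg. case: (rcont_on_ex f a b Hab Hf) => E1 E2. case: (rcont_on_ex g a b Hab Hg) => E3 E4.
  rewrite /CI /Cplus /Copp /=; congr (_, _).
  - exact: (@RInt_plus R_CompleteNormedModule (fun t => Re (f t)) (fun t => Re (g t))).
  - exact: (@RInt_plus R_CompleteNormedModule (fun t => Im (f t)) (fun t => Im (g t))).
Qed.

Lemma CI_scal c f a b : a <= b -> rcont_on f a b -> CI (fun t => c * f t)%C a b = (c * CI f a b)%C.
Proof.
  move=> Hab Hf. case: (rcont_on_ex f a b Hab Hf) => E1 E2.
  have S : forall (k : R) (h : R -> R), ex_RInt h a b -> ex_RInt (fun t => k * h t) a b.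
  { move=> k h. exact: (@ex_RInt_scal R_NormedModule h). }
  have S' : forall (k : R) (h : R -> R), ex_RInt h a b -> RInt (fun t => k * h t) a b = k * RInt h a b.
  { move=> k h. exact: (@RInt_scal R_CompleteNormedModule h). }
  rewrite /CI /Cmult /=; congr (_, _).
  - etransitivity; first apply: (@RInt_minus R_CompleteNormedModule (fun t => fst c * Re (f t)) (fun t => snd c * Im (f t))).
    + exact: S. + exact: S. + by rewrite !S'.
  - etransitivity; first apply: (@RInt_plus R_CompleteNormedModule (fun t => fst c * Im (f t)) (fun t => snd c * Re (f t))).
    + exact: S. + exact: S. + by rewrite !S'.
Qed.

Lemma CI_ext f g a b : a <= b -> (forall t, a <= t <= b -> f t = g t) -> CI f a b = CI g a b.
Proof.
  move=> Hab H. rewrite /CI; congr (_, _); apply: RInt_ext => t;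
  rewrite Rmin_left // Rmax_right // => Ht; rewrite H //; lra.
Qed.

Lemma CI_const c a b : CI (fun _ => c) a b = ((b - a)%R * c)%C.
Proof.
  rewrite /CI !(@RInt_const R_CompleteNormedModule) /scal /= /mult /=.
  rewrite {3}(surjective_pairing c) /Cmult /Re /Im /=. congr (_, _); ring.
Qed.

Lemma CI_derive F f a b : a <= b -> (forall t, a <= t <= b -> rdiff F t (f t)) -> rcont_on f a b ->
  CI f a b = (F b - F a)%C.
Proof.
  move=> Hab HF Hf. rewrite /CI /Cminus /Cplus /Copp /=; congr (_, _).
  - apply: is_RInt_unique. apply: (@is_RInt_derive R_CompleteNormedModule (fun t => Re (F t)) (fun t => Re (f t)));
    rewrite Rmin_left // Rmax_right // => t Ht; [by case: (HF t Ht) | by case: (Hf t Ht)].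
  - apply: is_RInt_unique. apply: (@is_RInt_derive R_CompleteNormedModule (fun t => Im (F t)) (fun t => Im (f t)));
    rewrite Rmin_left // Rmax_right // => t Ht; [by case: (HF t Ht) | by case: (Hf t Ht)].
Qed.

(** * Goursat's theorem *)

Lemma nested_limit (a b : nat -> R) : (forall n, a n <= a (S n)) -> (forall n, b (S n) <= b n) ->
  (forall n, a n <= b n) -> exists x, forall n, a n <= x <= b n.
Proof.
  move=> Ha Hb Hab.
  have Ma : forall n k, a n <= a (n + k)%nat.
  { move=> n; elim=> [|k IH]; first by rewrite Nat.add_0_r; lra.
    rewrite Nat.add_succ_r. have := Ha (n + k)%nat. lra. }
  have Mb : forall n k, b (n + k)%nat <= b n.
  { move=> n; elim=> [|k IH]; first by rewrite Nat.add_0_r; lra.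
    rewrite Nat.add_succ_r. have := Hb (n + k)%nat. lra. }
  have X : forall n m, a n <= b m.
  { move=> n m. have := Ma n m. have := Mb m n. have := Hab (n + m)%nat.
    rewrite (Nat.add_comm m n). lra. }
  case: (completeness (fun x => exists n, x = a n)).
  - exists (b 0%nat) => _ [n ->]. exact: X.
  - by exists (a 0%nat), 0%nat.
  - move=> x [U L]. exists x => n; split.
    + apply: U. by exists n.
    + apply: L => _ [m ->]. exact: X.
Qed.

Lemma geom_small q c e : 0 <= q < 1 -> 0 <= c -> 0 < e -> exists N, forall n, (N <= n)%nat -> q ^ n * c <= e.
Proof.
  move=> Hq Hc He.
  case: (pow_lt_1_zero q _ (e / (c + 1))) => [||N HN]; first by rewrite Rabs_pos_eq; lra.
  { apply: Rdiv_lt_0_compat; lra. }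
  exists N => n Hn. have := HN n Hn. rewrite Rabs_pos_eq; last by apply: pow_le; lra.
  move=> H. have : q ^ n * (c + 1) <= e / (c + 1) * (c + 1) by apply: Rmult_le_compat_r; lra.
  have -> : e / (c + 1) * (c + 1) = e by field; lra.
  have : 0 <= q ^ n by apply: pow_le; lra. lra.
Qed.

(** Goursat's argument for an arbitrary rectangle function: repeatedly keep a quarter that carries
    at least a quarter of the modulus. After n steps the value is at least [eta / 4 ^ n], while at
    the limit point it is an arbitrarily small multiple of the squared side lengths, which also
    decay like [4 ^ (- n)]. *)
Lemma rect_bisection (B : R -> R -> R -> R -> C) a0 b0 c0 d0 : a0 <= b0 -> c0 <= d0 ->
  (forall a b c d, a0 <= a -> a <= b -> b <= b0 -> c0 <= c -> c <= d -> d <= d0 ->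
     B a b c d = (B a ((a+b)/2)%R c ((c+d)/2)%R + B ((a+b)/2)%R b c ((c+d)/2)%R
                 + B a ((a+b)/2)%R ((c+d)/2)%R d + B ((a+b)/2)%R b ((c+d)/2)%R d)%C) ->
  (forall x y, a0 <= x <= b0 -> c0 <= y <= d0 -> forall eps, 0 < eps -> exists del, 0 < del /\
     forall a b c d, a0 <= a <= x -> x <= b <= b0 -> c0 <= c <= y -> y <= d <= d0 ->
       b - a < del -> d - c < del -> Cmod (B a b c d) <= eps * ((b - a) + (d - c)) ^ 2) ->
  B a0 b0 c0 d0 = 0.
Proof.
  move=> Hab Hcd Hadd Hloc.
  case: (classic (B a0 b0 c0 d0 = 0)) => [//|Hne].
  have Heta : 0 < Cmod (B a0 b0 c0 d0) := proj1 (Cmod_gt_0 _) Hne.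
  set eta := Cmod (B a0 b0 c0 d0) in Heta.
  set L := (b0 - a0) + (d0 - c0).
  pose val (q : R * R * R * R) := let '(a, b, c, d) := q in Cmod (B a b c d).
  (* The fourth quarter is the default when the other three fall short; the triangle inequality then
     shows that it qualifies. *)
  pose next (q : R * R * R * R) : R * R * R * R := let '(a, b, c, d) := q in
    let m := (a + b) / 2 in let n := (c + d) / 2 in
    match Rle_dec (val q / 4) (val (a, m, c, n)) with left _ => (a, m, c, n) | right _ =>
    match Rle_dec (val q / 4) (val (m, b, c, n)) with left _ => (m, b, c, n) | right _ =>
    match Rle_dec (val q / 4) (val (a, m, n, d)) with left _ => (a, m, n, d) | right _ => (m, b, n, d)
    end end end.
  pose Q n := Nat.iter n next (a0, b0, c0, d0).
  pose A n := let '(a, b, c, d) := Q n in a. pose B' n := let '(a, b, c, d) := Q n in b.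
  pose C' n := let '(a, b, c, d) := Q n in c. pose D' n := let '(a, b, c, d) := Q n in d.
  have Inv : forall n, a0 <= A n /\ A n <= B' n /\ B' n <= b0 /\ c0 <= C' n /\ C' n <= D' n /\ D' n <= d0 /\
     (B' n - A n = (b0 - a0) * (/ 2) ^ n /\ D' n - C' n = (d0 - c0) * (/ 2) ^ n /\
     eta * ((/ 2) ^ n * (/ 2) ^ n) <= Cmod (B (A n) (B' n) (C' n) (D' n))) /\
     A n <= A (S n) /\ B' (S n) <= B' n /\ C' n <= C' (S n) /\ D' (S n) <= D' n.
  { have Step : forall n, a0 <= A n /\ A n <= B' n /\ B' n <= b0 /\ c0 <= C' n /\ C' n <= D' n /\ D' n <= d0 /\
     (B' n - A n = (b0 - a0) * (/ 2) ^ n /\ D' n - C' n = (d0 - c0) * (/ 2) ^ n /\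
     eta * ((/ 2) ^ n * (/ 2) ^ n) <= Cmod (B (A n) (B' n) (C' n) (D' n))) ->
     (B' (S n) - A (S n) = (b0 - a0) * (/ 2) ^ S n /\ D' (S n) - C' (S n) = (d0 - c0) * (/ 2) ^ S n /\
     eta * ((/ 2) ^ S n * (/ 2) ^ S n) <= Cmod (B (A (S n)) (B' (S n)) (C' (S n)) (D' (S n)))) /\
     A n <= A (S n) <= B' (S n) /\ B' (S n) <= B' n /\ C' n <= C' (S n) <= D' (S n) /\ D' (S n) <= D' n.
    { move=> n. rewrite /A /B' /C' /D'.
      have -> : Q (S n) = next (Q n) by [].
      case: (Q n) => [[[a b] c] d] [H1 [H2 [H3 [H4 [H5 [H6 [H7 [H8 H9]]]]]]]].
      have T := Hadd a b c d H1 H2 H3 H4 H5 H6.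
      rewrite -!tech_pow_Rmult /next /val.
      set p := (/ 2) ^ n in H7 H8 H9 *.
      case: Rle_dec => [K1|K1]; [|case: Rle_dec => [K2|K2]; [|case: Rle_dec => [K3|K3]]];
      try (repeat split; lra).
      have K4 : Cmod (B a b c d) / 4 <= Cmod (B ((a + b) / 2) b ((c + d) / 2) d).
      { have := Cmod_triangle (B a ((a+b)/2)%R c ((c+d)/2)%R + B ((a+b)/2)%R b c ((c+d)/2)%R
                 + B a ((a+b)/2)%R ((c+d)/2)%R d) (B ((a+b)/2)%R b ((c+d)/2)%R d).
        have := Cmod_triangle (B a ((a+b)/2)%R c ((c+d)/2)%R + B ((a+b)/2)%R b c ((c+d)/2)%R) (B a ((a+b)/2)%R ((c+d)/2)%R d).
        have := Cmod_triangle (B a ((a+b)/2)%R c ((c+d)/2)%R) (B ((a+b)/2)%R b c ((c+d)/2)%R).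
        rewrite -T. lra. }
      repeat split; lra. }
    move=> n. have Base : a0 <= A n /\ A n <= B' n /\ B' n <= b0 /\ c0 <= C' n /\ C' n <= D' n /\ D' n <= d0 /\
     (B' n - A n = (b0 - a0) * (/ 2) ^ n /\ D' n - C' n = (d0 - c0) * (/ 2) ^ n /\
     eta * ((/ 2) ^ n * (/ 2) ^ n) <= Cmod (B (A n) (B' n) (C' n) (D' n))).
    { elim: n => [|n IH].
      - rewrite /A /B' /C' /D' /Q /= -/eta. repeat split; lra.
      - case: (Step n IH) => X [[Y1 Y2] [Y3 [[Y4 Y5] Y6]]].
        case: IH => I1 [I2 [I3 [I4 [I5 [I6 I7]]]]].
        do 6 (split; first lra). exact: X. }
    case: (Step n Base) => X [[Y1 Y2] [Y3 [[Y4 Y5] Y6]]].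
    case: Base => I1 [I2 [I3 [I4 [I5 [I6 I7]]]]].
    do 6 (split; first lra). split; first exact: I7. repeat split; lra. }
  case: (nested_limit A B') => [n|n|n|x Hx]; try (by case: (Inv n) => ? [? [? [? [? [? [? [? [? [? ?]]]]]]]]]).
  case: (nested_limit C' D') => [n|n|n|y Hy]; try (by case: (Inv n) => ? [? [? [? [? [? [? [? [? [? ?]]]]]]]]]).
  have HL : 0 <= L by rewrite /L; lra.
  (* With this tolerance the local upper bound at step n is at most half of [eta / 4 ^ n]. The [+ 1]
     covers a degenerate rectangle with [L = 0]. *)
  have He : 0 < eta / (2 * (L ^ 2 + 1)) by apply: Rdiv_lt_0_compat => //; nra.
  have Hx0 := Hx 0%nat. have Hy0 := Hy 0%nat. rewrite /A /B' /C' /D' /= in Hx0 Hy0.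
  case: (Hloc x y Hx0 Hy0 _ He) => del [Hdel Hb].
  case: (geom_small (/ 2) L (del / 2)) => [||| n /(_ n (le_n n)) Hn]; try lra.
  case: (Inv n) => I1 [I2 [I3 [I4 [I5 [I6 [[I7 [I8 I9]] _]]]]]].
  have Hxn := Hx n. have Hyn := Hy n.
  have P : 0 < (/ 2) ^ n by apply: pow_lt; lra.
  set p := (/ 2) ^ n in Hn I7 I8 I9 P.
  have K := Hb (A n) (B' n) (C' n) (D' n) ltac:(lra) ltac:(lra) ltac:(lra) ltac:(lra).
  rewrite I7 I8 in K.
  have Z1 : (b0 - a0) * p < del by rewrite /L in Hn; nra.
  have Z2 : (d0 - c0) * p < del by rewrite /L in Hn; nra.
  have {}K := K Z1 Z2.
  have E : eta / (2 * (L ^ 2 + 1)) * ((b0 - a0) * p + (d0 - c0) * p) ^ 2 =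
     (eta * (p * p)) * (L ^ 2 / (2 * (L ^ 2 + 1))).
  { rewrite /L. field. nra. }
  rewrite E in K.
  have F : L ^ 2 / (2 * (L ^ 2 + 1)) <= / 2.
  { apply: (Rmult_le_reg_r (2 * (L ^ 2 + 1))); first nra.
    have -> : L ^ 2 / (2 * (L ^ 2 + 1)) * (2 * (L ^ 2 + 1)) = L ^ 2 by field; nra. lra. }
  have G : 0 < eta * (p * p) by apply: Rmult_lt_0_compat => //; nra.
  exfalso. nra.
Qed.

(** An affine function has the explicit primitive [H], so its path integral depends on the end
    points only. In [goursat] these end values cancel around the rectangle and only the error of the
    affine approximation is left. *)
Lemma CI_affine_approx (g : C -> C) (c c' : R -> C) p q z0 g0 l K Lam : p <= q ->
  (forall t, p <= t <= q -> rdiff c t (c' t)) -> rcont_on c' p q ->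
  rcont_on (fun t => g (c t)) p q ->
  (forall t, p <= t <= q -> Cmod (g (c t) - (g0 + l * (c t - z0))) <= K) ->
  (forall t, p <= t <= q -> Cmod (c' t) <= Lam) ->
  let H z := (g0 * z + l / 2 * ((z - z0) * (z - z0)))%C in
  Cmod (CI (fun t => g (c t) * c' t)%C p q - (H (c q) - H (c p))) <= (q - p) * (K * Lam).
Proof.
  move=> Hpq Hd Hc' Hg HK HL H.
  have Cc : rcont_on c p q by move=> t Ht; apply: rdiff_rcont; exact: Hd.
  have Ch : rcont_on (fun t => (g0 + l * (c t - z0)) * c' t)%C p q.
  { move=> t Ht. apply: rcont_mult; last exact: Hc'. apply: rcont_plus; first exact: rcont_const.
    apply: rcont_mult; first exact: rcont_const. apply: rcont_minus; last exact: rcont_const. exact: Cc. }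
  have Cg : rcont_on (fun t => g (c t) * c' t)%C p q.
  { move=> t Ht. apply: rcont_mult; [exact: Hg | exact: Hc']. }
  rewrite -(CI_derive (fun t => H (c t)) (fun t => (g0 + l * (c t - z0)) * c' t)%C p q Hpq) //; last first.
  { move=> t Ht. have D := Hd t Ht.
    have D0 : rdiff (fun s => c s + - z0)%C t (c' t + 0) by apply: rdiff_plus => //; exact: rdiff_const.
    have := rdiff_plus _ _ _ _ _ (rdiff_mult _ _ _ _ _ (rdiff_const g0 t) D)
      (rdiff_mult _ _ _ _ _ (rdiff_const (l / 2)%C t) (rdiff_mult _ _ _ _ _ D0 D0)).
    have -> : (0 * c t + g0 * c' t + (0 * ((c t + - z0) * (c t + - z0)) +
      l / 2 * ((c' t + 0) * (c t + - z0) + (c t + - z0) * (c' t + 0))) = (g0 + l * (c t - z0)) * c' t)%C.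
    { field. }
    by []. }
  rewrite -CI_minus //. apply: CI_bound => //.
  { move=> t Ht. apply: rcont_minus; [exact: Cg | exact: Ch]. }
  move=> t Ht.
  have -> : (g (c t) * c' t - (g0 + l * (c t - z0)) * c' t = (g (c t) - (g0 + l * (c t - z0))) * c' t)%C by ring.
  rewrite Cmod_mult. apply: Rmult_le_compat; try exact: Cmod_ge_0; [exact: HK | exact: HL].
Qed.

(** The integral of g dz along the image under [gam] of the boundary of the parameter rectangle,
    with [gs] and [gt] as partial derivatives of [gam]. The orientation is clockwise: up the side s
    = a, along t = d, and back. *)
Definition boundary_int (g : C -> C) (gam gs gt : R -> R -> C) (a b c d : R) : C :=
  (CI (fun t => g (gam a t) * gt a t) c d + CI (fun s => g (gam s d) * gs s d) a b
   - CI (fun t => g (gam b t) * gt b t) c d - CI (fun s => g (gam s c) * gs s c) a b)%C.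

(** Bisecting in the parameter plane makes the shape of the image irrelevant: the Lipschitz bound
    [Lam] turns a small parameter rectangle into a small piece of the image, around a point where g
    is differentiable. *)
Lemma goursat (g : C -> C) (gam gs gt : R -> R -> C) a b c d Lam : a <= b -> c <= d ->
  (forall s t, a <= s <= b -> c <= t <= d -> rdiff (fun s => gam s t) s (gs s t)) ->
  (forall s t, a <= s <= b -> c <= t <= d -> rdiff (gam s) t (gt s t)) ->
  (forall s t, a <= s <= b -> c <= t <= d -> rcont (fun s => gs s t) s) ->
  (forall s t, a <= s <= b -> c <= t <= d -> rcont (gt s) t) ->
  (forall s t, a <= s <= b -> c <= t <= d -> Cmod (gs s t) <= Lam /\ Cmod (gt s t) <= Lam) ->
  (forall s t s' t', a <= s <= b -> c <= t <= d -> a <= s' <= b -> c <= t' <= d ->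
     Cmod (gam s t - gam s' t') <= Lam * (Rabs (s - s') + Rabs (t - t'))) ->
  (forall s t, a <= s <= b -> c <= t <= d -> exists l, cdiff g (gam s t) l) ->
  boundary_int g gam gs gt a b c d = 0.
Proof.
  move=> Hab Hcd Ds Dt Cs Ct Hb HLip Hg.
  have HL0 : 0 <= Lam.
  { case: (Hb a c) => [||H _]; try lra. have := Cmod_ge_0 (gs a c). lra. }
  have Cgs : forall s t, a <= s <= b -> c <= t <= d -> rcont (fun s => g (gam s t)) s.
  { move=> s t H1 H2. case: (Hg s t H1 H2) => l Hl. apply: (rcont_comp g (fun s => gam s t) s l Hl).
    apply: rdiff_rcont. exact: Ds. }
  have Cgt : forall s t, a <= s <= b -> c <= t <= d -> rcont (fun t => g (gam s t)) t.
  { move=> s t H1 H2. case: (Hg s t H1 H2) => l Hl. apply: (rcont_comp g (gam s) t l Hl).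
    apply: rdiff_rcont. exact: Dt. }
  apply: rect_bisection => //.
  - move=> a' b' c' d' H1 H2 H3 H4 H5 H6. rewrite /boundary_int.
    have X : forall s, a <= s <= b -> (CI (fun t => g (gam s t) * gt s t) c' ((c' + d') / 2)%R +
       CI (fun t => g (gam s t) * gt s t) ((c' + d') / 2)%R d' = CI (fun t => g (gam s t) * gt s t) c' d')%C.
    { move=> s Hs. apply: CI_Chasles; try lra. move=> t Ht. apply: rcont_mult; [apply: Cgt | apply: Ct]; lra. }
    have Y : forall t, c <= t <= d -> (CI (fun s => g (gam s t) * gs s t) a' ((a' + b') / 2)%R +
       CI (fun s => g (gam s t) * gs s t) ((a' + b') / 2)%R b' = CI (fun s => g (gam s t) * gs s t) a' b')%C.
    { move=> t Ht. apply: CI_Chasles; try lra. move=> s Hs. apply: rcont_mult; [apply: Cgs | apply: Cs]; lra. }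
    rewrite -(X a') -?(X b') -?(Y d') -?(Y c'); try lra. ring.
  - move=> x y Hx Hy eps He.
    case: (Hg x y Hx Hy) => l Hl.
    (* The four sides have total length 2 [sg], the affine error is at most [e * (Lam * sg)] and the
       speed at most [Lam], so the total is 2 [e] Lam^2 sg^2. The [+ 1] covers [Lam = 0]. *)
    have He' : 0 < eps / (2 * (Lam + 1) ^ 2) by apply: Rdiv_lt_0_compat => //; nra.
    case: (Hl _ He') => del [Hdel Hw]. set e := eps / (2 * (Lam + 1) ^ 2) in He' Hw.
    exists (del / (2 * (Lam + 1))); split; first by apply: Rdiv_lt_0_compat => //; nra.
    move=> a' b' c' d' H1 H2 H3 H4 H5 H6.
    set sg := (b' - a') + (d' - c').
    have Hsg : 0 <= sg by rewrite /sg; lra.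
    have Hsd : Lam * sg < del.
    { have : (Lam + 1) * sg < (Lam + 1) * (2 * (del / (2 * (Lam + 1)))) by apply: Rmult_lt_compat_l; rewrite /sg; lra.
      have -> : (Lam + 1) * (2 * (del / (2 * (Lam + 1)))) = del by field; lra. nra. }
    set z0 := gam x y in Hl Hw.
    have K : forall s t, a' <= s <= b' -> c' <= t <= d' ->
      Cmod (g (gam s t) - (g z0 + l * (gam s t - z0))) <= e * (Lam * sg).
    { move=> s t Hs Ht.
      have D : Cmod (gam s t - z0) <= Lam * sg.
      { eapply Rle_trans; first (apply: HLip; lra). apply: Rmult_le_compat_l => //.
        have : Rabs (s - x) <= b' - a' by apply: Rabs_le; lra.
        have : Rabs (t - y) <= d' - c' by apply: Rabs_le; lra. rewrite /sg; lra. }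
      have -> : (g (gam s t) - (g z0 + l * (gam s t - z0)) = g (gam s t) - g z0 - l * (gam s t - z0))%C by ring.
      eapply Rle_trans; first (apply: Hw; lra).
      apply: Rmult_le_compat_l; lra. }
    have T : forall s, a' <= s <= b' -> _ := fun s Hs =>
      CI_affine_approx g (gam s) (gt s) c' d' z0 (g z0) l (e * (Lam * sg)) Lam ltac:(lra)
       (fun t Ht => Dt s t ltac:(lra) ltac:(lra)) (fun t Ht => Ct s t ltac:(lra) ltac:(lra))
       (fun t Ht => Cgt s t ltac:(lra) ltac:(lra)) (fun t Ht => K s t Hs Ht)
       (fun t Ht => proj2 (Hb s t ltac:(lra) ltac:(lra))).
    have S : forall t, c' <= t <= d' -> _ := fun t Ht =>
      CI_affine_approx g (fun s => gam s t) (fun s => gs s t) a' b' z0 (g z0) l (e * (Lam * sg)) Lam ltac:(lra)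
       (fun s Hs => Ds s t ltac:(lra) ltac:(lra)) (fun s Hs => Cs s t ltac:(lra) ltac:(lra))
       (fun s Hs => Cgs s t ltac:(lra) ltac:(lra)) (fun s Hs => K s t Hs Ht)
       (fun s Hs => proj1 (Hb s t ltac:(lra) ltac:(lra))).
    have T1 := T a' ltac:(lra). have T2 := T b' ltac:(lra).
    have S1 := S c' ltac:(lra). have S2 := S d' ltac:(lra).
    move: T1 T2 S1 S2 => /= {T S}. rewrite /boundary_int.
    set H := fun z => (g z0 * z + l / 2 * ((z - z0) * (z - z0)))%C.
    rewrite -!/(H _).
    set I1 := CI _ c' d'. set I2 := CI _ c' d'. set J1 := CI _ a' b'. set J2 := CI _ a' b'.
    move=> T1 T2 S1 S2.
    have -> : (I1 + J2 - I2 - J1 = (I1 - (H (gam a' d') - H (gam a' c'))) + (J2 - (H (gam b' d') - H (gam a' d')))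
       - (I2 - (H (gam b' d') - H (gam b' c'))) - (J1 - (H (gam b' c') - H (gam a' c'))))%C by ring.
    eapply Rle_trans; first apply: Cmod_triangle_minus.
    have W1 := Cmod_triangle_minus ((I1 - (H (gam a' d') - H (gam a' c'))) + (J2 - (H (gam b' d') - H (gam a' d')))) (I2 - (H (gam b' d') - H (gam b' c'))).
    have W2 := Cmod_triangle (I1 - (H (gam a' d') - H (gam a' c'))) (J2 - (H (gam b' d') - H (gam a' d'))).
    have : eps * sg ^ 2 = e * (2 * (Lam + 1) ^ 2) * sg ^ 2 by rewrite /e; field; lra.
    have : 2 * sg * (e * (Lam * sg) * Lam) <= e * (2 * (Lam + 1) ^ 2) * sg ^ 2.
    { have -> : 2 * sg * (e * (Lam * sg) * Lam) = (e * (2 * sg ^ 2)) * Lam ^ 2 by ring.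
      have -> : e * (2 * (Lam + 1) ^ 2) * sg ^ 2 = (e * (2 * sg ^ 2)) * (Lam + 1) ^ 2 by ring.
      apply: Rmult_le_compat_l; nra. }
    rewrite /sg in T1 T2 S1 S2 *. lra.
Qed.

(** * Cauchy's formula and its consequences *)

Definition expi (t : R) : C := (cos t, sin t).

Lemma Cmod_expi t : Cmod (expi t) = 1.
Proof.
  rewrite /Cmod /expi /=. have := sin2_cos2 t. rewrite /Rsqr => H.
  have -> : cos t * (cos t * 1) + sin t * (sin t * 1) = 1 by lra. exact: sqrt_1.
Qed.

Lemma rdiff_expi t : rdiff expi t (Ci * expi t).
Proof.
  split; rewrite /Re /Im /expi /=.
  - have -> : 0 * cos t - 1 * sin t = - sin t by ring. exact: is_derive_cos.
  - have -> : 0 * sin t + 1 * cos t = cos t by ring. exact: is_derive_sin.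
Qed.

Lemma rcont_expi t : rcont expi t.
Proof. exact: rdiff_rcont (rdiff_expi t). Qed.

Lemma expi_2PI : expi (2 * PI) = expi 0.
Proof. by rewrite /expi cos_2PI sin_2PI cos_0 sin_0. Qed.

Lemma expi_lip t t' : Cmod (expi t - expi t') <= Rabs (t - t').
Proof.
  have W : forall t t', t' <= t -> Cmod (expi t - expi t') <= t - t'.
  { move=> {}t {}t' H. rewrite -(CI_derive expi (fun x => Ci * expi x)%C t' t H).
    - rewrite -[X in _ <= X]Rmult_1_r. apply: CI_bound => //.
      + move=> x _. apply: rcont_mult; [exact: rcont_const | exact: rcont_expi].
      + move=> x _. rewrite Cmod_mult Cmod_Ci Cmod_expi. lra.
    - move=> x _. exact: rdiff_expi.
    - move=> x _. apply: rcont_mult; [exact: rcont_const | exact: rcont_expi]. }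
  case: (Rle_dec t' t) => H.
  - rewrite Rabs_pos_eq; last lra. exact: W.
  - rewrite Cmod_minus_sym Rabs_minus_sym Rabs_pos_eq; last lra. apply: W; lra.
Qed.

Lemma rdiff_RtoC (h : R -> R) t l : is_derive h t l -> rdiff (fun s => RtoC (h s)) t (RtoC l).
Proof. move=> H; split => //=. exact: is_derive_const. Qed.

Lemma Cmod_small_eq0 (z : C) : (forall e, 0 < e -> Cmod z <= e) -> z = 0.
Proof.
  move=> H. apply: Cmod_eq_0. have := Cmod_ge_0 z.
  case: (Rlt_dec 0 (Cmod z)) => [P|]; last lra. have := H (Cmod z / 2) ltac:(lra). lra.
Qed.

Lemma Cminus_neq_0 (x y : C) : Cmod y < Cmod x -> (x - y)%C <> 0.
Proof.
  move=> H E. have := Cmod_triangle_inv x y. rewrite E Cmod_0. lra.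
Qed.

Lemma cdiff_div_sub f w z l : cdiff f z l -> (z - w)%C <> 0 -> exists m, cdiff (fun x => f x / (x - w))%C z m.
Proof.
  move=> Hf Hz. eexists. apply: cdiff_mult; first exact: Hf.
  apply: (cdiff_comp Cinv (fun x => x - w)%C); first exact: cdiff_inv.
  apply: cdiff_minus; [exact: cdiff_id | exact: cdiff_const].
Qed.

Lemma Cmod_RtoC_pos (x : R) : 0 <= x -> Cmod (RtoC x) = x.
Proof. move=> H. by rewrite Cmod_R Rabs_pos_eq. Qed.

Lemma Cmod_circle r t : 0 <= r -> Cmod (r * expi t) = r.
Proof. move=> H. by rewrite Cmod_mult Cmod_expi Cmod_RtoC_pos // Rmult_1_r. Qed.

(** The homotopy moves the centre from w (s = 0) to 0 (s = 1) while the radius grows from [del] to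
    [rho]. It avoids w because [gam s t - w = r s * expi t - s * w] and [r s > s |w|], thanks to
    [del < rho - |w|]. Dividing dz by z - w removes the radius of the small circle. *)
Lemma circle_deform f rho w del : holo f -> 0 < rho < 1 -> 0 < del < rho - Cmod w ->
  CI (fun t => f (rho * expi t) * (rho * expi t / (rho * expi t - w)))%C 0 (2 * PI) =
  CI (fun t => f (w + del * expi t))%C 0 (2 * PI).
Proof.
  move=> /holo_cdiff Hf Hrho Hdel.
  have Pw := Cmod_ge_0 w. have HPI := PI_RGT_0.
  pose r s := del + s * (rho - del).
  pose gam (s t : R) := (w + RtoC s * (- w) + r s * expi t)%C.
  pose gs (s t : R) := (- w + (rho - del)%R * expi t)%C.
  pose gt (s t : R) := (r s * (Ci * expi t))%C.
  pose g z := (f z / (z - w))%C.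
  have Hr : forall s, 0 <= s <= 1 -> 0 <= r s <= 1 by move=> s Hs; rewrite /r; nra.
  have Hne : forall s t, 0 <= s <= 1 -> (gam s t - w)%C <> 0.
  { move=> s t Hs. rewrite /gam.
    have -> : (w + s * - w + r s * expi t - w = r s * expi t - s * w)%C by ring.
    apply: Cminus_neq_0. case: (Hr s Hs) => H1 _.
    rewrite Cmod_circle // Cmod_mult Cmod_RtoC_pos; last lra. rewrite /r. nra. }
  have Ds : forall s t, 0 <= s <= 1 -> 0 <= t <= 2 * PI -> rdiff (fun s => gam s t) s (gs s t).
  { move=> s t Hs Ht. rewrite /gam.
    have D1 : rdiff (fun s => RtoC s) s 1 by apply: rdiff_RtoC; exact: is_derive_id.
    have D2 : rdiff (fun s => RtoC (r s)) s (rho - del)%R.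
    { apply: rdiff_RtoC. rewrite /r. auto_derive => //. ring. }
    have := rdiff_plus _ _ _ _ _ (rdiff_plus _ _ _ _ _ (rdiff_const w s) (rdiff_mult _ _ _ _ _ D1 (rdiff_const (- w) s)))
      (rdiff_mult _ _ _ _ _ D2 (rdiff_const (expi t) s)).
    have -> : (0 + (1 * - w + s * 0) + ((rho - del)%R * expi t + r s * 0) = gs s t)%C by rewrite /gs; ring.
    by []. }
  have Dt : forall s t, 0 <= s <= 1 -> 0 <= t <= 2 * PI -> rdiff (gam s) t (gt s t).
  { move=> s t Hs Ht. rewrite /gam.
    have := rdiff_plus _ _ _ _ _ (rdiff_const (w + s * - w)%C t) (rdiff_mult _ _ _ _ _ (rdiff_const (r s) t) (rdiff_expi t)).
    have -> : (0 + (0 * expi t + r s * (Ci * expi t)) = gt s t)%C by rewrite /gt; ring.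
    by []. }
  have B0 : boundary_int g gam gs gt 0 1 0 (2 * PI) = 0.
  { apply: (goursat g gam gs gt 0 1 0 (2 * PI) 2); try lra.
    - exact: Ds. - exact: Dt.
    - move=> s t _ _. exact: rcont_const.
    - move=> s t _ _. apply: rcont_mult; first exact: rcont_const.
      apply: rcont_mult; [exact: rcont_const | exact: rcont_expi].
    - move=> s t Hs Ht. split.
      + eapply Rle_trans; first apply: Cmod_triangle. rewrite Cmod_opp Cmod_circle; lra.
      + rewrite /gt !Cmod_mult Cmod_Ci Cmod_expi. case: (Hr s Hs) => H1 H2. rewrite Cmod_RtoC_pos //. lra.
    - move=> s t s' t' Hs Ht Hs' Ht'.
      have -> : (gam s t - gam s' t' = RtoC (s - s') * (- w + (rho - del)%R * expi t) + r s' * (expi t - expi t'))%C.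
      { rewrite /gam /r !RtoC_minus !RtoC_plus !RtoC_mult !RtoC_minus. ring. }
      eapply Rle_trans; first apply: Cmod_triangle. rewrite !Cmod_mult Cmod_R.
      case: (Hr s' Hs') => H1 H2. rewrite (Cmod_RtoC_pos (r s')) //.
      have L := expi_lip t t'.
      have X : Cmod (- w + (rho - del)%R * expi t) <= 2.
      { eapply Rle_trans; first apply: Cmod_triangle. rewrite Cmod_opp Cmod_circle; lra. }
      have := Rabs_pos (s - s'). have := Rabs_pos (t - t'). have := Cmod_ge_0 (expi t - expi t').
      nra.
    - move=> s t Hs Ht. apply: cdiff_div_sub; last exact: Hne. apply: Hf.
      rewrite /inD /gam. have -> : (w + s * - w = RtoC (1 - s) * w)%C by rewrite RtoC_minus; ring.
      eapply Rle_lt_trans; first apply: Cmod_triangle. case: (Hr s Hs) => H1 H2.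
      rewrite Cmod_mult Cmod_circle // Cmod_RtoC_pos; last lra. rewrite /r. nra. }
  rewrite /boundary_int in B0.
  (* The sides t = 0 and t = 2 PI trace the same path, so they cancel and only the two circles
     remain. *)
  have Eq : CI (fun s => g (gam s (2 * PI)%R) * gs s (2 * PI)%R)%C 0 1 = CI (fun s => g (gam s 0) * gs s 0)%C 0 1.
  { apply: CI_ext => [|s _]; first lra. by rewrite /gam /gs expi_2PI. }
  rewrite Eq in B0.
  have Ccont : forall s, 0 <= s <= 1 -> rcont_on (fun t => f (gam s t)) 0 (2 * PI).
  { move=> s Hs t Ht. apply: (rcont_comp f (gam s)); last by apply: rdiff_rcont; apply: Dt.
    apply: Hf. rewrite /inD /gam. have -> : (w + s * - w = RtoC (1 - s) * w)%C by rewrite RtoC_minus; ring.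
      eapply Rle_lt_trans; first apply: Cmod_triangle. case: (Hr s Hs) => H1 H2.
      rewrite Cmod_mult Cmod_circle // Cmod_RtoC_pos; last lra. rewrite /r. nra. }
  have E0 : CI (fun t => g (gam 0 t) * gt 0 t)%C 0 (2 * PI) = (Ci * CI (fun t => f (w + del * expi t))%C 0 (2 * PI))%C.
  { rewrite -CI_scal; first last.
    - move=> t Ht. have := Ccont 0 ltac:(lra) t Ht. rewrite /gam /r.
      apply: (fun (h h' : R -> C) (e : h = h') (H : rcont h t) => eq_ind h (fun h => rcont h t) H h' e).
      apply: functional_extensionality => x. congr f. rewrite Rmult_0_l Rplus_0_r. ring.
    - lra.
    - apply: CI_ext => [|t _]; first lra. rewrite /g /gam /gt /r Rmult_0_l Rplus_0_r.
      have -> : (w + 0 * - w + del * expi t = w + del * expi t)%C by ring. field.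
      have -> : (w + del * expi t - w = del * expi t)%C by ring.
      move=> E. have := Cmod_circle del t ltac:(lra). rewrite E Cmod_0. lra. }
  have E1 : CI (fun t => g (gam 1 t) * gt 1 t)%C 0 (2 * PI) =
    (Ci * CI (fun t => f (rho * expi t) * (rho * expi t / (rho * expi t - w)))%C 0 (2 * PI))%C.
  { have E1 : forall t, gam 1 t = (rho * expi t)%C.
    { move=> t. rewrite /gam /r. have -> : del + 1 * (rho - del) = rho by ring. ring. }
    rewrite -CI_scal; first last.
    - move=> t Ht. apply: rcont_mult.
      + have := Ccont 1 ltac:(lra) t Ht.
        apply: (fun (h h' : R -> C) (e : h = h') (H : rcont h t) => eq_ind h (fun h => rcont h t) H h' e).
        apply: functional_extensionality => x. by rewrite E1.
      + apply: rcont_mult; first (apply: rcont_mult; [exact: rcont_const | exact: rcont_expi]).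
        have N : (rho * expi t - w)%C <> 0 by rewrite -E1; apply: Hne; lra.
        apply: (rcont_comp Cinv _ t _ (cdiff_inv _ N)). apply: rcont_minus; last exact: rcont_const.
        apply: rcont_mult; [exact: rcont_const | exact: rcont_expi].
    - lra.
    - apply: CI_ext => [|t _]; first lra. have N := Hne 1 t ltac:(lra). rewrite /g /gt. move: N. rewrite E1 => N.
      rewrite /r. have -> : del + 1 * (rho - del) = rho by ring. by field. }
  have K : forall X Y Z : C, (Ci * Y + Z - Ci * X - Z)%C = 0 -> X = Y.
  { move=> X Y Z H. have Z0 : (Ci * (Y - X))%C = 0 by rewrite -H; ring.
    have H' : (Y - X)%C = 0.
    { apply: Cmod_eq_0. have := Cmod_mult Ci (Y - X). rewrite Z0 Cmod_0 Cmod_Ci. lra. }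
    have -> : X = (Y - (Y - X))%C by ring. rewrite H'. ring. }
  rewrite E0 E1 in B0. exact: (K _ _ _ B0).
Qed.

(** By [circle_deform] the integral equals that of f over an arbitrarily small circle around w,
    where continuity of f at w makes it arbitrarily close to 2 PI f(w). *)
Lemma cauchy_formula f rho w : holo f -> 0 < rho < 1 -> Cmod w < rho ->
  CI (fun t => f (rho * expi t) * (rho * expi t / (rho * expi t - w)))%C 0 (2 * PI) = ((2 * PI)%R * f w)%C.
Proof.
  move=> Hf Hrho Hw. have HPI := PI_RGT_0.
  set X := CI _ _ _.
  suff : (X - (2 * PI)%R * f w)%C = 0.
  { move=> H. have -> : X = (X - (2 * PI)%R * f w + (2 * PI)%R * f w)%C by ring. rewrite H. ring. }
  apply: Cmod_small_eq0 => e He.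
  have Hfw := proj1 (holo_cdiff f) Hf.
  have Hin : inD w by rewrite /inD; lra.
  case: (cdiff_cont _ _ _ (Hfw w Hin) (e / (2 * PI))) => [|d [Hd Hb]]; first by apply: Rdiv_lt_0_compat; lra.
  set del := Rmin (d / 2) ((rho - Cmod w) / 2).
  have H1 : 0 < del by apply: Rmin_glb_lt; lra.
  have H2 : del <= d / 2 := Rmin_l _ _.
  have H3 : del <= (rho - Cmod w) / 2 := Rmin_r _ _.
  rewrite /X (circle_deform f rho w del Hf Hrho); last lra.
  have -> : ((2 * PI)%R * f w)%C = CI (fun _ => f w) 0 (2 * PI) by rewrite CI_const; congr (RtoC _ * _)%C; ring.
  have Cc : rcont_on (fun t => f (w + del * expi t)%C) 0 (2 * PI).
  { move=> t Ht. apply: (rcont_comp f (fun t => w + del * expi t)%C).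
    - apply: Hfw. rewrite /inD. eapply Rle_lt_trans; first apply: Cmod_triangle. rewrite Cmod_circle; lra.
    - apply: rcont_plus; first exact: rcont_const. apply: rcont_mult; [exact: rcont_const | exact: rcont_expi]. }
  rewrite -CI_minus //; try lra; last by move=> t _; exact: rcont_const.
  have -> : e = (2 * PI - 0) * (e / (2 * PI)) by field; lra.
  apply: CI_bound; first lra.
  - move=> t Ht. apply: rcont_minus; [exact: Cc | exact: rcont_const].
  - move=> t Ht. apply: Hb. have -> : (w + del * expi t - w = del * expi t)%C by ring.
    rewrite Cmod_circle; lra.
Qed.

Lemma rcont_on_bounded f a b : a <= b -> rcont_on f a b -> exists M, 0 <= M /\ forall t, a <= t <= b -> Cmod (f t) <= M.
Proof.
  move=> Hab H.
  case: (@bounded_continuity R_AbsRing R_NormedModule (fun t => Re (f t)) a b) => [t Ht|M1 H1]; first by case: (H t Ht).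
  case: (@bounded_continuity R_AbsRing R_NormedModule (fun t => Im (f t)) a b) => [t Ht|M2 H2]; first by case: (H t Ht).
  have K : forall t, a <= t <= b -> Cmod (f t) <= M1 + M2.
  { move=> t Ht. have := H1 t Ht. have := H2 t Ht. rewrite /norm /= /abs /=. have := Cmod_le_abs (f t). lra. }
  exists (M1 + M2); split => //. have := K a ltac:(lra). have := Cmod_ge_0 (f a). lra.
Qed.

(** Differentiation under the integral sign; a quadratic remainder uniform in t takes the place of a
    domination argument. *)
Lemma cdiff_CI (K : C -> R -> C) (K1 : R -> C) a b w0 r M : a <= b -> 0 < r -> 0 <= M ->
  (forall w, Cmod (w - w0) < r -> rcont_on (K w) a b) -> rcont_on K1 a b ->
  (forall w t, Cmod (w - w0) < r -> a <= t <= b ->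
     Cmod (K w t - K w0 t - K1 t * (w - w0)) <= M * Cmod (w - w0) ^ 2) ->
  cdiff (fun w => CI (K w) a b) w0 (CI K1 a b).
Proof.
  move=> Hab Hr HM HK HK1 Hb eps He.
  have P : 0 < (b - a) * M + 1 by nra.
  exists (Rmin r (eps / ((b - a) * M + 1))); split.
  { apply: Rmin_glb_lt => //. exact: Rdiv_lt_0_compat. }
  move=> w /Rmin_Rgt_l [H1 H2].
  have H0 : Cmod (w0 - w0) < r by have -> : (w0 - w0)%C = 0 by [ring]; rewrite Cmod_0.
  have C2 : rcont_on (fun t => K1 t * (w - w0))%C a b.
  { move=> t Ht. apply: rcont_mult; [exact: HK1 | exact: rcont_const]. }
  have -> : (CI K1 a b * (w - w0))%C = CI (fun t => K1 t * (w - w0))%C a b.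
  { rewrite Cmult_comm -CI_scal //. apply: CI_ext => // t _. ring. }
  rewrite -CI_minus; [|lra|exact: HK|exact: HK].
  rewrite -CI_minus //; last by move=> t Ht; apply: rcont_minus; apply: HK.
  set W := Cmod (w - w0) in H1 H2 *. have HW : 0 <= W by exact: Cmod_ge_0.
  apply: (Rle_trans _ ((b - a) * (M * W ^ 2))).
  { apply: CI_bound => //.
    - move=> t Ht. apply: rcont_minus; last exact: C2. apply: rcont_minus; exact: HK.
    - move=> t Ht. exact: Hb. }
  have : ((b - a) * M + 1) * W <= ((b - a) * M + 1) * (eps / ((b - a) * M + 1)) by apply: Rmult_le_compat_l; lra.
  have -> : ((b - a) * M + 1) * (eps / ((b - a) * M + 1)) = eps by field; lra.
  nra.
Qed.

Lemma Cmod_inv_le (z : C) d : 0 < d -> d <= Cmod z -> Cmod (/ z) <= / d.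
Proof.
  move=> Hd Hz. have N : z <> 0 by move=> E; rewrite E Cmod_0 in Hz; lra.
  rewrite Cmod_inv //. by apply: Rinv_le_contravar.
Qed.

Lemma circle_sub_ne rho t w : Cmod w < rho -> (rho * expi t - w)%C <> 0.
Proof.
  move=> H. apply: Cminus_neq_0. have := Cmod_ge_0 w => P. rewrite Cmod_circle; lra.
Qed.

Lemma rcont_circle rho t : rcont (fun t => rho * expi t)%C t.
Proof. apply: rcont_mult; [exact: rcont_const | exact: rcont_expi]. Qed.

Lemma rcont_kernel rho w t : Cmod w < rho -> rcont (fun t => / (rho * expi t - w))%C t.
Proof.
  move=> Hw. apply: (rcont_comp Cinv _ t _ (cdiff_inv _ (circle_sub_ne rho t w Hw))).
  apply: rcont_minus; [exact: rcont_circle | exact: rcont_const].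
Qed.

Lemma rcont_holo_circle f rho t : holo f -> 0 <= rho < 1 -> rcont (fun t => f (rho * expi t))%C t.
Proof.
  move=> /holo_cdiff Hf Hrho. apply: (rcont_comp f (fun t => rho * expi t)%C); last exact: rcont_circle.
  apply: Hf. rewrite /inD Cmod_circle; lra.
Qed.

(** The two halves give the first and second derivatives of a Cauchy integral, which is all the
    regularity needed for [holo_d1]. Both remainders are explicit: they are (w - w0)^2 times a
    polynomial in the two kernels 1/(z - w) and 1/(z - w0). *)
Lemma CI_kernel_diff (k : R -> C) rho w0 : rcont_on k 0 (2 * PI) -> Cmod w0 < rho ->
  cdiff (fun w => CI (fun t => k t * / (rho * expi t - w))%C 0 (2 * PI)) w0
    (CI (fun t => k t * (/ (rho * expi t - w0)) ^ 2)%C 0 (2 * PI)) /\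
  cdiff (fun w => CI (fun t => k t * (/ (rho * expi t - w)) ^ 2)%C 0 (2 * PI)) w0
    (CI (fun t => k t * (2 * (/ (rho * expi t - w0)) ^ 3))%C 0 (2 * PI)).
Proof.
  move=> Hk Hw0. have HPI := PI_RGT_0. have Pw := Cmod_ge_0 w0.
  case: (rcont_on_bounded k 0 (2 * PI) ltac:(lra) Hk) => M [HM0 HM].
  (* Half the distance from w0 to the circle: every w within [d] of w0 still lies at distance at
     least [d] from the circle, so the kernels are bounded by 1/d. *)
  set d := (rho - Cmod w0) / 2. have Hd : 0 < d by rewrite /d; lra.
  have Hin : forall w, Cmod (w - w0) < d -> Cmod w < rho.
  { move=> w. have := Cmod_triangle_inv w w0. rewrite /d; lra. }
  have Hq : forall w t, Cmod (w - w0) < d -> Cmod (/ (rho * expi t - w)) <= / d.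
  { move=> w t H. apply: Cmod_inv_le => //. have := Cmod_triangle_inv (rho * expi t) w.
    have := Cmod_triangle_inv w w0. rewrite Cmod_circle; last lra. rewrite /d in H *; lra. }
  have H00 : Cmod (w0 - w0) < d by have -> : (w0 - w0)%C = 0 by [ring]; rewrite Cmod_0.
  have Hq0 := fun t => Hq w0 t H00.
  have Hid : 0 < / d by apply: Rinv_0_lt_compat.
  split.
  - apply: (cdiff_CI _ _ _ _ _ d (M * ((/ d) ^ 2 * / d))); [lra|lra| | | | ].
    + apply: Rmult_le_pos => //. nra.
    + move=> w Hw t Ht. apply: rcont_mult; first exact: Hk. apply: rcont_kernel; exact: Hin.
    + move=> t Ht. apply: rcont_mult; first exact: Hk. simpl.
      apply: rcont_mult; first exact: rcont_kernel. apply: rcont_mult; [exact: rcont_kernel | exact: rcont_const].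
    + move=> w t Hw Ht.
      have N0 := circle_sub_ne rho t w0 Hw0. have N1 := circle_sub_ne rho t w (Hin w Hw).
      have E : (w = w0 + (w - w0))%C by ring.
      have -> : (k t * / (rho * expi t - w) - k t * / (rho * expi t - w0) - k t * (/ (rho * expi t - w0)) ^ 2 * (w - w0)
        = k t * ((w - w0) ^ 2 * ((/ (rho * expi t - w0)) ^ 2 * / (rho * expi t - w))))%C by simpl; field.
      rewrite Cmod_mult Cmod_mult Cmod_pow Cmod_mult Cmod_pow.
      have A1 := Hq w t Hw. have A2 := Hq0 t. have A3 := HM t Ht.
      set q0 := Cmod (/ (rho * expi t - w0)) in A2 *. set q := Cmod (/ (rho * expi t - w)) in A1 *.
      have Q0 : 0 <= q0 by exact: Cmod_ge_0. have Q : 0 <= q by exact: Cmod_ge_0.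
      have -> : Cmod (k t) * (Cmod (w - w0) ^ 2 * (q0 ^ 2 * q)) = (Cmod (k t) * (q0 ^ 2 * q)) * Cmod (w - w0) ^ 2 by ring.
      apply: Rmult_le_compat_r; first by apply: pow2_ge_0.
      apply: Rmult_le_compat => //; first exact: Cmod_ge_0.
      * apply: Rmult_le_pos => //. exact: pow2_ge_0.
      * apply: Rmult_le_compat => //; first exact: pow2_ge_0. apply: pow_incr; lra.
  - apply: (cdiff_CI _ _ _ _ _ d (M * ((/ d) ^ 2 * / d * (2 * / d + / d)))); [lra|lra| | | | ].
    + apply: Rmult_le_pos => //. apply: Rmult_le_pos; [nra | lra].
    + move=> w Hw t Ht. apply: rcont_mult; first exact: Hk. have R1 := rcont_kernel rho w t (Hin w Hw).
      apply: rcont_mult => //. apply: rcont_mult => //. exact: rcont_const.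
    + move=> t Ht. apply: rcont_mult; first exact: Hk. have R1 := rcont_kernel rho w0 t Hw0.
      apply: rcont_mult; first exact: rcont_const. do 3 (apply: rcont_mult => //). exact: rcont_const.
    + move=> w t Hw Ht.
      have N0 := circle_sub_ne rho t w0 Hw0. have N1 := circle_sub_ne rho t w (Hin w Hw).
      have -> : (k t * (/ (rho * expi t - w)) ^ 2 - k t * (/ (rho * expi t - w0)) ^ 2 - k t * (2 * (/ (rho * expi t - w0)) ^ 3) * (w - w0)
        = k t * ((w - w0) ^ 2 * ((/ (rho * expi t - w0)) ^ 2 * / (rho * expi t - w) * (2 * / (rho * expi t - w0) + / (rho * expi t - w)))))%C by simpl; field.
      rewrite Cmod_mult Cmod_mult Cmod_pow Cmod_mult Cmod_mult Cmod_pow.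
      have A1 := Hq w t Hw. have A2 := Hq0 t. have A3 := HM t Ht.
      have A4 := Cmod_triangle (2 * / (rho * expi t - w0)) (/ (rho * expi t - w)).
      rewrite (Cmod_mult 2) (Cmod_RtoC_pos 2) in A4; last lra.
      set q0 := Cmod (/ (rho * expi t - w0)) in A2 A4 *. set q := Cmod (/ (rho * expi t - w)) in A1 A4 *.
      set s := Cmod (_ + _) in A4 *.
      have Q0 : 0 <= q0 by exact: Cmod_ge_0. have Q : 0 <= q by exact: Cmod_ge_0. have S : 0 <= s by exact: Cmod_ge_0.
      have -> : Cmod (k t) * (Cmod (w - w0) ^ 2 * (q0 ^ 2 * q * s)) = (Cmod (k t) * (q0 ^ 2 * q * s)) * Cmod (w - w0) ^ 2 by ring.
      apply: Rmult_le_compat_r; first by apply: pow2_ge_0.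
      have P2 : 0 <= q0 ^ 2 * q by apply: Rmult_le_pos => //; exact: pow2_ge_0.
      apply: Rmult_le_compat => //; first exact: Cmod_ge_0.
      * by apply: Rmult_le_pos.
      * apply: Rmult_le_compat => //; last lra. apply: Rmult_le_compat => //; first exact: pow2_ge_0. apply: pow_incr; lra.
Qed.

Lemma RtoC_2PI_ne : RtoC (2 * PI) <> 0.
Proof. move=> E. injection E. have := PI_RGT_0. lra. Qed.

Lemma cauchy_derivative f rho w : holo f -> 0 < rho < 1 -> Cmod w < rho ->
  d1 f w = (/ (2 * PI)%R * CI (fun t => f (rho * expi t) * (rho * expi t) * (/ (rho * expi t - w)) ^ 2) 0 (2 * PI)%R)%C.
Proof.
  move=> Hf Hrho Hw.
  have Hk : rcont_on (fun t => f (rho * expi t) * (rho * expi t))%C 0 (2 * PI).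
  { move=> t _. apply: rcont_mult; last exact: rcont_circle. apply: rcont_holo_circle => //; lra. }
  case: (CI_kernel_diff _ rho w Hk Hw) => D _.
  apply: cdiff_d1. apply: (cdiff_ext _ _ _ _ (rho - Cmod w) _ _ (cdiff_scal _ _ _ (/ (2 * PI)%R)%C D)); first lra.
  move=> z Hz /=. have Hz' : Cmod z < rho by have := Cmod_triangle_inv z w; lra.
  have -> : (fun t => f (rho * expi t) * (rho * expi t) * / (rho * expi t - z))%C =
    (fun t => f (rho * expi t) * (rho * expi t / (rho * expi t - z)))%C.
  { apply: functional_extensionality => t. rewrite /Cdiv. ring. }
  rewrite cauchy_formula //. field. exact: RtoC_2PI_ne.
Qed.

(** The formula for f' is again an integral with a power of the kernel, and the second half of
    [CI_kernel_diff] differentiates it. From here on [d2 f] is a genuine derivative. *)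
Theorem holo_d1 f : holo f -> holo (d1 f).
Proof.
  move=> Hf z Hz. rewrite /inD in Hz. have Pz := Cmod_ge_0 z.
  set rho := (1 + Cmod z) / 2. have Hrho : 0 < rho < 1 by rewrite /rho; lra.
  have Hw : Cmod z < rho by rewrite /rho; lra.
  have Hk : rcont_on (fun t => f (rho * expi t) * (rho * expi t))%C 0 (2 * PI).
  { move=> t _. apply: rcont_mult; last exact: rcont_circle. apply: rcont_holo_circle => //; lra. }
  case: (CI_kernel_diff _ rho z Hk Hw) => _ D.
  eexists. apply/cdiff_is_derive.
  apply: (cdiff_ext _ _ _ _ (rho - Cmod z) _ _ (cdiff_scal _ _ _ (/ (2 * PI)%R)%C D)); first lra.
  move=> w Hzw /=. have Hw' : Cmod w < rho by have := Cmod_triangle_inv w z; lra.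
  by rewrite (cauchy_derivative f rho w).
Qed.

Lemma CI_mean_bound g M : rcont_on g 0 (2 * PI) -> (forall t, Cmod (g t) <= M) ->
  Cmod (/ (2 * PI)%R * CI g 0 (2 * PI)%R)%C <= M.
Proof.
  move=> Hg HM. have HPI := PI_RGT_0.
  have B := CI_bound g 0 (2 * PI) M ltac:(lra) Hg (fun t _ => HM t).
  rewrite Cmod_mult Cmod_inv; last exact: RtoC_2PI_ne.
  rewrite Cmod_RtoC_pos; last lra.
  apply: (Rmult_le_reg_l (2 * PI)); first lra. rewrite -Rmult_assoc Rinv_r; lra.
Qed.

(** Circles of radius rho < 1 give M / rho, and rho tends to 1. *)
Lemma cauchy_estimate0 f M : holo f -> (forall z, inD z -> Cmod (f z) <= M) -> Cmod (d1 f 0) <= M.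
Proof.
  move=> Hf HM.
  have HM0 : 0 <= M.
  { have := HM 0%C. rewrite /inD Cmod_0 => H. have := H ltac:(lra). have := Cmod_ge_0 (f 0). lra. }
  have K : forall rho, 0 < rho < 1 -> Cmod (d1 f 0) <= M / rho.
  { move=> rho Hrho. rewrite (cauchy_derivative f rho 0) // ?Cmod_0; try lra.
    have R1 : forall t, rcont (fun t => f (rho * expi t) * (rho * expi t) * (/ (rho * expi t - 0)) ^ 2)%C t.
    { move=> t. have Q := rcont_kernel rho 0 t ltac:(rewrite Cmod_0; lra).
      apply: rcont_mult; last by (do 2 (apply: rcont_mult => //)); exact: rcont_const.
      apply: rcont_mult; last exact: rcont_circle. apply: rcont_holo_circle => //; lra. }
    apply: CI_mean_bound => [t _|t]; first exact: R1.
    rewrite Cmod_mult Cmod_mult Cmod_pow. have -> : (rho * expi t - 0 = rho * expi t)%C by ring.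
    have E := Cmod_circle rho t ltac:(lra).
    rewrite Cmod_inv; last by move=> E0; rewrite E0 Cmod_0 in E; lra.
    rewrite E. have -> : Cmod (f (rho * expi t)%C) * rho * (/ rho) ^ 2 = Cmod (f (rho * expi t)%C) / rho by field; lra.
    apply: Rmult_le_compat_r; first by left; apply: Rinv_0_lt_compat; lra.
    apply: HM. rewrite /inD E; lra. }
  case: (Rle_dec (Cmod (d1 f 0)) M) => // H. exfalso.
  set x := Cmod (d1 f 0) in K H. have Hx : M < x by lra.
  (* If x = |f'(0)| exceeded M, this radius would give M / rho = 2 M x / (M + x) < x. *)
  have Hr : 0 < (M + x) / (2 * x) < 1.
  { split; first by apply: Rdiv_lt_0_compat; lra.
    apply: (Rmult_lt_reg_r (2 * x)); first lra. have -> : (M + x) / (2 * x) * (2 * x) = M + x by field; lra. lra. }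
  have := K _ Hr. have -> : M / ((M + x) / (2 * x)) = M * (2 * x) / (M + x) by field; lra.
  move=> Q. have : x * (M + x) <= M * (2 * x) / (M + x) * (M + x) by apply: Rmult_le_compat_r; lra.
  have -> : M * (2 * x) / (M + x) * (M + x) = M * (2 * x) by field; lra. nra.
Qed.

(** Rescaling by z |-> c + r z to the unit disk lets the disk of radius r touch the unit circle, so
    radii such as 1 - |c| are allowed. *)
Lemma cauchy_estimate f c r M : holo f -> 0 < r -> Cmod c + r <= 1 ->
  (forall z, Cmod (z - c) < r -> Cmod (f z) <= M) -> Cmod (d1 f c) <= M / r.
Proof.
  move=> Hf Hr Hc HM. have Hf' := proj1 (holo_cdiff f) Hf.
  have Hin : forall z, inD z -> inD (c + r * z).
  { rewrite /inD => z Hz. eapply Rle_lt_trans; first apply: Cmod_triangle.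
    rewrite Cmod_mult Cmod_RtoC_pos; [nra | lra]. }
  have D : forall z, inD z -> cdiff (fun z => f (c + r * z))%C z (d1 f (c + r * z) * r).
  { move=> z Hz. apply: (cdiff_comp f (fun z => c + r * z)%C); first by apply: Hf'; exact: Hin.
    apply: (cdiff_eq _ _ _ _ (cdiff_plus _ _ _ _ _ (cdiff_const c z) (cdiff_scal _ _ _ r (cdiff_id z)))). ring. }
  have H0 : inD 0 by rewrite /inD Cmod_0; lra.
  have E := cauchy_estimate0 (fun z => f (c + r * z))%C M.
  rewrite (cdiff_d1 _ _ _ (D 0%C H0)) in E. move: E.
  have -> : (c + r * 0 = c)%C by ring. rewrite Cmod_mult Cmod_RtoC_pos; last lra. move=> E.
  apply: (Rmult_le_reg_r r) => //. have -> : M / r * r = M by field; lra.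
  apply: E.
  - move=> z Hz. eexists. apply/cdiff_is_derive. exact: D.
  - move=> z Hz. apply: HM. have -> : (c + r * z - c = r * z)%C by ring.
    rewrite Cmod_mult Cmod_RtoC_pos; last lra. rewrite /inD in Hz. nra.
Qed.

(** * Taylor coefficients and remainder *)

Fixpoint csum (F : nat -> C) (n : nat) : C :=
  match n with O => 0 | S m => csum F m + F m end%C.

(** The k-th Taylor coefficient at 0; the exponent is k instead of k + 1 because dz / z^(k+1) = i
    z^(-k) dt. The integral form is visibly linear in f and controlled by the sup norm. *)
Definition coef (f : C -> C) (rho : R) (k : nat) : C :=
  (/ (2 * PI)%R * CI (fun t => f (rho * expi t) * (/ (rho * expi t)) ^ k) 0 (2 * PI)%R)%C.

Lemma circle_ne0 rho t : 0 < rho -> (rho * expi t)%C <> 0.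
Proof. move=> H E. have := Cmod_circle rho t ltac:(lra). rewrite E Cmod_0. lra. Qed.

Lemma rcont_circle_inv_pow rho t k : 0 < rho -> rcont (fun t => (/ (rho * expi t)) ^ k)%C t.
Proof.
  move=> H. elim: k => [|k IH]; first exact: rcont_const.
  apply: rcont_mult => //. apply: (rcont_comp Cinv _ t _ (cdiff_inv _ (circle_ne0 rho t H))). exact: rcont_circle.
Qed.

Lemma rcont_coef f rho k t : holo f -> 0 < rho < 1 -> rcont (fun t => f (rho * expi t) * (/ (rho * expi t)) ^ k)%C t.
Proof.
  move=> Hf Hrho. apply: rcont_mult; first by apply: rcont_holo_circle => //; lra.
  apply: rcont_circle_inv_pow; lra.
Qed.

Lemma coef_bound f rho M k : holo f -> 0 < rho < 1 -> (forall z, inD z -> Cmod (f z) <= M) ->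
  Cmod (coef f rho k) <= M * (/ rho) ^ k.
Proof.
  move=> Hf Hrho HM. apply: CI_mean_bound.
  - move=> t _. exact: rcont_coef.
  - move=> t. have E := Cmod_circle rho t ltac:(lra).
    rewrite Cmod_mult Cmod_pow Cmod_inv; last by apply: circle_ne0; lra.
    rewrite E. apply: Rmult_le_compat_r; last by apply: HM; rewrite /inD E; lra.
    apply: pow_le. left; apply: Rinv_0_lt_compat; lra.
Qed.

(** The kernel satisfies z / (z - w) = 1 + (w / z) z / (z - w); each induction step peels off the 1,
    which produces one more coefficient. *)
Lemma taylor_remainder f rho w n : holo f -> 0 < rho < 1 -> Cmod w < rho ->
  (f w - csum (fun k => coef f rho k * w ^ k) n =
   w ^ n * (/ (2 * PI)%R * CI (fun t => f (rho * expi t) * (/ (rho * expi t)) ^ n * (rho * expi t / (rho * expi t - w))) 0 (2 * PI)%R))%C.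
Proof.
  move=> Hf Hrho Hw. have HPI := PI_RGT_0.
  elim: n => [|n IH].
  - simpl. have -> : (fun t => f (rho * expi t) * 1 * (rho * expi t / (rho * expi t - w)))%C =
      (fun t => f (rho * expi t) * (rho * expi t / (rho * expi t - w)))%C.
    { apply: functional_extensionality => t. ring. }
    rewrite cauchy_formula //. field. exact: RtoC_2PI_ne.
  - rewrite /= -/csum.
    have -> : forall x y z : C, (x - (y + z) = (x - y) - z)%C by move=> x y z; ring.
    rewrite IH /coef.
    have Q : forall m, rcont_on (fun t => f (rho * expi t) * (/ (rho * expi t)) ^ m * (rho * expi t / (rho * expi t - w)))%C 0 (2 * PI).
    { move=> m t _. apply: rcont_mult; first exact: rcont_coef.
      apply: rcont_mult; [exact: rcont_circle | exact: rcont_kernel]. }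
    have -> : CI (fun t => f (rho * expi t) * (/ (rho * expi t)) ^ n * (rho * expi t / (rho * expi t - w)))%C 0 (2 * PI) =
      (CI (fun t => f (rho * expi t) * (/ (rho * expi t)) ^ n) 0 (2 * PI)%R +
       w * CI (fun t => f (rho * expi t) * (/ (rho * expi t)) ^ S n * (rho * expi t / (rho * expi t - w))) 0 (2 * PI)%R)%C.
    { rewrite -CI_scal; [|lra|exact: Q]. rewrite -CI_plus; [|lra| |]; first last.
      - move=> t Ht. apply: rcont_mult; [exact: rcont_const | exact: Q].
      - move=> t _. exact: rcont_coef.
      - apply: CI_ext => [|t _]; first lra. rewrite Cpow_S. set p := ((/ (rho * expi t)) ^ n)%C.
        have N1 := circle_sub_ne rho t w Hw. have N2 := circle_ne0 rho t ltac:(lra).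
        set z := (rho * expi t)%C in N1 N2 p *. field. split => //. }
    simpl. ring.
Qed.

Lemma taylor_remainder_bound f rho w n M : holo f -> 0 < rho < 1 -> Cmod w < rho ->
  (forall z, inD z -> Cmod (f z) <= M) ->
  Cmod (f w - csum (fun k => coef f rho k * w ^ k) n)%C <= (Cmod w / rho) ^ n * (M / (rho - Cmod w)).
Proof.
  move=> Hf Hrho Hw HM. have Pw := Cmod_ge_0 w.
  have HM0 : 0 <= M.
  { have := HM 0%C. rewrite /inD Cmod_0 => H. have := H ltac:(lra). have := Cmod_ge_0 (f 0). lra. }
  rewrite taylor_remainder // Cmod_mult Cmod_pow.
  have B : Cmod (/ (2 * PI)%R * CI (fun t => f (rho * expi t) * (/ (rho * expi t)) ^ n * (rho * expi t / (rho * expi t - w))) 0 (2 * PI)%R)%C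
    <= M * (/ rho) ^ n * (1 / (rho - Cmod w)).
  { apply: CI_mean_bound.
    - move=> t _. apply: rcont_mult; first exact: rcont_coef.
      apply: rcont_mult; [exact: rcont_circle | exact: rcont_kernel].
    - move=> t. have E := Cmod_circle rho t ltac:(lra). have N1 := circle_sub_ne rho t w Hw.
      rewrite 2!Cmod_mult Cmod_pow Cmod_inv; last by apply: circle_ne0; lra.
      rewrite Cmod_div // E.
      have I1 : 0 <= (/ rho) ^ n by apply: pow_le; left; apply: Rinv_0_lt_compat; lra.
      have Cp := Cmod_triangle_inv (rho * expi t) w. rewrite E in Cp.
      apply: Rmult_le_compat.
      + apply: Rmult_le_pos => //. exact: Cmod_ge_0.
      + apply: Rdiv_le_0_compat; lra.
      + apply: Rmult_le_compat_r => //. apply: HM. rewrite /inD E; lra.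
      + apply: Rmult_le_compat; try lra; first by left; apply: Rinv_0_lt_compat; lra.
        apply: Rinv_le_contravar; lra. }
  have -> : (Cmod w / rho) ^ n * (M / (rho - Cmod w)) = Cmod w ^ n * (M * (/ rho) ^ n * (1 / (rho - Cmod w))).
  { rewrite /Rdiv Rpow_mult_distr. ring. }
  apply: Rmult_le_compat_l => //. exact: pow_le.
Qed.

(** * Bloch and Zygmund functions *)

Definition coefA (u phi : C -> C) (z : C) : C := (2 * d1 u z * d1 phi z + u z * d2 phi z)%C.
Definition coefB (u phi : C -> C) (z : C) : C := (u z * (d1 phi z) ^ 2)%C.

Lemma cdiff_holo f : (forall z, inD z -> exists l, cdiff f z l) -> holo f.
Proof. move=> H z Hz. case: (H z Hz) => l /cdiff_is_derive Hl. by exists l. Qed.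

Lemma d1_ext_D f g z : inD z -> holo f -> (forall w, inD w -> f w = g w) -> d1 g z = d1 f z.
Proof.
  move=> Hz Hf E. apply: cdiff_d1. apply: (cdiff_ext_D f) => //. exact: (proj1 (holo_cdiff f)).
Qed.

Lemma cdiff_holo1 f z : holo f -> inD z -> cdiff f z (d1 f z).
Proof. move=> /holo_cdiff H. exact: H. Qed.

Lemma cdiff_holo2 f z : holo f -> inD z -> cdiff (d1 f) z (d2 f z).
Proof. move=> /holo_d1 /holo_cdiff H. exact: H. Qed.

Lemma holo_minus f g : holo f -> holo g -> holo (fun z => f z - g z)%C.
Proof.
  move=> Hf Hg. apply: cdiff_holo => z Hz. eexists. apply: cdiff_minus; exact: cdiff_holo1.
Qed.

Lemma d2_minus f g z : holo f -> holo g -> inD z -> d2 (fun z => f z - g z)%C z = (d2 f z - d2 g z)%C.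
Proof.
  move=> Hf Hg Hz. apply: cdiff_d1.
  apply: (cdiff_ext_D (fun z => d1 f z - d1 g z)%C) => //.
  - move=> w Hw. symmetry. apply: cdiff_d1. apply: cdiff_minus; exact: cdiff_holo1.
  - apply: cdiff_minus; exact: cdiff_holo2.
Qed.

Lemma wcomp_cdiff u phi f z : holo u -> selfmap phi -> holo f -> inD z ->
  cdiff (wcomp u phi f) z (d1 u z * f (phi z) + u z * (d1 f (phi z) * d1 phi z)).
Proof.
  move=> Hu [Hp Hs] Hf Hz. apply: cdiff_mult; first exact: cdiff_holo1.
  apply: (cdiff_comp f phi); last exact: cdiff_holo1. apply: cdiff_holo1 => //. exact: Hs.
Qed.

Lemma wcomp_d2 u phi f z : holo u -> selfmap phi -> holo f -> inD z ->
  d2 (wcomp u phi f) z = (d2 u z * f (phi z) + coefA u phi z * d1 f (phi z) + coefB u phi z * d2 f (phi z))%C.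
Proof.
  move=> Hu Hphi Hf Hz. have [Hp Hs] := Hphi. apply: cdiff_d1.
  apply: (cdiff_ext_D (fun z => d1 u z * f (phi z) + u z * (d1 f (phi z) * d1 phi z))%C) => //.
  { move=> w Hw. symmetry. apply: cdiff_d1. exact: wcomp_cdiff. }
  have D0 : cdiff (fun z => f (phi z)) z (d1 f (phi z) * d1 phi z).
  { apply: (cdiff_comp f phi); last exact: cdiff_holo1. apply: cdiff_holo1 => //. exact: Hs. }
  have D1 : cdiff (fun z => d1 f (phi z)) z (d2 f (phi z) * d1 phi z).
  { apply: (cdiff_comp (d1 f) phi); last exact: cdiff_holo1. apply: cdiff_holo2 => //. exact: Hs. }
  apply: (cdiff_eq _ _ _ _ (cdiff_plus _ _ _ _ _ (cdiff_mult _ _ _ _ _ (cdiff_holo2 u z Hu Hz) D0)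
    (cdiff_mult _ _ _ _ _ (cdiff_holo1 u z Hu Hz) (cdiff_mult _ _ _ _ _ D1 (cdiff_holo2 phi z Hp Hz))))).
  rewrite /coefA /coefB /=. ring.
Qed.

Lemma wcomp_holo u phi f : holo u -> selfmap phi -> holo f -> holo (wcomp u phi f).
Proof. move=> Hu Hphi Hf. apply: cdiff_holo => z Hz. eexists. exact: wcomp_cdiff. Qed.

Lemma wt_base_pos z : inD z -> 0 < 1 - Cmod z ^ 2 <= 1.
Proof. rewrite /inD => H. have := Cmod_ge_0 z. nra. Qed.

Lemma Rpower_pos x y : 0 < Rpower x y.
Proof. exact: exp_pos. Qed.

Lemma wt_pos a z : 0 < wt a z.
Proof. exact: Rpower_pos. Qed.

Lemma Rpower_le_1 x a : 0 < x <= 1 -> 0 <= a -> Rpower x a <= 1.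
Proof.
  move=> Hx Ha. have <- : Rpower 1 a = 1 by rewrite /Rpower ln_1 Rmult_0_r exp_0.
  exact: Rle_Rpower_l.
Qed.

Lemma wt_le_1 a z : 0 <= a -> inD z -> wt a z <= 1.
Proof. move=> Ha Hz. apply: Rpower_le_1 => //. exact: wt_base_pos. Qed.

Lemma Rpower_neg_anti x y a : 0 < x <= y -> 0 <= a -> Rpower y (- a) <= Rpower x (- a).
Proof.
  move=> H Ha. rewrite !Rpower_Ropp. apply: Rinv_le_contravar; first exact: Rpower_pos.
  exact: Rle_Rpower_l.
Qed.

Lemma wsup_le a g (M : R) : (forall z, inD z -> wt a z * Cmod (g z) <= M) -> Rbar_le (wsup a g) M.
Proof.
  move=> H. rewrite /wsup /Rbar_lub. case: Rbar_ex_lub => l [_ L] /=. apply: L => x [z [Hz ->]] /=. exact: H.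
Qed.

Lemma wsup_ge a g z : inD z -> Rbar_le (wt a z * Cmod (g z)) (wsup a g).
Proof.
  move=> H. rewrite /wsup /Rbar_lub. case: Rbar_ex_lub => l Hl.
  exact: (proj1 Hl _ (ex_intro _ z (conj H (eq_refl _)))).
Qed.

Lemma wsup_ge0 a g : Rbar_le 0 (wsup a g).
Proof.
  apply: (Rbar_le_trans _ (wt a 0%C * Cmod (g 0%C))).
  - apply: Rmult_le_pos; [left; exact: wt_pos | exact: Cmod_ge_0].
  - apply: wsup_ge. rewrite /inD Cmod_0. lra.
Qed.

Lemma norm_le_split (x : R) (y : Rbar) (M : R) : 0 <= x -> Rbar_le 0 y -> Rbar_le (Rbar_plus x y) M ->
  x <= M /\ Rbar_le y M.
Proof. move=> H. case: y => [y||] //= H1 H2. lra. Qed.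

Lemma zyg_norm_le b (g : C -> C) (M N : R) : Cmod (g 0%C) + Cmod (d1 g 0%C) <= N ->
  (forall z, inD z -> wt b z * Cmod (d2 g z) <= M) -> Rbar_le (zyg_norm b g) (N + M).
Proof.
  move=> H1 /wsup_le H2. rewrite /zyg_norm. exact: (Rbar_plus_le_compat _ (Finite N) _ (Finite M)).
Qed.

Lemma zyg_norm_ge b (g : C -> C) (M : R) : Rbar_le (zyg_norm b g) M -> forall z, inD z -> wt b z * Cmod (d2 g z) <= M.
Proof.
  move=> /norm_le_split H z Hz. case: H => [| |_ H].
  - have := Cmod_ge_0 (g 0%C). have := Cmod_ge_0 (d1 g 0%C). lra.
  - exact: wsup_ge0.
  - exact: (Rbar_le_trans _ _ _ (wsup_ge b (d2 g) z Hz) H).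
Qed.

Lemma bloch_norm_le a (g : C -> C) (M N : R) : Cmod (g 0%C) <= N ->
  (forall z, inD z -> wt a z * Cmod (d1 g z) <= M) -> Rbar_le (bloch_norm a g) (N + M).
Proof.
  move=> H1 /wsup_le H2. rewrite /bloch_norm. exact: (Rbar_plus_le_compat _ (Finite N) _ (Finite M)).
Qed.

Lemma bloch_norm_ge a (g : C -> C) (M : R) : Rbar_le (bloch_norm a g) M ->
  Cmod (g 0%C) <= M /\ forall z, inD z -> wt a z * Cmod (d1 g z) <= M.
Proof.
  move=> /norm_le_split H. case: H => [| |H1 H].
  - exact: Cmod_ge_0. - exact: wsup_ge0.
  - split => // z Hz. exact: (Rbar_le_trans _ _ _ (wsup_ge a (d1 g) z Hz) H).
Qed.

Lemma bloch_norm_ge0 a (g : C -> C) : Rbar_le 0 (bloch_norm a g).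
Proof.
  rewrite /bloch_norm. have := wsup_ge0 a (d1 g). have := Cmod_ge_0 (g 0%C). case: (wsup a (d1 g)) => //= x. lra.
Qed.

(** The weight 1 - |z|^2 is traded for the smaller 1 - |z|, whose negative powers increase with |z|
    and have an explicit primitive along radii. *)
Lemma bloch_growth a (f : C -> C) (M : R) : 0 < a -> Rbar_le (bloch_norm a f) M ->
  forall z, inD z -> Cmod (d1 f z) <= M * Rpower (1 - Cmod z) (- a).
Proof.
  move=> Ha /bloch_norm_ge [H0 H] z Hz. have := H z Hz. rewrite /wt => K.
  have Pz := Cmod_ge_0 z. rewrite /inD in Hz.
  have HM : 0 <= M by have := Cmod_ge_0 (f 0%C); lra.
  apply: (Rle_trans _ (M * Rpower (1 - Cmod z ^ 2) (- a))).
  - rewrite Rpower_Ropp. apply: (Rmult_le_reg_l (Rpower (1 - Cmod z ^ 2) a)); first exact: Rpower_pos.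
    have P := Rpower_pos (1 - Cmod z ^ 2) a.
    have -> : Rpower (1 - Cmod z ^ 2) a * (M * / Rpower (1 - Cmod z ^ 2) a) = M by field; lra. by [].
  - apply: Rmult_le_compat_l => //. apply: Rpower_neg_anti; nra.
Qed.

Lemma growth_inBloch a (f : C -> C) (M : R) : 0 < a -> holo f ->
  (forall z, inD z -> Cmod (d1 f z) <= M) -> inBloch a f /\ Rbar_le (bloch_norm a f) (Cmod (f 0%C) + M).
Proof.
  move=> Ha Hf H.
  have K : forall z, inD z -> wt a z * Cmod (d1 f z) <= M.
  { move=> z Hz. have := H z Hz. have := wt_le_1 a z ltac:(lra) Hz. have := wt_pos a z. have := Cmod_ge_0 (d1 f z). nra. }
  split; first by split => //; exists M. apply: bloch_norm_le => //. lra.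
Qed.

(** Put x = 1 - |z|. On the disk of radius x / 2 around z the distance to the unit circle is still
    at least x / 2, so the Cauchy estimate costs 2 * 2^a <= 4. *)
Lemma growth_d2 a (f : C -> C) (M : R) : 0 < a <= 1 -> holo f ->
  (forall z, inD z -> Cmod (d1 f z) <= M * Rpower (1 - Cmod z) (- a)) ->
  forall z, inD z -> Cmod (d2 f z) <= 4 * M * Rpower (1 - Cmod z) (- (a + 1)).
Proof.
  move=> Ha Hf H z Hz. rewrite /inD in Hz. have Pz := Cmod_ge_0 z.
  have HM : 0 <= M.
  { have := H 0%C. rewrite /inD Cmod_0 => Q. have := Q ltac:(lra). have := Cmod_ge_0 (d1 f 0%C). have := Rpower_pos (1 - 0) (- a). nra. }
  set x := 1 - Cmod z. have Hx : 0 < x by rewrite /x; lra.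
  have E : Cmod (d2 f z) <= (M * Rpower (x / 2) (- a)) / (x / 2).
  { apply: (cauchy_estimate (d1 f)); [exact: holo_d1|lra|rewrite /x; lra|].
    move=> w Hw. have Hw' : Cmod w < (1 + Cmod z) / 2 by have := Cmod_triangle_inv w z; rewrite /x in Hw; lra.
    eapply Rle_trans; first by apply: H; rewrite /inD; lra.
    apply: Rmult_le_compat_l => //. apply: Rpower_neg_anti; rewrite /x; lra. }
  eapply Rle_trans; first exact: E.
  have -> : Rpower x (- (a + 1)) = Rpower x (- a) / x.
  { rewrite Ropp_plus_distr Rpower_plus (Rpower_Ropp x 1) Rpower_1 //. }
  have -> : Rpower (x / 2) (- a) = Rpower x (- a) * Rpower 2 a.
  { rewrite /Rdiv -Rpower_mult_distr; try lra. congr (_ * _). rewrite Rpower_Ropp. rewrite -Rpower_Ropp.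
    rewrite /Rpower ln_Rinv; last lra. congr exp. ring. }
  have H2 : Rpower 2 a <= 2 by rewrite -{2}(Rpower_1 2); [apply: Rle_Rpower; lra | lra].
  have P := Rpower_pos x (- a). have P2 := Rpower_pos 2 a.
  have -> : M * (Rpower x (- a) * Rpower 2 a) / (x / 2) = (M * (Rpower x (- a) / x)) * (2 * Rpower 2 a) by field; lra.
  have -> : 4 * M * (Rpower x (- a) / x) = (M * (Rpower x (- a) / x)) * 4 by ring.
  apply: Rmult_le_compat_l; last lra. apply: Rmult_le_pos => //. apply: Rdiv_le_0_compat; lra.
Qed.

(** For lack of a complex mean value equality, the real one is applied to the component of F along
    the increment [c], minus [|c| Psi]. A variable majorant [psi] is essential because the bound on
    f' blows up at the circle. *)
Lemma mean_value_bound (F F' : R -> C) (Psi psi : R -> R) p q : p < q ->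
  (forall t, p <= t <= q -> rdiff F t (F' t)) -> (forall t, p <= t <= q -> is_derive Psi t (psi t)) ->
  (forall t, p <= t <= q -> Cmod (F' t) <= psi t) -> Cmod (F q - F p) <= Psi q - Psi p.
Proof.
  move=> Hpq HF HP Hb.
  set c := (F q - F p)%C.
  pose x t := Re c * Re (F t) + Im c * Im (F t) - Cmod c * Psi t.
  pose x' t := Re c * Re (F' t) + Im c * Im (F' t) - Cmod c * psi t.
  have Dx : forall t, p <= t <= q -> is_derive x t (x' t).
  { move=> t Ht. case: (HF t Ht) => D1 D2. have D3 := HP t Ht.
    apply: (is_derive_minus (fun t => Re c * Re (F t) + Im c * Im (F t)) (fun t => Cmod c * Psi t)).
    - apply: (is_derive_plus (fun t => Re c * Re (F t)) (fun t => Im c * Im (F t))); exact: is_derive_scal.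
    - exact: is_derive_scal. }
  case: (MVT_gen x p q x') => [t|t|t0].
  - rewrite Rmin_left ?Rmax_right; try lra. move=> Ht. apply: Dx; lra.
  - rewrite Rmin_left ?Rmax_right; try lra. move=> Ht. apply: derivable_continuous_pt.
    apply: ex_derive_Reals_0. eexists. apply: Dx; lra.
  - rewrite Rmin_left ?Rmax_right; try lra. move=> [Ht E].
    have X : x' t0 <= 0.
    { have := Hb t0 Ht. rewrite /x'.
      have CS : Re c * Re (F' t0) + Im c * Im (F' t0) <= Cmod c * Cmod (F' t0).
      { rewrite -(Cmod_conj c) -Cmod_mult. have := re_le_Cmod (Cconj c * F' t0).
        have -> : Re (Cconj c * F' t0) = Re c * Re (F' t0) + Im c * Im (F' t0) by rewrite /Re /Im /=; ring.
        have := Rle_abs (Re c * Re (F' t0) + Im c * Im (F' t0)). lra. }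
      have := Cmod_ge_0 c. nra. }
    have Y : x q <= x p by nra.
    have Z : Cmod c ^ 2 = Re c * (Re (F q) - Re (F p)) + Im c * (Im (F q) - Im (F p)).
    { rewrite Cmod2_alt /c /Re /Im /=. ring. }
    rewrite /x in Y. have P := Cmod_ge_0 c.
    have W : Cmod c * Cmod c <= Cmod c * (Psi q - Psi p) by nra.
    (* When the increment vanishes there is nothing to divide by, and [Psi p <= Psi q] has to come
       from [psi >= 0]. *)
    case: (Req_dec (Cmod c) 0) => N.
    + have Hpsi : forall t, p <= t <= q -> 0 <= psi t by move=> t Ht'; have := Hb t Ht'; have := Cmod_ge_0 (F' t); lra.
      case: (MVT_gen Psi p q psi) => [t|t|t1].
      * rewrite Rmin_left ?Rmax_right; try lra. move=> Ht'. apply: HP; lra.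
      * rewrite Rmin_left ?Rmax_right; try lra. move=> Ht'. apply: derivable_continuous_pt.
        apply: ex_derive_Reals_0. eexists. apply: HP; lra.
      * rewrite Rmin_left ?Rmax_right; try lra. move=> [Ht1 E1]. have := Hpsi t1 Ht1. nra.
    + apply: (Rmult_le_reg_l (Cmod c)) => //. lra.
Qed.

Lemma is_derive_Rpower_1m (a t : R) : t < 1 -> a <> 1 ->
  is_derive (fun t => - Rpower (1 - t) (1 - a) / (1 - a)) t (Rpower (1 - t) (- a)).
Proof.
  move=> Ht Ha. rewrite /Rpower. auto_derive; first lra.
  have -> : (1 - a) * ln (1 - t) = - a * ln (1 - t) + ln (1 - t) by ring.
  rewrite exp_plus exp_ln; last lra. field. lra.
Qed.

(** The bound on f' is integrated along the segment from r z to z; since a < 1, the integral of (1 -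
    t)^(-a) over [r, 1] is finite and tends to 0 as r tends to 1. This is the common modulus of
    continuity of the unit ball. *)
Lemma bloch_dilation_diff a (f : C -> C) (M r : R) : 0 < a < 1 -> holo f -> 0 <= r < 1 -> 0 <= M ->
  (forall z, inD z -> Cmod (d1 f z) <= M * Rpower (1 - Cmod z) (- a)) ->
  forall z, inD z -> Cmod (f z - f (r * z))%C <= M * (Rpower (1 - r) (1 - a) / (1 - a)).
Proof.
  move=> Ha Hf Hr HM H z Hz. have Hz1 : Cmod z < 1 := Hz. have Pz := Cmod_ge_0 z.
  have Hin : forall t, 0 <= t <= 1 -> inD (t * z).
  { move=> t Ht. rewrite /inD Cmod_mult Cmod_RtoC_pos; nra. }
  (* The majorant is singular at t = 1, so the segment first stops at [T < 1]; continuity of f at z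
     then lets T tend to 1. *)
  have K : forall T, r < T < 1 -> Cmod (f (T * z) - f (r * z))%C <= M * (Rpower (1 - r) (1 - a) / (1 - a)).
  { move=> T HT.
    have := mean_value_bound (fun t => f (t * z)%C) (fun t => d1 f (t * z) * z)%C
      (fun t => M * (- Rpower (1 - t) (1 - a) / (1 - a))) (fun t => M * Rpower (1 - t) (- a)) r T.
    move=> Q. eapply Rle_trans; first apply: Q; try lra.
    - move=> t Ht. apply: (rdiff_of_cdiff (fun w => f (w * z)%C)).
      apply: (cdiff_comp f (fun w => w * z)%C). apply: cdiff_holo1 => //; apply: Hin; lra.
      apply: (cdiff_eq _ _ _ _ (cdiff_mult _ _ _ _ _ (cdiff_id t) (cdiff_const z t))). ring.
    - move=> t Ht. apply: is_derive_scal. apply: is_derive_Rpower_1m; lra.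
    - move=> t Ht. rewrite Cmod_mult.
      have E := H (t * z)%C (Hin t ltac:(lra)). rewrite Cmod_mult Cmod_RtoC_pos in E; last lra.
      apply: (Rle_trans _ (Cmod (d1 f (t * z)%C))); first by have := Cmod_ge_0 (d1 f (t * z)%C); nra.
      eapply Rle_trans; first exact: E. apply: Rmult_le_compat_l => //. apply: Rpower_neg_anti; nra.
    - have := Rpower_pos (1 - T) (1 - a). move=> P.
      have : 0 <= M * (Rpower (1 - T) (1 - a) / (1 - a)).
      { apply: Rmult_le_pos => //. apply: Rdiv_le_0_compat; lra. } lra. }
  apply: le_epsilon => e He.
  case: (cdiff_cont _ _ _ (cdiff_holo1 f z Hf Hz) e He) => d [Hd Hw].
  (* Beyond r, and close enough to 1 for T z to lie within [d] of z. *)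
  set T := Rmax ((1 + r) / 2) (1 - d / 2).
  have T1 : (1 + r) / 2 <= T := Rmax_l _ _. have T2 : 1 - d / 2 <= T := Rmax_r _ _.
  have T3 : T < 1 by apply: Rmax_lub_lt; lra.
  have := K T ltac:(lra). have := Hw (T * z)%C.
  have -> : (T * z - z = - (RtoC (1 - T) * z))%C by rewrite RtoC_minus; ring.
  rewrite Cmod_opp Cmod_mult Cmod_RtoC_pos; last lra. move=> Q. have := Q ltac:(nra).
  rewrite Cmod_minus_sym.
  have := Cmod_triangle (f z - f (T * z))%C (f (T * z) - f (r * z))%C.
  have -> : (f z - f (T * z) + (f (T * z) - f (r * z)) = f z - f (r * z))%C by ring. lra.
Qed.

Lemma bloch_bounded a (f : C -> C) (M : R) : 0 < a < 1 -> holo f -> Cmod (f 0%C) <= M ->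
  (forall z, inD z -> Cmod (d1 f z) <= M * Rpower (1 - Cmod z) (- a)) ->
  forall z, inD z -> Cmod (f z) <= M * (1 + / (1 - a)).
Proof.
  move=> Ha Hf H0 H z Hz.
  have HM : 0 <= M by have := Cmod_ge_0 (f 0%C); lra.
  have := bloch_dilation_diff a f M 0 Ha Hf ltac:(lra) HM H z Hz.
  have -> : (0 * z = 0)%C by ring.
  have -> : Rpower (1 - 0) (1 - a) = 1 by rewrite Rminus_0_r /Rpower ln_1 Rmult_0_r exp_0.
  have := Cmod_triangle_inv (f z) (f 0%C). lra.
Qed.

(** * Finite-rank approximation *)

Fixpoint rsum (F : nat -> R) (n : nat) : R :=
  match n with O => 0 | S m => rsum F m + F m end.

Lemma rsum_le F G n : (forall k, (k < n)%nat -> F k <= G k) -> rsum F n <= rsum G n.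
Proof.
  elim: n => [|n IH] H /=; first lra. have := H n ltac:(lia). have := IH (fun k Hk => H k ltac:(lia)). lra.
Qed.

Lemma rsum_scal c F n : rsum (fun k => c * F k) n = c * rsum F n.
Proof. elim: n => [|n IH] /=; first ring. rewrite IH. ring. Qed.

Lemma csum_bound F n : Cmod (csum F n) <= rsum (fun k => Cmod (F k)) n.
Proof.
  elim: n => [|n IH] /=; first by rewrite Cmod_0; lra.
  have := Cmod_triangle (csum F n) (F n). lra.
Qed.

Lemma csum_ext F G n : (forall k, F k = G k) -> csum F n = csum G n.
Proof. move=> H. congr csum. exact: functional_extensionality. Qed.

Lemma csum_lin F G c n : csum (fun k => F k + c * G k)%C n = (csum F n + c * csum G n)%C.
Proof. elim: n => [|n IH] /=; first ring. rewrite IH. ring. Qed.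

(** Coefficients and dilation factor are kept apart: r = 1 gives the plain Taylor polynomial, which
    is compared with f before dilating. *)
Definition dpoly (c : nat -> C) (r : R) (n : nat) (z : C) : C := csum (fun k => c k * (r * z) ^ k)%C n.

Lemma cdiff_dpoly c r n z :
  cdiff (dpoly c r n) z (csum (fun k => c k * (INR k * (r * z) ^ (k - 1) * r)) n)%C.
Proof.
  rewrite /dpoly. elim: n => [|n IH] /=; first exact: cdiff_const.
  apply: cdiff_plus => //. apply: cdiff_scal.
  apply: (cdiff_comp (fun w => w ^ n)%C (fun w => r * w)%C); first exact: cdiff_pow.
  apply: (cdiff_eq _ _ _ _ (cdiff_scal _ _ _ r (cdiff_id z))). ring.
Qed.

Lemma dpoly_holo c r n : holo (dpoly c r n).
Proof. apply: cdiff_holo => z _. eexists. exact: cdiff_dpoly. Qed.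

Lemma pow_le_1 x k : 0 <= x <= 1 -> x ^ k <= 1.
Proof. move=> H. rewrite -(pow1 k). exact: pow_incr. Qed.

(** A norm bound in terms of finitely many coefficients; it turns convergence of coefficients into
    convergence in the Bloch space. *)
Lemma dpoly_bloch a c r n : 0 < a -> 0 <= r <= 1 ->
  inBloch a (dpoly c r n) /\
  Rbar_le (bloch_norm a (dpoly c r n)) (rsum (fun k => Cmod (c k) * (1 + INR k)) n).
Proof.
  move=> Ha Hr.
  have P : forall z k, inD z -> Cmod ((r * z) ^ k)%C <= 1.
  { move=> z k Hz. rewrite Cmod_pow Cmod_mult Cmod_RtoC_pos; last lra. rewrite /inD in Hz.
    apply: pow_le_1. have := Cmod_ge_0 z. nra. }
  have D : forall z, inD z -> Cmod (d1 (dpoly c r n) z) <= rsum (fun k => Cmod (c k) * INR k) n.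
  { move=> z Hz. rewrite (cdiff_d1 _ _ _ (cdiff_dpoly c r n z)).
    eapply Rle_trans; first exact: csum_bound. apply: rsum_le => k _.
    rewrite Cmod_mult Cmod_mult Cmod_mult Cmod_RtoC_pos; last exact: pos_INR. rewrite (Cmod_RtoC_pos r); last lra.
    apply: Rmult_le_compat_l; first exact: Cmod_ge_0.
    have := P z (k - 1)%nat Hz. have := Cmod_ge_0 ((r * z) ^ (k - 1))%C. have := pos_INR k.
    set p := Cmod _. move=> H1 H2 H3. have : INR k * p <= INR k by nra. have : 0 <= INR k * p by nra. nra. }
  case: (growth_inBloch a _ _ Ha (dpoly_holo c r n) D) => B1 B2. split => //.
  apply: Rbar_le_trans; first exact: B2. rewrite /=.
  have : Cmod (dpoly c r n 0%C) <= rsum (fun k => Cmod (c k)) n.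
  { eapply Rle_trans; first exact: csum_bound. apply: rsum_le => k _. rewrite Cmod_mult.
    have := P 0%C k ltac:(rewrite /inD Cmod_0; lra). have := Cmod_ge_0 (c k). nra. }
  have -> : rsum (fun k => Cmod (c k) * (1 + INR k)) n = rsum (fun k => Cmod (c k)) n + rsum (fun k => Cmod (c k) * INR k) n.
  { elim: n {D B1 B2} => [|n IH] /=; first ring. rewrite IH. ring. }
  lra.
Qed.

Lemma exists_dilation a e : 0 < a < 1 -> 0 < e -> exists r, 0 < r < 1 /\ Rpower (1 - r) (1 - a) / (1 - a) <= e.
Proof.
  move=> Ha He. set y := Rmin (/ 2) (e * (1 - a)).
  have Hy : 0 < y by apply: Rmin_glb_lt; [lra | apply: Rmult_lt_0_compat; lra].
  have H1 : y <= / 2 := Rmin_l _ _. have H2 : y <= e * (1 - a) := Rmin_r _ _.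
  set x := Rpower y (/ (1 - a)).
  have Hx : 0 < x < 1.
  { split; first exact: Rpower_pos. rewrite -exp_0 /x /Rpower. apply: exp_increasing.
    have : ln y < ln 1 by apply: ln_increasing; lra. rewrite ln_1.
    have : 0 < / (1 - a) by apply: Rinv_0_lt_compat; lra. nra. }
  exists (1 - x); split; first lra.
  have -> : 1 - (1 - x) = x by ring. rewrite /x Rpower_mult.
  have -> : / (1 - a) * (1 - a) = 1 by field; lra. rewrite Rpower_1 //.
  apply: (Rmult_le_reg_r (1 - a)); first lra. have -> : y / (1 - a) * (1 - a) = y by field; lra. lra.
Qed.

(** The error is h = (f - f(r z)) + E(r z), with E the Taylor remainder of f. The constant 3 counts
    f', the derivative of f(r z) and that of E(r z), and it does not depend on e. Near |phi| = 1
    only this uniform bound is available, elsewhere smallness of h is used. *)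
Lemma finite_rank_approx a e : 0 < a < 1 -> 0 < e -> exists r rho n, 0 < r < 1 /\ 0 < rho < 1 /\
  forall f, inBloch a f -> Rbar_le (bloch_norm a f) 1 ->
    let h := fun z => (f z - dpoly (coef f rho) r n z)%C in
    holo h /\ (forall z, inD z -> Cmod (h z) <= e) /\
    (forall z, inD z -> Cmod (d1 h z) <= 3 * Rpower (1 - Cmod z) (- a)).
Proof.
  move=> Ha He.
  case: (exists_dilation a (e / 2) Ha ltac:(lra)) => r [Hr Hre].
  (* Nested radii r < s < rho < 1: the points r z lie in |w| <= r, the Taylor error is small on |w|
     <= s, and the coefficients are integrals over |w| = rho. [M] bounds every f of the unit ball,
     so the degree [n] chosen below does not depend on f. *)
  set s := (1 + r) / 2. set rho := (1 + s) / 2. set M := 1 * (1 + / (1 - a)).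
  have Hs : r < s < 1 by rewrite /s; lra. have Hrho : s < rho < 1 by rewrite /rho; lra.
  have HM : 0 < M by rewrite /M; have : 0 < / (1 - a) by [apply: Rinv_0_lt_compat; lra]; lra.
  have Hq : 0 <= s / rho < 1.
  { split; first by apply: Rdiv_le_0_compat; lra. apply: (Rmult_lt_reg_r rho); first lra.
    have -> : s / rho * rho = s by field; lra. lra. }
  (* The target e / 2 serves |h| <= e; the target s - r makes the Cauchy estimate on disks of radius
     s - r give |E'| <= 1. *)
  case: (geom_small (s / rho) (M / (rho - s)) (Rmin (e / 2) (s - r)) Hq) => [||n Hn].
  { apply: Rdiv_le_0_compat; lra. } { apply: Rmin_glb_lt; lra. }
  have {Hn} := Hn n (le_n n). set eta := _ ^ n * _ => Hn.
  have Hn1 : eta <= e / 2 by have := Rmin_l (e / 2) (s - r); lra.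
  have Hn2 : eta <= s - r by have := Rmin_r (e / 2) (s - r); lra.
  exists r, rho, n; split; [lra|split; [lra|]].
  move=> f Hf Hb h. have Hh := proj1 Hf.
  have Hg : forall z, inD z -> Cmod (d1 f z) <= 1 * Rpower (1 - Cmod z) (- a) := bloch_growth a f 1 ltac:(lra) Hb.
  have HfM := bloch_bounded a f 1 Ha Hh (proj1 (bloch_norm_ge a f 1 Hb)) Hg.
  pose E w := (f w - dpoly (coef f rho) 1 n w)%C.
  have HE : holo E by apply: holo_minus => //; exact: dpoly_holo.
  have Eb : forall w, Cmod w <= s -> Cmod (E w) <= eta.
  { move=> w Hw. have Pw := Cmod_ge_0 w.
    have -> : E w = (f w - csum (fun k => coef f rho k * w ^ k) n)%C.
    { rewrite /E /dpoly. congr (_ - _)%C. apply: csum_ext => k. by rewrite Cmult_1_l. }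
    eapply Rle_trans; first by apply: (taylor_remainder_bound f rho w n M) => //; lra.
    apply: Rmult_le_compat.
    - apply: pow_le. apply: Rdiv_le_0_compat; lra.
    - apply: Rdiv_le_0_compat; lra.
    - apply: pow_incr. split; first by apply: Rdiv_le_0_compat; lra.
      apply: Rmult_le_compat_r => //. left; apply: Rinv_0_lt_compat; lra.
    - apply: Rmult_le_compat_l; first lra. apply: Rinv_le_contravar; lra. }
  have rz : forall z, inD z -> Cmod (r * z)%C <= r.
  { move=> z Hz. rewrite Cmod_mult Cmod_RtoC_pos; last lra. rewrite /inD in Hz. nra. }
  have rzD : forall z, inD z -> inD (r * z) by move=> z Hz; have := rz z Hz; rewrite /inD; lra.
  have Eh : forall z, h z = (f z - f (r * z) + E (r * z))%C.
  { move=> z. rewrite /h /E /dpoly. rewrite (csum_ext (fun k => coef f rho k * (1 * (r * z)) ^ k)%C (fun k => coef f rho k * (r * z) ^ k)%C).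
    - ring. - move=> k. by rewrite Cmult_1_l. }
  split; [|split].
  - apply: holo_minus => //. exact: dpoly_holo.
  - move=> z Hz. rewrite Eh. have := Cmod_triangle (f z - f (r * z))%C (E (r * z)%C).
    have := Eb (r * z)%C. have := rz z Hz.
    have := bloch_dilation_diff a f 1 r Ha Hh ltac:(lra) ltac:(lra) Hg z Hz.
    rewrite Rmult_1_l. move=> H1 H2 H3. have := H3 ltac:(lra). lra.
  - move=> z Hz.
    have Dl : forall g, holo g -> cdiff (fun z => g (r * z)%C) z (d1 g (r * z) * r).
    { move=> g Hg'. apply: (cdiff_comp g (fun z => r * z)%C); first by apply: cdiff_holo1 => //; exact: rzD.
      apply: (cdiff_eq _ _ _ _ (cdiff_scal _ _ _ r (cdiff_id z))). ring. }
    have Dh : cdiff h z (d1 f z - d1 f (r * z) * r + d1 E (r * z) * r).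
    { apply: (cdiff_ext_D (fun z => f z - f (r * z) + E (r * z))%C) => //.
      apply: cdiff_plus; last exact: Dl. apply: cdiff_minus; [exact: cdiff_holo1 | exact: Dl]. }
    rewrite (cdiff_d1 _ _ _ Dh).
    have Pz := Cmod_ge_0 z. have Hz1 : Cmod z < 1 := Hz.
    set p := Rpower (1 - Cmod z) (- a).
    have B1 := Hg z Hz. rewrite -/p Rmult_1_l in B1.
    have B2 : Cmod (d1 f (r * z)%C * r) <= p.
    { rewrite Cmod_mult (Cmod_RtoC_pos r); last lra.
      have := Hg _ (rzD z Hz). rewrite Cmod_mult Cmod_RtoC_pos; last lra.
      have : Rpower (1 - r * Cmod z) (- a) <= p by apply: Rpower_neg_anti; nra.
      have := Cmod_ge_0 (d1 f (r * z)%C). nra. }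
    have B3 : Cmod (d1 E (r * z)%C * r) <= 1.
    { rewrite Cmod_mult (Cmod_RtoC_pos r); last lra.
      have : Cmod (d1 E (r * z)%C) <= eta / (s - r).
      { apply: cauchy_estimate => //; try lra.
        - have := rz z Hz. lra.
        - move=> w Hw. apply: Eb. have := Cmod_triangle_inv w (r * z)%C. have := rz z Hz. lra. }
      have : eta / (s - r) <= 1.
      { apply: (Rmult_le_reg_r (s - r)); first lra. have -> : eta / (s - r) * (s - r) = eta by field; lra. lra. }
      have := Cmod_ge_0 (d1 E (r * z)%C). nra. }
    have B4 : 1 <= p.
    { have -> : 1 = Rpower 1 (- a) by rewrite /Rpower ln_1 Rmult_0_r exp_0. apply: Rpower_neg_anti; lra. }
    have T1 := Cmod_triangle (d1 f z - d1 f (r * z) * r)%C (d1 E (r * z) * r)%C.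
    have T2 := Cmod_triangle_minus (d1 f z) (d1 f (r * z) * r)%C. lra.
Qed.

(** * Convergent subsequences and compactness of the finite-rank operators *)

Definition ccv (x : nat -> C) (l : C) := forall e, 0 < e -> exists N, forall n, (N <= n)%nat -> Cmod (x n - l) <= e.

Definition strictly_inc (s : nat -> nat) := forall n, (s n < s (S n))%nat.

Lemma strictly_inc_ge s : strictly_inc s -> forall n, (n <= s n)%nat.
Proof. move=> H. elim=> [|n IH]; first lia. have := H n. lia. Qed.

Lemma strictly_inc_lt s : strictly_inc s -> forall n m, (n < m)%nat -> (s n < s m)%nat.
Proof. move=> H n m. elim: m => [|m IH] Hm; first lia. have := H m. case: (Nat.eq_dec n m) => [->//|N]. have := IH ltac:(lia). lia. Qed.

Lemma strictly_inc_comp s t : strictly_inc s -> strictly_inc t -> strictly_inc (fun n => s (t n)).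
Proof. move=> Hs Ht n. apply: strictly_inc_lt => //. Qed.

Lemma ccv_subseq x l s : strictly_inc s -> ccv x l -> ccv (fun n => x (s n)) l.
Proof.
  move=> Hs H e He. case: (H e He) => N HN. exists N => n Hn. apply: HN. have := strictly_inc_ge s Hs n. lia.
Qed.

(** The property may change with k, so that shrinking neighbourhoods can be imposed along the
    subsequence. *)
Lemma frequently_subseq (P : nat -> nat -> Prop) : (forall k N, exists p, (N <= p)%nat /\ P k p) ->
  exists s, strictly_inc s /\ forall k, P k (s k).
Proof.
  move=> H.
  pose g k N := proj1_sig (constructive_indefinite_description _ (H k N)).
  have Hg : forall k N, (N <= g k N)%nat /\ P k (g k N).
  { move=> k N. exact: (proj2_sig (constructive_indefinite_description _ (H k N))). }
  pose s := nat_rect (fun _ => nat) (g 0%nat 0%nat) (fun k sk => g (S k) (S sk)).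
  exists s; split.
  - move=> n. have := proj1 (Hg (S n) (S (s n))). rewrite /s /=. lia.
  - case=> [|k]; exact: (proj2 (Hg _ _)).
Qed.

Lemma bolzano_weierstrass_R (x : nat -> R) M : (forall n, Rabs (x n) <= M) ->
  exists s l, strictly_inc s /\ forall e, 0 < e -> exists N, forall n, (N <= n)%nat -> Rabs (x (s n) - l) <= e.
Proof.
  move=> H.
  case: (Bolzano_Weierstrass x (fun c => - M <= c <= M) (compact_P3 (- M) M)) => [n|l Hl].
  { have := H n => /Rabs_le_between. lra. }
  case: (frequently_subseq (fun k p => Rabs (x p - l) < / (INR k + 1))) => [k N|s [Hs Hk]].
  { have Pk : 0 < / (INR k + 1) by apply: Rinv_0_lt_compat; have := pos_INR k; lra.
    case: (Hl (fun y => Rabs (y - l) < / (INR k + 1)) N).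
    - exists (mkposreal _ Pk) => y. by rewrite /disc.
    - move=> p Hp. by exists p. }
  exists s, l; split => // e He.
  case: (archimed_cor1 e He) => N [HN HN0]. exists N => n Hn.
  apply: Rlt_le. apply: (Rlt_le_trans _ _ _ (Hk n)). apply: (Rle_trans _ (/ INR N)); last lra.
  apply: Rinv_le_contravar; first by apply: lt_0_INR. have := le_INR _ _ Hn. lra.
Qed.

Lemma bolzano_weierstrass_C (x : nat -> C) M : (forall n, Cmod (x n) <= M) ->
  exists s l, strictly_inc s /\ ccv (fun n => x (s n)) l.
Proof.
  move=> H.
  case: (bolzano_weierstrass_R (fun n => Re (x n)) M) => [n|s [l [Hs Hl]]].
  { have := re_le_Cmod (x n). have := H n. lra. }
  case: (bolzano_weierstrass_R (fun n => Im (x (s n))) M) => [n|t [l' [Ht Hl']]].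
  { have := Im_le_Cmod (x (s n)). have := H (s n). lra. }
  exists (fun n => s (t n)), (l, l'); split; first exact: strictly_inc_comp.
  move=> e He. case: (Hl (e / 2) ltac:(lra)) => N HN. case: (Hl' (e / 2) ltac:(lra)) => N' HN'.
  exists (N + N')%nat => n Hn.
  have A1 := HN (t n) ltac:(have := strictly_inc_ge t Ht n; lia). have A2 := HN' n ltac:(lia).
  have := Cmod_le_abs (x (s (t n)) - (l, l'))%C.
  have -> : Re (x (s (t n)) - (l, l')) = Re (x (s (t n))) - l by rewrite /Re /=; ring.
  have -> : Im (x (s (t n)) - (l, l')) = Im (x (s (t n))) - l' by rewrite /Im /=; ring.
  lra.
Qed.

(** Only the m coefficients of a polynomial have to converge, so m successive extractions replace a
    diagonal argument. *)
Lemma bolzano_weierstrass_family (x : nat -> nat -> C) (M : nat -> R) : (forall k n, Cmod (x k n) <= M k) ->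
  forall m, exists s c, strictly_inc s /\ forall k, (k < m)%nat -> ccv (fun n => x k (s n)) (c k).
Proof.
  move=> H. elim=> [|m [s [c [Hs Hc]]]].
  - exists (fun n => n), (fun _ => RtoC 0). split => [n|k]; lia.
  - case: (bolzano_weierstrass_C (fun n => x m (s n)) (M m)) => [n|t [l [Ht Hl]]]; first exact: H.
    exists (fun n => s (t n)), (fun k => if Nat.eqb k m then l else c k).
    split; first exact: strictly_inc_comp. move=> k Hk. case: (Nat.eqb_spec k m) => [->//|N].
    apply: (ccv_subseq (fun n => x k (s n))) => //. apply: Hc. lia.
Qed.

Lemma rsum_cv0 (x : nat -> nat -> R) m : (forall k, (k < m)%nat -> forall e, 0 < e -> exists N, forall n, (N <= n)%nat -> x n k <= e) ->
  forall e, 0 < e -> exists N, forall n, (N <= n)%nat -> rsum (x n) m <= e.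
Proof.
  elim: m => [|m IH] H e He; first by exists 0%nat => n _ /=; lra.
  case: (IH (fun k Hk => H k ltac:(lia)) (e / 2) ltac:(lra)) => N HN.
  case: (H m ltac:(lia) (e / 2) ltac:(lra)) => N' HN'. exists (N + N')%nat => n Hn /=.
  have := HN n ltac:(lia). have := HN' n ltac:(lia). lra.
Qed.

(** The constant becomes nonnegative and the norm is replaced by a real upper bound [B], which keeps
    later estimates out of extended-real products. *)
Lemma wcomp_bounded_const a b u phi : wcomp_bounded a b u phi ->
  exists M, 0 <= M /\ forall f (B : R), inBloch a f -> Rbar_le (bloch_norm a f) B ->
    Rbar_le (zyg_norm b (wcomp u phi f)) (M * B).
Proof.
  move=> [_ [M HM]]. exists (Rabs M); split; first exact: Rabs_pos.
  move=> f B Hf HB. have := HM f Hf. have := bloch_norm_ge0 a f. move: HB.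
  case: (bloch_norm a f) => [x||] //= H1 H2 H3.
  apply: Rbar_le_trans; first exact: H3. rewrite /=. have := Rle_abs M. have := Rabs_pos M. nra.
Qed.

Lemma coef_lin f g c rho k : holo f -> holo g -> 0 < rho < 1 ->
  coef (fun w => f w + c * g w)%C rho k = (coef f rho k + c * coef g rho k)%C.
Proof.
  move=> Hf Hg Hrho. have HPI := PI_RGT_0.
  have Rf : rcont_on _ 0 (2 * PI) := fun t _ => rcont_coef f rho k t Hf Hrho.
  have Rg : rcont_on _ 0 (2 * PI) := fun t _ => rcont_coef g rho k t Hg Hrho.
  rewrite /coef.
  have -> : CI (fun t => (f (rho * expi t) + c * g (rho * expi t)) * (/ (rho * expi t)) ^ k)%C 0 (2 * PI) =
    (CI (fun t => f (rho * expi t) * (/ (rho * expi t)) ^ k) 0 (2 * PI)%R + c * CI (fun t => g (rho * expi t) * (/ (rho * expi t)) ^ k) 0 (2 * PI)%R)%C.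
  { rewrite -CI_scal //; last lra. rewrite -CI_plus //; [|lra|]; last first.
    - move=> t Ht. apply: rcont_mult; [exact: rcont_const | exact: Rg].
    - apply: CI_ext => [|t _]; [lra | ring]. }
  ring.
Qed.

(** The operator factors through n Taylor coefficients, which stay bounded along a bounded sequence.
    A subsequence of them converges, and boundedness of the weighted composition carries the Bloch
    convergence of the polynomials over to the Zygmund norm. *)
Lemma finite_rank_compact a b u phi r rho n : 0 < a < 1 -> holo u -> selfmap phi -> wcomp_bounded a b u phi ->
  0 < r < 1 -> 0 < rho < 1 -> compact_op a b (fun f => wcomp u phi (dpoly (coef f rho) r n)).
Proof.
  move=> Ha Hu Hphi HT Hr Hrho. split; first split.
  - move=> f Hf. apply: (proj1 HT). apply: (proj1 (dpoly_bloch a _ r n _ _)); lra.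
  - move=> f g c [Hf _] [Hg _] z Hz. rewrite /wcomp /dpoly.
    rewrite (csum_ext _ (fun k => coef f rho k * (r * phi z) ^ k + c * (coef g rho k * (r * phi z) ^ k))%C).
    + rewrite csum_lin. ring.
    + move=> k. rewrite coef_lin //. ring.
  - move=> fs M Hfs.
    have B : forall k m, Cmod (coef (fs m) rho k) <= M * (1 + / (1 - a)) * (/ rho) ^ k.
    { move=> k m. case: (Hfs m) => [[Hh Hi] Hb]. apply: coef_bound => //.
      apply: (bloch_bounded a) => //; first exact: (proj1 (bloch_norm_ge a _ _ Hb)).
      apply: bloch_growth => //; lra. }
    case: (bolzano_weierstrass_family (fun k m => coef (fs m) rho k) _ B n) => s [c [Hs Hc]].
    case: (wcomp_bounded_const a b u phi HT) => MT [HMT HT'].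
    exists s, (wcomp u phi (dpoly c r n)); split => //; split.
    { apply: (proj1 HT). apply: (proj1 (dpoly_bloch a _ r n _ _)); lra. }
    move=> e He.
    pose x m k := Cmod (coef (fs (s m)) rho k - c k)%C * (1 + INR k).
    case: (rsum_cv0 x n _ (e / (MT + 1))) => [k Hk e' He'| | N HN].
    + have Pk : 0 < 1 + INR k by have := pos_INR k; lra.
      case: (Hc k Hk (e' / (1 + INR k))) => [|N HN]; first exact: Rdiv_lt_0_compat.
      exists N => m Hm. rewrite /x. have -> : e' = e' / (1 + INR k) * (1 + INR k) by field; lra.
      apply: Rmult_le_compat_r; first lra. exact: HN.
    + apply: Rdiv_lt_0_compat; lra.
    + exists N => m Hm.
      have -> : (fun z => wcomp u phi (dpoly (coef (fs (s m)) rho) r n) z - wcomp u phi (dpoly c r n) z)%C =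
        wcomp u phi (dpoly (fun k => coef (fs (s m)) rho k - c k)%C r n).
      { apply: functional_extensionality => z. rewrite /wcomp /dpoly.
        rewrite [in RHS](csum_ext _ (fun k => coef (fs (s m)) rho k * (r * phi z) ^ k + (- (1)) * (c k * (r * phi z) ^ k))%C).
        - rewrite csum_lin. ring. - move=> k. ring. }
      case: (dpoly_bloch a (fun k => coef (fs (s m)) rho k - c k)%C r n) => [||D1 D2]; try lra.
      apply: Rbar_le_trans; first exact: (HT' _ _ D1 D2). have := HN m Hm. rewrite /x /=.
      set R0 := rsum _ _ => HR.
      have : (MT + 1) * R0 <= (MT + 1) * (e / (MT + 1)) by apply: Rmult_le_compat_l; lra.
      have -> : (MT + 1) * (e / (MT + 1)) = e by field; lra.
      have : 0 <= R0.
      { apply: (Rle_trans _ (rsum (fun _ => 0 * 0) n)); first by rewrite rsum_scal; lra.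
        apply: rsum_le => k _. rewrite Rmult_0_l. apply: Rmult_le_pos; first exact: Cmod_ge_0. have := pos_INR k; lra. }
      nra.
Qed.

(** * Upper bound *)

Lemma d1_pow n : d1 (fun w => w ^ n)%C = (fun z => INR n * z ^ (n - 1))%C.
Proof. apply: functional_extensionality => z. apply: cdiff_d1. exact: cdiff_pow. Qed.

Lemma d2_pow n : d2 (fun w => w ^ n)%C = (fun z => INR n * (INR (n - 1) * z ^ (n - 1 - 1)))%C.
Proof.
  apply: functional_extensionality => z. rewrite /d2 -/(d1 (fun w => w ^ n)%C) d1_pow.
  apply: cdiff_d1. apply: cdiff_scal. exact: cdiff_pow.
Qed.

Lemma pow_holo n : holo (fun w => w ^ n)%C.
Proof. apply: cdiff_holo => z _. eexists. exact: cdiff_pow. Qed.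

Lemma Cmod_pow_le_1 z n : inD z -> Cmod (z ^ n)%C <= 1.
Proof.
  move=> Hz. rewrite Cmod_pow. apply: pow_le_1. rewrite /inD in Hz. have := Cmod_ge_0 z. lra.
Qed.

Lemma pow_bloch a n : 0 < a -> inBloch a (fun w => w ^ n)%C /\
  Rbar_le (bloch_norm a (fun w => w ^ n)%C) (1 + INR n).
Proof.
  move=> Ha. case: (growth_inBloch a (fun w => w ^ n)%C (INR n) Ha (pow_holo n)) => [z Hz|B1 B2].
  - rewrite d1_pow Cmod_mult Cmod_RtoC_pos; last exact: pos_INR.
    have := Cmod_pow_le_1 z (n - 1) Hz. have := pos_INR n. nra.
  - split => //. apply: Rbar_le_trans; first exact: B2. rewrite /=.
    have := Cmod_pow_le_1 0%C n ltac:(rewrite /inD Cmod_0; lra). lra.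
Qed.

(* Test on f = 1, z, z^2. *)
Lemma wcomp_coef_bounded a b u phi : 0 < a -> holo u -> selfmap phi -> wcomp_bounded a b u phi ->
  exists M, 0 <= M /\ forall z, inD z -> wt b z * Cmod (d2 u z) <= M /\
    wt b z * Cmod (coefA u phi z) <= M /\ wt b z * Cmod (coefB u phi z) <= M.
Proof.
  move=> Ha Hu Hphi HT. case: (wcomp_bounded_const a b u phi HT) => M [HM H].
  have T : forall n z, inD z -> wt b z * Cmod (d2 (wcomp u phi (fun w => w ^ n)%C) z) <= M * (1 + INR n).
  { move=> n z Hz. case: (pow_bloch a n Ha) => B1 B2. exact: (zyg_norm_ge b _ _ (H _ _ B1 B2) z Hz). }
  exists (10 * M); split; first lra. move=> z Hz.
  have Pp : Cmod (phi z) < 1 := proj2 Hphi z Hz. have Pp0 := Cmod_ge_0 (phi z).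
  have W := wt_pos b z.
  have T0 := T 0%nat z Hz. have T1 := T 1%nat z Hz. have T2 := T 2%nat z Hz.
  rewrite !wcomp_d2 // in T0 T1 T2; try exact: pow_holo.
  rewrite d1_pow d2_pow /= in T0. rewrite d1_pow d2_pow /= in T1. rewrite d1_pow d2_pow /= in T2.
  move: T0. have -> : (d2 u z * 1 + coefA u phi z * (0 * 1) + coefB u phi z * (0 * (0 * 1)) = d2 u z)%C by ring. move=> T0.
  move: T1. have -> : (d2 u z * (phi z * 1) + coefA u phi z * (1 * 1) + coefB u phi z * (1 * (0 * 1)) = d2 u z * phi z + coefA u phi z)%C by ring. move=> T1.
  move: T2. rewrite RtoC_plus.
  have -> : (d2 u z * (phi z * (phi z * 1)) + coefA u phi z * ((1 + 1) * (phi z * 1)) + coefB u phi z * ((1 + 1) * (1 * 1)) =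
    d2 u z * (phi z * phi z) + coefA u phi z * (2 * phi z) + coefB u phi z * 2)%C by ring. move=> T2.
  have A1 : wt b z * Cmod (coefA u phi z) <= 3 * M.
  { have := Cmod_triangle_minus (d2 u z * phi z + coefA u phi z)%C (d2 u z * phi z)%C.
    have -> : (d2 u z * phi z + coefA u phi z - d2 u z * phi z = coefA u phi z)%C by ring.
    rewrite (Cmod_mult (d2 u z)). have := Cmod_ge_0 (d2 u z). nra. }
  have A2 : wt b z * Cmod (coefB u phi z * 2)%C <= 10 * M.
  { have := Cmod_triangle_minus (d2 u z * (phi z * phi z) + coefA u phi z * (2 * phi z) + coefB u phi z * 2)%C
      (d2 u z * (phi z * phi z) + coefA u phi z * (2 * phi z))%C.
    have -> : (d2 u z * (phi z * phi z) + coefA u phi z * (2 * phi z) + coefB u phi z * 2 - (d2 u z * (phi z * phi z) + coefA u phi z * (2 * phi z)) = coefB u phi z * 2)%C by ring.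
    have := Cmod_triangle (d2 u z * (phi z * phi z))%C (coefA u phi z * (2 * phi z))%C.
    rewrite (Cmod_mult (d2 u z)) (Cmod_mult (coefA u phi z)) (Cmod_mult 2) (Cmod_mult (phi z)) (Cmod_RtoC_pos 2); last lra.
    have P1 := Cmod_ge_0 (d2 u z). have P2 := Cmod_ge_0 (coefA u phi z). set p := Cmod (phi z) in Pp Pp0 *.
    have Q1 : Cmod (d2 u z) * (p * p) <= Cmod (d2 u z) by have : p * p <= 1 by [nra]; nra.
    have Q2 : Cmod (coefA u phi z) * (2 * p) <= 2 * Cmod (coefA u phi z) by nra.
    move=> Q3 Q4.
    have Q5 : Cmod (coefB u phi z * 2)%C <= Cmod (d2 u z * (phi z * phi z) + coefA u phi z * (2 * phi z) + coefB u phi z * 2)%C + Cmod (d2 u z) + 2 * Cmod (coefA u phi z) by lra.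
    have : wt b z * Cmod (coefB u phi z * 2)%C <= wt b z * (Cmod (d2 u z * (phi z * phi z) + coefA u phi z * (2 * phi z) + coefB u phi z * 2)%C + Cmod (d2 u z) + 2 * Cmod (coefA u phi z)) by apply: Rmult_le_compat_l; lra.
    lra. }
  rewrite Cmod_mult Cmod_RtoC_pos in A2; last lra.
  have := Cmod_ge_0 (coefB u phi z). repeat split; nra.
Qed.

(** For x <= 1/2 one has e^(2x) (1 - x) >= (1 + 2x)(1 - x) >= 1, hence 1 - x >= e^(-2x). *)
Lemma pow_one_minus_ge x n : 0 <= x <= / 2 -> INR n * x <= 1 -> exp (- 2) <= (1 - x) ^ n.
Proof.
  move=> Hx Hn.
  have E : exp (- (2 * x)) <= 1 - x.
  { rewrite exp_Ropp. have := exp_ineq1_le (2 * x) => Q.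
    apply: (Rmult_le_reg_l (exp (2 * x))); first exact: exp_pos. rewrite Rinv_r; last by have := exp_pos (2 * x); lra. nra. }
  apply: (Rle_trans _ (exp (- (2 * x)) ^ n)); last by apply: pow_incr; split => //; left; exact: exp_pos.
  have -> : exp (- (2 * x)) ^ n = exp (- (2 * x) * INR n).
  { elim: n {Hn} => [|n IH]; first by rewrite /= Rmult_0_r exp_0.
    rewrite S_INR -tech_pow_Rmult IH -exp_plus. congr exp. ring. }
  case: (Rle_lt_or_eq_dec (- 2) (- (2 * x) * INR n)) => [|H|<-]; [nra| |lra].
  left. exact: exp_increasing.
Qed.

Lemma floor_inv x : 0 < x -> exists n, INR n * x <= 1 < (INR n + 1) * x.
Proof.
  move=> Hx. case: (nfloor_ex (/ x)) => [|n [H1 H2]]; first by left; apply: Rinv_0_lt_compat.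
  exists n. have E : / x * x = 1 by field; lra. split.
  - have : INR n * x <= / x * x by apply: Rmult_le_compat_r; lra. lra.
  - have : / x * x < (INR n + 1) * x by apply: Rmult_lt_compat_r; lra. lra.
Qed.

Lemma exp_m2 : exp (- 2) * exp 2 = 1.
Proof. rewrite -exp_plus. have -> : -2 + 2 = 0 by ring. exact: exp_0. Qed.

(* At a point where |phi| = 1 - x, the power n = floor(1/x) is the one for which phi^n is still bounded below. *)
Lemma weight_from_powers p (phi Gf : C -> C) b L N : 0 <= p ->
  (forall n z, (N <= n)%nat -> inD z -> Rpower (INR n + 1) p * (wt b z * Cmod (Gf z * phi z ^ n)%C) <= L) ->
  forall z, inD z -> 1 - / (INR N + 2) <= Cmod (phi z) < 1 ->
    wt b z * Cmod (Gf z) * Rpower (1 - Cmod (phi z)) (- p) <= exp 2 * L.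
Proof.
  move=> Hp H z Hz Ht. set x := 1 - Cmod (phi z). have PN := pos_INR N.
  have Hx : 0 < x by rewrite /x; lra.
  (* The offset 2 serves twice: it gives x <= 1/2, as [pow_one_minus_ge] requires, and it makes n =
     floor(1/x) at least N. *)
  have Hx1 : x <= / (INR N + 2) by rewrite /x; lra.
  have Hx2 : / (INR N + 2) <= / 2 by apply: Rinv_le_contravar; lra.
  case: (floor_inv x Hx) => n [H1 H2].
  have Hn : (N <= n)%nat.
  { have : x * (INR N + 2) <= 1.
    { have : x * (INR N + 2) <= / (INR N + 2) * (INR N + 2) by apply: Rmult_le_compat_r; lra.
      rewrite Rinv_l; lra. }
    move=> Q. have : INR N < INR n by nra. move=> /INR_lt. lia. }
  have K := H n z Hn Hz. rewrite Cmod_mult Cmod_pow in K.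
  have Et : exp (- 2) <= Cmod (phi z) ^ n.
  { have -> : Cmod (phi z) = 1 - x by rewrite /x; ring. apply: pow_one_minus_ge => //. lra. }
  have Ew : 0 <= wt b z * Cmod (Gf z) by apply: Rmult_le_pos; [left; exact: wt_pos | exact: Cmod_ge_0].
  have Er : Rpower x (- p) <= Rpower (INR n + 1) p.
  { have -> : Rpower x (- p) = Rpower (/ x) p by rewrite /Rpower ln_Rinv //; congr exp; ring.
    apply: Rle_Rpower_l => //. split; first exact: Rinv_0_lt_compat.
    apply: (Rmult_le_reg_r x) => //. rewrite Rinv_l; lra. }
  have P1 := Rpower_pos (INR n + 1) p. have P2 := exp_pos 2. have P3 := exp_pos (-2). have E2 := exp_m2.
  set w := wt b z * Cmod (Gf z) in Ew *. set t := Cmod (phi z) ^ n in K Et.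
  have Ewt : wt b z * (Cmod (Gf z) * t) = w * t by rewrite /w; ring.
  rewrite Ewt in K.
  have Q1 : w * Rpower x (- p) <= w * Rpower (INR n + 1) p by apply: Rmult_le_compat_l.
  have Q2 : Rpower (INR n + 1) p * w * exp (-2) <= Rpower (INR n + 1) p * w * t by apply: Rmult_le_compat_l => //; nra.
  have Q3 : exp 2 * (Rpower (INR n + 1) p * w * exp (-2)) <= exp 2 * L by apply: Rmult_le_compat_l; lra.
  have : exp 2 * (Rpower (INR n + 1) p * w * exp (-2)) = Rpower (INR n + 1) p * w.
  { rewrite -[RHS]Rmult_1_r -E2. ring. }
  lra.
Qed.

Lemma op_norm_diff_le a b T K (M : R) :
  (forall f, inBloch a f -> Rbar_le (bloch_norm a f) 1 -> Rbar_le (zyg_norm b (fun z => T f z - K f z)%C) M) ->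
  Rbar_le (op_norm_diff a b T K) M.
Proof.
  move=> H. rewrite /op_norm_diff /Rbar_lub. case: Rbar_ex_lub => l [_ Hl] /=. apply: Hl => x [f [H1 [H2 ->]]]. exact: H.
Qed.

Lemma ess_norm_le a b T K : compact_op a b K -> Rbar_le (ess_norm a b T) (op_norm_diff a b T K).
Proof.
  move=> H. rewrite /ess_norm /Rbar_glb. case: Rbar_ex_glb => l Hl.
  exact: (proj1 Hl _ (ex_intro _ K (conj H (eq_refl _)))).
Qed.

(** The 15 is 3 + 12: h' carries the constant 3 and h'' the constant 4 * 3, each meeting a weighted
    coefficient at most e^2 L where |phi| is close to 1. The additional [L] absorbs the values at 0,
    the term u'' h(phi) and the rest of the disk. *)
Lemma ess_norm_upper a b u phi L N : 0 < a < 1 -> holo u -> selfmap phi -> wcomp_bounded a b u phi -> 0 < L ->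
  (forall n z, (N <= n)%nat -> inD z -> Rpower (INR n + 1) a * (wt b z * Cmod (coefA u phi z * phi z ^ n)%C) <= L) ->
  (forall n z, (N <= n)%nat -> inD z -> Rpower (INR n + 1) (a + 1) * (wt b z * Cmod (coefB u phi z * phi z ^ n)%C) <= L) ->
  Rbar_le (ess_norm a b (wcomp u phi)) ((15 * exp 2 + 1) * L).
Proof.
  move=> Ha Hu Hphi HT HL HA HB.
  case: (wcomp_coef_bounded a b u phi ltac:(lra) Hu Hphi HT) => MU [HMU HU].
  have WA := weight_from_powers a phi _ b L N ltac:(lra) HA.
  have WB := weight_from_powers (a + 1) phi _ b L N ltac:(lra) HB.
  have PN := pos_INR N.
  (* Half the width of the boundary layer: where |phi| < 1 - 2d, two successive Cauchy estimates of
     radius d, for h' and then for h'', stay inside the disk. *)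
  set d := / (INR N + 2) / 2.
  have Hd : 0 < d by rewrite /d; apply: Rdiv_lt_0_compat; [apply: Rinv_0_lt_compat|]; lra.
  have Hd2 : 2 * d = / (INR N + 2) by rewrite /d; field; lra.
  have H0 : inD 0%C by rewrite /inD Cmod_0; lra.
  have Hphi0 : Cmod (phi 0%C) < 1 := proj2 Hphi _ H0.
  set d0 := 1 - Cmod (phi 0%C). have Hd0 : 0 < d0 by rewrite /d0; lra.
  (* If |h| <= e, then the part of the Zygmund norm at the origin is at most [e * c0]; h'(phi(0)) is
     bounded by e / d0 through a Cauchy estimate. *)
  set c0 := Cmod (u 0%C) + Cmod (d1 u 0%C) + Cmod (u 0%C) * Cmod (d1 phi 0%C) / d0.
  have Hc0 : 0 <= c0.
  { rewrite /c0. have := Cmod_ge_0 (u 0%C). have := Cmod_ge_0 (d1 u 0%C).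
    have : 0 <= Cmod (u 0%C) * Cmod (d1 phi 0%C) / d0 by apply: Rdiv_le_0_compat => //; apply: Rmult_le_pos; exact: Cmod_ge_0. lra. }
  set X := MU * (1 + / d + / d / d).
  have Hid : 0 < / d by exact: Rinv_0_lt_compat.
  have Hidd : 0 < / d / d by apply: Rdiv_lt_0_compat.
  have HX : 0 <= X by apply: Rmult_le_pos; lra.
  (* Chosen after d, so that e absorbs both [c0] and [X]: away from |phi| = 1 the functions h, h',
     h'' are at most e, e/d, e/d^2. *)
  set e := L / (2 * (1 + c0 + X)).
  have He : 0 < e by apply: Rdiv_lt_0_compat; lra.
  have HeL : e * (1 + c0 + X) = L / 2 by rewrite /e; field; lra.
  case: (finite_rank_approx a e Ha He) => r [rho [n [Hr [Hrho Happ]]]].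
  apply: Rbar_le_trans; first exact: (ess_norm_le a b _ _ (finite_rank_compact a b u phi r rho n Ha Hu Hphi HT Hr Hrho)).
  apply: op_norm_diff_le => f Hf Hbf.
  case: (Happ f Hf Hbf). set h := fun z => (f z - dpoly (coef f rho) r n z)%C. move=> Hh [Hhe Hh1].
  have -> : (fun z => wcomp u phi f z - wcomp u phi (dpoly (coef f rho) r n) z)%C = wcomp u phi h.
  { apply: functional_extensionality => z. rewrite /wcomp /h. ring. }
  have Hh2 := growth_d2 a h 3 ltac:(lra) Hh Hh1.
  have -> : (15 * exp 2 + 1) * L = L / 2 + (15 * exp 2 * L + L / 2) by field.
  apply: zyg_norm_le.
  - rewrite (cdiff_d1 _ _ _ (wcomp_cdiff u phi h 0%C Hu Hphi Hh H0)).
    have E1 := Hhe _ (proj2 Hphi _ H0).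
    have E2 : Cmod (d1 h (phi 0%C)) <= e / d0.
    { apply: cauchy_estimate => //; first by rewrite /d0; lra.
      move=> w Hw. apply: Hhe. rewrite /inD. have := Cmod_triangle_inv w (phi 0%C). rewrite /d0 in Hw; lra. }
    have T := Cmod_triangle (d1 u 0 * h (phi 0%C))%C (u 0 * (d1 h (phi 0%C) * d1 phi 0%C))%C.
    have P1 := Cmod_ge_0 (u 0%C). have P2 := Cmod_ge_0 (d1 u 0%C). have P3 := Cmod_ge_0 (d1 phi 0%C).
    rewrite /wcomp !Cmod_mult in T *.
    have Q1 : Cmod (u 0%C) * Cmod (h (phi 0%C)) <= Cmod (u 0%C) * e by apply: Rmult_le_compat_l.
    have Q2 : Cmod (d1 u 0%C) * Cmod (h (phi 0%C)) <= Cmod (d1 u 0%C) * e by apply: Rmult_le_compat_l.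
    have Q3 : Cmod (u 0%C) * (Cmod (d1 h (phi 0%C)) * Cmod (d1 phi 0%C)) <= Cmod (u 0%C) * (e / d0 * Cmod (d1 phi 0%C)).
    { apply: Rmult_le_compat_l => //. by apply: Rmult_le_compat_r. }
    have : e * c0 = Cmod (u 0%C) * e + Cmod (d1 u 0%C) * e + Cmod (u 0%C) * (e / d0 * Cmod (d1 phi 0%C)) by rewrite /c0; field; lra.
    have : 0 <= e * X by apply: Rmult_le_pos; lra. lra.
  - move=> z Hz. rewrite wcomp_d2 //.
    have Hpz : Cmod (phi z) < 1 := proj2 Hphi z Hz. have Ppz := Cmod_ge_0 (phi z).
    have T1 := Cmod_triangle (d2 u z * h (phi z) + coefA u phi z * d1 h (phi z))%C (coefB u phi z * d2 h (phi z))%C.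
    have T2 := Cmod_triangle (d2 u z * h (phi z))%C (coefA u phi z * d1 h (phi z))%C.
    rewrite (Cmod_mult (coefB u phi z)) in T1. rewrite (Cmod_mult (d2 u z)) (Cmod_mult (coefA u phi z)) in T2.
    have W := wt_pos b z. case: (HU z Hz) => U1 [U2 U3].
    have G1 := Hhe _ (proj2 Hphi z Hz).
    set h0 := Cmod (h (phi z)) in T2 G1. set h1 := Cmod (d1 h (phi z)) in T2. set h2 := Cmod (d2 h (phi z)) in T1.
    have Ph0 : 0 <= h0 by exact: Cmod_ge_0. have Ph1 : 0 <= h1 by exact: Cmod_ge_0. have Ph2 : 0 <= h2 by exact: Cmod_ge_0.
    set wu := wt b z * Cmod (d2 u z) in U1. set wA := wt b z * Cmod (coefA u phi z) in U2. set wB := wt b z * Cmod (coefB u phi z) in U3.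
    have Pwu : 0 <= wu by apply: Rmult_le_pos; [lra | exact: Cmod_ge_0].
    have PwA : 0 <= wA by apply: Rmult_le_pos; [lra | exact: Cmod_ge_0].
    have PwB : 0 <= wB by apply: Rmult_le_pos; [lra | exact: Cmod_ge_0].
    apply: (Rle_trans _ (wu * h0 + wA * h1 + wB * h2)).
    { rewrite /wu /wA /wB.
      have -> : wt b z * Cmod (d2 u z) * h0 + wt b z * Cmod (coefA u phi z) * h1 + wt b z * Cmod (coefB u phi z) * h2 =
        wt b z * (Cmod (d2 u z) * h0 + Cmod (coefA u phi z) * h1 + Cmod (coefB u phi z) * h2) by ring.
      apply: Rmult_le_compat_l; lra. }
    have Q0 : wu * h0 <= MU * e by apply: Rmult_le_compat.
    have HMe : MU * e * (1 + / d + / d / d) <= L / 2.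
    { have -> : MU * e * (1 + / d + / d / d) = e * X by rewrite /X; ring.
      have : 0 <= e * (1 + c0) by apply: Rmult_le_pos; lra. lra. }
    have P0 : 0 <= MU * e by apply: Rmult_le_pos; lra.
    have P2 := exp_pos 2.
    case: (Rle_dec (1 - / (INR N + 2)) (Cmod (phi z))) => Hcase.
    + have G2 := Hh1 _ (proj2 Hphi z Hz). have G3 := Hh2 _ (proj2 Hphi z Hz).
      rewrite -/h1 in G2. rewrite -/h2 in G3.
      have WA' := WA z Hz ltac:(lra). have WB' := WB z Hz ltac:(lra). rewrite -/wA in WA'. rewrite -/wB in WB'.
      set q1 := Rpower _ _ in G2 WA'. set q2 := Rpower _ _ in G3 WB'.
      have Q1 : wA * h1 <= wA * (3 * q1) by apply: Rmult_le_compat_l.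
      have Q2 : wB * h2 <= wB * (4 * 3 * q2) by apply: Rmult_le_compat_l.
      have : 0 <= MU * e * / d by apply: Rmult_le_pos; lra.
      have : 0 <= MU * e * (/ d / d) by apply: Rmult_le_pos; lra.
      lra.
    + have R1 : forall w, Cmod w <= 1 - d -> Cmod (d1 h w) <= e / d.
      { move=> w Hw. apply: cauchy_estimate => //; first lra.
        move=> v Hv. apply: Hhe. rewrite /inD. have := Cmod_triangle_inv v w. lra. }
      have G2 : h1 <= e / d by apply: R1; lra.
      have G3 : h2 <= e / d / d.
      { apply: (cauchy_estimate (d1 h)) => //; [exact: holo_d1 | lra |].
        move=> v Hv. apply: R1. have := Cmod_triangle_inv v (phi z). lra. }
      have Q1 : wA * h1 <= MU * (e / d) by apply: Rmult_le_compat.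
      have Q2 : wB * h2 <= MU * (e / d / d) by apply: Rmult_le_compat.
      have : MU * e * (1 + / d + / d / d) = MU * e + MU * (e / d) + MU * (e / d / d) by field; lra.
      have : 0 <= 15 * exp 2 * L by nra. lra.
Qed.

(** * Lower bound *)

Lemma d2_ext_D f g z : inD z -> holo f -> (forall w, inD w -> f w = g w) -> d2 g z = d2 f z.
Proof.
  move=> Hz Hf E. apply: d1_ext_D => //; first exact: holo_d1.
  move=> w Hw. symmetry. exact: d1_ext_D.
Qed.

Lemma op_norm_diff_ge a b T K (E : R) f : Rbar_le (op_norm_diff a b T K) E ->
  inBloch a f -> Rbar_le (bloch_norm a f) 1 -> Rbar_le (zyg_norm b (fun z => T f z - K f z)%C) E.
Proof.
  move=> H H1 H2. apply: Rbar_le_trans; last exact: H.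
  rewrite /op_norm_diff /Rbar_lub. case: Rbar_ex_lub => l Hl.
  exact: (proj1 Hl _ (ex_intro _ f (conj H1 (conj H2 (eq_refl _))))).
Qed.

(* A compact K nearly identifies f_m and f_n for two members m < n of a suitable subsequence; freezing m
   and letting n tend to infinity removes T f_n, so weak convergence of (f_n) is not needed. *)
Lemma compact_test_sequence a b u phi K (E L : R) fs zs : 0 < a -> holo u -> selfmap phi ->
  wcomp_bounded a b u phi -> compact_op a b K -> Rbar_le (op_norm_diff a b (wcomp u phi) K) E ->
  (forall k, inBloch a (fs k) /\ Rbar_le (bloch_norm a (fs k)) (/ 4)) ->
  (forall z, inD z -> forall e, 0 < e -> exists N, forall k, (N <= k)%nat -> wt b z * Cmod (d2 (wcomp u phi (fs k)) z) <= e) ->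
  (forall k, inD (zs k) /\ L <= wt b (zs k) * Cmod (d2 (wcomp u phi (fs k)) (zs k))) -> L <= E.
Proof.
  move=> Ha Hu Hphi HT [[HK1 HK2] HKc] HE Hfs Hpt Hzs.
  apply: le_epsilon => e He.
  case: (HKc fs (/ 4) Hfs) => s [g [Hs [Hg Hcv]]].
  case: (Hcv (e / 3) ltac:(lra)) => N HN.
  set m := s N. set z := zs m. have [Hz HL] := Hzs m. rewrite -/z in Hz HL.
  case: (Hpt z Hz (e / 3) ltac:(lra)) => N' HN'.
  set p := s (N + N')%nat.
  have Hp : wt b z * Cmod (d2 (wcomp u phi (fs p)) z) <= e / 3.
  { apply: HN'. have := strictly_inc_ge s Hs (N + N')%nat. rewrite /p. lia. }
  have [Hfm Bfm] := Hfs m. have [Hfp Bfp] := Hfs p.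
  (* Written as f + c g with c = -1 to fit the linearity clause of [lin_op]. The bound 1/4 on both
     functions gives 1/2 for |G(0)| and 1/2 for the seminorm, so G lies in the unit ball. *)
  pose G w := (fs m w + (- (1)) * fs p w)%C.
  have HGd : forall w, inD w -> cdiff G w (d1 (fs m) w + (- (1)) * d1 (fs p) w)%C.
  { move=> w Hw. apply: cdiff_plus; first by apply: cdiff_holo1 => //; case: Hfm.
    apply: cdiff_scal. by apply: cdiff_holo1 => //; case: Hfp. }
  have HGw : forall w, inD w -> wt a w * Cmod (d1 G w) <= / 2.
  { move=> w Hw. rewrite (cdiff_d1 _ _ _ (HGd w Hw)).
    have := Cmod_triangle (d1 (fs m) w) ((- (1)) * d1 (fs p) w)%C. rewrite (Cmod_mult (- (1))) Cmod_m1.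
    have := proj2 (bloch_norm_ge a _ _ Bfm) w Hw. have := proj2 (bloch_norm_ge a _ _ Bfp) w Hw.
    have := wt_pos a w. nra. }
  have HGb : inBloch a G.
  { split; last by exists (/ 2). apply: cdiff_holo => w Hw. eexists. exact: HGd. }
  have HG1 : Rbar_le (bloch_norm a G) 1.
  { have -> : 1 = / 2 + / 2 by field. apply: bloch_norm_le => //.
    rewrite /G. have := Cmod_triangle (fs m 0%C) ((- (1)) * fs p 0%C)%C. rewrite (Cmod_mult (- (1))) Cmod_m1.
    have := proj1 (bloch_norm_ge a _ _ Bfm). have := proj1 (bloch_norm_ge a _ _ Bfp). lra. }
  have Q := zyg_norm_ge b _ E (op_norm_diff_ge _ _ _ _ _ _ HE HGb HG1) z Hz.
  have hTm : holo (wcomp u phi (fs m)) by apply: wcomp_holo => //; case: Hfm.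
  have hTp : holo (wcomp u phi (fs p)) by apply: wcomp_holo => //; case: Hfp.
  have hKm : holo (K (fs m)) by case: (HK1 _ Hfm). have hKp : holo (K (fs p)) by case: (HK1 _ Hfp).
  have hg : holo g by case: Hg.
  have hD1 := holo_minus _ _ hTm hTp. have hD2 := holo_minus _ _ hKm hKp.
  have EQ : d2 (fun z => wcomp u phi G z - K G z)%C z =
    ((d2 (wcomp u phi (fs m)) z - d2 (wcomp u phi (fs p)) z) - (d2 (K (fs m)) z - d2 (K (fs p)) z))%C.
  { rewrite -!d2_minus //. apply: d2_ext_D => //; first exact: holo_minus.
    move=> w Hw. rewrite /G (HK2 (fs m) (fs p) _ Hfm Hfp w Hw) /wcomp. ring. }
  rewrite EQ in Q.
  have R1 := zyg_norm_ge b _ _ (HN N (le_n N)) z Hz. rewrite d2_minus // -/m in R1.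
  have R2 := zyg_norm_ge b _ _ (HN (N + N')%nat ltac:(lia)) z Hz. rewrite d2_minus // -/p in R2.
  set tm := d2 (wcomp u phi (fs m)) z in HL Q. set tp := d2 (wcomp u phi (fs p)) z in Hp Q.
  set km := d2 (K (fs m)) z in Q R1. set kp := d2 (K (fs p)) z in Q R2. set gg := d2 g z in R1 R2.
  have T : Cmod tm <= Cmod (tm - tp - (km - kp))%C + Cmod (km - gg)%C + Cmod (kp - gg)%C + Cmod tp.
  { have -> : tm = ((tm - tp - (km - kp)) + ((km - gg) - (kp - gg)) + tp)%C by ring.
    have -> : (tm - tp - (km - kp) + (km - gg - (kp - gg)) + tp - tp - (km - kp) = tm - tp - (km - kp))%C by ring.
    eapply Rle_trans; first apply: Cmod_triangle.
    have := Cmod_triangle (tm - tp - (km - kp))%C ((km - gg) - (kp - gg))%C.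
    have := Cmod_triangle_minus (km - gg)%C (kp - gg)%C. lra. }
  have W := wt_pos b z.
  have : wt b z * Cmod tm <= wt b z * (Cmod (tm - tp - (km - kp))%C + Cmod (km - gg)%C + Cmod (kp - gg)%C + Cmod tp) by apply: Rmult_le_compat_l; lra.
  lra.
Qed.

(** * Monomials and test functions *)

(** The right-hand side is (1 - r) times a sum of n + 1 powers of r, each at least r^n. *)
Lemma pow_peak r n : 0 <= r <= 1 -> INR (S n) * (1 - r) * r ^ n <= 1 - r ^ S n.
Proof.
  move=> Hr. elim: n => [|n IH]; first by simpl; lra.
  rewrite S_INR. rewrite -(tech_pow_Rmult r (S n)). rewrite -(tech_pow_Rmult r n) in IH *.
  have P : 0 <= r ^ n by apply: pow_le; lra.
  set x := r ^ n in IH P *.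
  have : r * (INR (S n) * (1 - r) * x) <= r * (1 - r * x) by apply: Rmult_le_compat_l; lra.
  have : (1 - r) * (r * x) <= 1 - r.
  { have : r * x <= 1; last nra. have : x <= 1 by apply: pow_le_1. nra. }
  lra.
Qed.

Lemma Rpower_le_1_plus y p : 0 < y -> 0 <= p <= 1 -> Rpower y p <= 1 + y.
Proof.
  move=> Hy Hp. case: (Rle_dec y 1) => H.
  - have := Rpower_le_1 y p ltac:(lra) ltac:(lra). lra.
  - have : Rpower y p <= Rpower y 1 by apply: Rle_Rpower; lra. rewrite Rpower_1; lra.
Qed.

(** With y = (1 - r^2)(n + 1) one has y^a <= 1 + y, and [pow_peak] gives y r^n <= 1 + r; the total
    is at most 1 + 2. *)
Lemma monomial_weight a n r : 0 < a < 1 -> 0 <= r < 1 ->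
  Rpower (1 - r ^ 2) a * (Rpower (INR (S n)) a * r ^ n) <= 3.
Proof.
  move=> Ha Hr. have Pn : 0 < INR (S n) by apply: lt_0_INR; lia.
  have P : 0 <= r ^ n by apply: pow_le; lra.
  have P1 : r ^ n <= 1 by apply: pow_le_1; lra.
  have Pr : 0 < 1 - r ^ 2 by nra.
  rewrite -Rmult_assoc Rpower_mult_distr //.
  have Q := Rpower_le_1_plus ((1 - r ^ 2) * INR (S n)) a ltac:(exact: Rmult_lt_0_compat) ltac:(lra).
  have K := pow_peak r n ltac:(lra).
  have : 0 <= r ^ S n by apply: pow_le; lra.
  set y := Rpower _ _ in Q *. move=> P2.
  have : y * r ^ n <= (1 + (1 - r ^ 2) * INR (S n)) * r ^ n by apply: Rmult_le_compat_r.
  have : (1 - r ^ 2) * INR (S n) * r ^ n = (1 + r) * (INR (S n) * (1 - r) * r ^ n) by ring.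
  have : (1 + r) * (INR (S n) * (1 - r) * r ^ n) <= (1 + r) * 1 by apply: Rmult_le_compat_l; lra.
  lra.
Qed.

Lemma square_geom_small r e : 0 <= r < 1 -> 0 < e -> exists N, forall n, (N <= n)%nat -> (INR n + 2) ^ 2 * r ^ n <= e.
Proof.
  move=> Hr He. set s := sqrt (sqrt r).
  have S1 : 0 <= sqrt r by exact: sqrt_pos. have S2 : 0 <= s by exact: sqrt_pos.
  have S3 : s * s = sqrt r by apply: sqrt_sqrt. have S4 : sqrt r * sqrt r = r by apply: sqrt_sqrt; lra.
  have S5 : s < 1 by rewrite -sqrt_1; apply: sqrt_lt_1_alt; split => //; rewrite -sqrt_1; apply: sqrt_lt_1_alt; lra.
  have S6 : 0 <= s * s < 1 by nra.
  case: (geom_small (s * s) (4 / (1 - s) ^ 2) e S6) => [||N HN] //.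
  { apply: Rdiv_le_0_compat; nra. }
  exists N => n Hn. eapply Rle_trans; last exact: (HN n Hn).
  have K := pow_peak s n ltac:(lra). have Pn := pos_INR n. rewrite S_INR in K.
  have P : 0 <= s ^ n by apply: pow_le.
  have P' : 0 <= s ^ S n by apply: pow_le.
  have E : r ^ n = s ^ n * s ^ n * (s * s) ^ n by rewrite -S4 -S3 !Rpow_mult_distr.
  have I : (INR n + 1) * s ^ n <= / (1 - s).
  { apply: (Rmult_le_reg_l (1 - s)); first lra. rewrite Rinv_r; lra. }
  have P2 : 0 <= (s * s) ^ n by apply: pow_le; lra.
  have I2 : ((INR n + 1) * s ^ n) * ((INR n + 1) * s ^ n) <= / (1 - s) * / (1 - s).
  { apply: Rmult_le_compat => //; apply: Rmult_le_pos; lra. }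
  rewrite E. have -> : 4 / (1 - s) ^ 2 = 4 * (/ (1 - s) * / (1 - s)) by field; lra.
  have -> : (INR n + 2) ^ 2 * (s ^ n * s ^ n * (s * s) ^ n) = (s * s) ^ n * ((INR n + 2) ^ 2 * (s ^ n * s ^ n)) by ring.
  apply: Rmult_le_compat_l => //.
  have Pss : 0 <= s ^ n * s ^ n by apply: Rmult_le_pos.
  have : (INR n + 2) ^ 2 * (s ^ n * s ^ n) <= 4 * (INR n + 1) ^ 2 * (s ^ n * s ^ n) by apply: Rmult_le_compat_r => //; nra.
  lra.
Qed.

Lemma Rpower_neg_small p e : 0 < p -> 0 < e -> exists N, forall n, (N <= n)%nat -> Rpower (INR n + 1) (- p) <= e.
Proof.
  move=> Hp He. set x := Rpower (/ e) (/ p).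
  case: (INR_unbounded x) => N HN. exists N => n Hn.
  have Px : 0 < x by exact: Rpower_pos. have := le_INR _ _ Hn => Q.
  apply: (Rle_trans _ (Rpower x (- p))); first by apply: Rpower_neg_anti; lra.
  rewrite /x Rpower_mult. have -> : / p * - p = - (1) by field; lra.
  rewrite Rpower_Ropp Rpower_1; last exact: Rinv_0_lt_compat. rewrite Rinv_inv. lra.
Qed.

(* Normalizes the test functions to Bloch norm at most 1/4. *)
Definition test_scale : R := / (12 * (1 + 4 * exp 2)).

Definition test_fun (a : R) (n : nat) (c : C) (z : C) : C :=
  (RtoC (test_scale * Rpower (INR n) (a - 1)) * (z ^ n - c * z ^ (2 * n)))%C.

Lemma test_scale_pos : 0 < test_scale.
Proof. apply: Rinv_0_lt_compat. have := exp_pos 2. lra. Qed.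

Lemma test_scale_eq : test_scale * (12 * (1 + 4 * exp 2)) = 1.
Proof. rewrite /test_scale. field. have := exp_pos 2. lra. Qed.

Lemma test_scale_le : test_scale <= 1.
Proof. have := test_scale_eq. have := test_scale_pos. have := exp_pos 2. nra. Qed.

Lemma cdiff_test_fun a n c z : cdiff (test_fun a n c) z
  (RtoC (test_scale * Rpower (INR n) (a - 1)) * (INR n * z ^ (n - 1) - c * (INR (2 * n) * z ^ (2 * n - 1)))).
Proof. apply: cdiff_scal. apply: cdiff_minus; last apply: cdiff_scal; exact: cdiff_pow. Qed.

Lemma d1_test_fun a n c z : d1 (test_fun a n c) z =
  (RtoC (test_scale * Rpower (INR n) (a - 1)) * (INR n * z ^ (n - 1) - c * (INR (2 * n) * z ^ (2 * n - 1))))%C.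
Proof. apply: cdiff_d1. exact: cdiff_test_fun. Qed.

Lemma d2_test_fun a n c z : d2 (test_fun a n c) z =
  (RtoC (test_scale * Rpower (INR n) (a - 1)) * (INR n * (INR (n - 1) * z ^ (n - 1 - 1)) - c * (INR (2 * n) * (INR (2 * n - 1) * z ^ (2 * n - 1 - 1)))))%C.
Proof.
  have E : d1 (test_fun a n c) = (fun z => RtoC (test_scale * Rpower (INR n) (a - 1)) * (INR n * z ^ (n - 1) - c * (INR (2 * n) * z ^ (2 * n - 1))))%C.
  { apply: functional_extensionality => w. exact: d1_test_fun. }
  rewrite /d2 -/(d1 (test_fun a n c)) E. apply: cdiff_d1. apply: cdiff_scal.
  apply: cdiff_minus; repeat apply: cdiff_scal; exact: cdiff_pow.
Qed.

Lemma test_fun_holo a n c : holo (test_fun a n c).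
Proof. apply: cdiff_holo => z _. eexists. exact: cdiff_test_fun. Qed.

(** The derivative is the scaled n^a z^(n-1) (1 - 2 c z^n). [monomial_weight] bounds the weighted
    monomial by 3 and |c| <= e^2 bounds the last factor by 1 + 4 e^2, so [test_scale] leaves exactly
    1/4. *)
Lemma test_fun_bloch a n c : 0 < a < 1 -> (1 <= n)%nat -> Cmod c <= exp 2 ->
  inBloch a (test_fun a n c) /\ Rbar_le (bloch_norm a (test_fun a n c)) (/ 4).
Proof.
  move=> Ha Hn Hc. have K := test_scale_pos. have Keq := test_scale_eq. have E2 := exp_pos 2.
  have Pn : 0 < INR n by apply: lt_0_INR; lia.
  have B : forall z, inD z -> wt a z * Cmod (d1 (test_fun a n c) z) <= / 4.
  { move=> z Hz. rewrite d1_test_fun. have Hz1 : Cmod z < 1 := Hz. have Pz := Cmod_ge_0 z.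
    have M := monomial_weight a (n - 1) (Cmod z) Ha ltac:(lra).
    have En : S (n - 1) = n by lia. rewrite En -/(wt a z) in M.
    have -> : (INR n * z ^ (n - 1) - c * (INR (2 * n) * z ^ (2 * n - 1)) = RtoC (INR n) * (z ^ (n - 1) * (1 - 2 * c * z ^ n)))%C.
    { have -> : (2 * n - 1 = (n - 1) + n)%nat by lia. rewrite Cpow_add_r mult_INR RtoC_mult /=.
      rewrite RtoC_plus. ring. }
    rewrite Cmod_mult Cmod_mult Cmod_mult Cmod_pow.
    have PR := Rpower_pos (INR n) (a - 1).
    rewrite (Cmod_RtoC_pos (test_scale * _)); last by apply: Rmult_le_pos; lra. rewrite (Cmod_RtoC_pos (INR n)); last lra.
    have Er : Rpower (INR n) (a - 1) * INR n = Rpower (INR n) a.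
    { rewrite -{2}(Rpower_1 (INR n)) // -Rpower_plus. congr Rpower. ring. }
    have F : Cmod (1 - 2 * c * z ^ n)%C <= 1 + 4 * exp 2.
    { eapply Rle_trans; first apply: Cmod_triangle_minus. rewrite Cmod_1 Cmod_mult Cmod_mult Cmod_RtoC_pos; last lra.
      have := Cmod_pow_le_1 z n Hz. have := Cmod_ge_0 (z ^ n)%C. have := Cmod_ge_0 c.
      move=> H1 H2 H3. have : Cmod c * Cmod (z ^ n)%C <= exp 2 * 1 by apply: Rmult_le_compat. lra. }
    set F0 := Cmod (_ - _) in F *. have PF : 0 <= F0 by exact: Cmod_ge_0.
    have -> : wt a z * (test_scale * Rpower (INR n) (a - 1) * (INR n * (Cmod z ^ (n - 1) * F0))) =
      test_scale * ((wt a z * (Rpower (INR n) a * Cmod z ^ (n - 1))) * F0) by rewrite -Er; ring.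
    have W := wt_pos a z. have PRa := Rpower_pos (INR n) a. have Pzn : 0 <= Cmod z ^ (n - 1) by exact: pow_le.
    set w := wt a z * _ in M *.
    have Pw : 0 <= w by apply: Rmult_le_pos; [lra | apply: Rmult_le_pos; lra].
    have : w * F0 <= 3 * (1 + 4 * exp 2) by apply: Rmult_le_compat.
    nra. }
  split; first by split; [exact: test_fun_holo | exists (/ 4)].
  rewrite -[/ 4]Rplus_0_l. apply: bloch_norm_le => //.
  have -> : test_fun a n c 0%C = 0%C.
  { rewrite /test_fun. have -> : n = S (n - 1) by lia. have -> : (2 * S (n - 1) = S (2 * S (n - 1) - 1))%nat by lia.
    rewrite !Cpow_S. ring. }
  rewrite Cmod_0. lra.
Qed.

(** Two kinds of smallness: the common bound [S] tends to 0 at each fixed point (n - 2 is the lowest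
    exponent occurring, and the 4 is (2n)^2 / n^2), while the last bound is uniform on the disk and
    controls u'' f(phi) at moving points. *)
Lemma test_fun_bounds a n c z : 0 < a < 1 -> (2 <= n)%nat -> Cmod c <= exp 2 -> inD z ->
  let S := (1 + 4 * exp 2) * (INR n ^ 2 * Cmod z ^ (n - 2)) in
  Cmod (test_fun a n c z) <= S /\ Cmod (d1 (test_fun a n c) z) <= S /\ Cmod (d2 (test_fun a n c) z) <= S /\
  Cmod (test_fun a n c z) <= (1 + 4 * exp 2) * Rpower (INR n) (a - 1).
Proof.
  move=> Ha Hn Hc Hz Sx. have K := test_scale_pos. have K1 := test_scale_le. have E2 := exp_pos 2.
  have Pn : 2 <= INR n by exact: (le_INR 2).
  have PR := Rpower_pos (INR n) (a - 1).
  have PR1 : Rpower (INR n) (a - 1) <= 1.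
  { have -> : a - 1 = - (1 - a) by ring. apply: (Rle_trans _ (Rpower 1 (- (1 - a)))).
    - apply: Rpower_neg_anti; lra. - rewrite /Rpower ln_1 Rmult_0_r exp_0. lra. }
  set k0 := test_scale * Rpower (INR n) (a - 1).
  have Hk0 : 0 <= k0 <= 1 by rewrite /k0; nra.
  have Hk1 : k0 <= Rpower (INR n) (a - 1) by rewrite /k0; nra.
  set r := Cmod z. have Hr : 0 <= r < 1 by split; [exact: Cmod_ge_0 | exact: Hz].
  have Mono : forall j, (n - 2 <= j)%nat -> Cmod (z ^ j)%C <= r ^ (n - 2).
  { move=> j Hj. have -> : (j = (n - 2) + (j - (n - 2)))%nat by lia. rewrite Cmod_pow -/r pow_add.
    have : 0 <= r ^ (n - 2) by apply: pow_le; lra. have := pow_le_1 r (j - (n - 2)) ltac:(lra). nra. }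
  have Pr : 0 <= r ^ (n - 2) by apply: pow_le; lra.
  set rn := r ^ (n - 2) in Mono Pr.
  have G : forall x y (al be : R), 0 <= al -> 0 <= be -> Cmod x <= al -> Cmod y <= be ->
    Cmod (RtoC k0 * (x - c * y))%C <= k0 * (al + exp 2 * be).
  { move=> x y al be Hal Hbe Hx Hy. rewrite Cmod_mult Cmod_RtoC_pos; last lra. apply: Rmult_le_compat_l; first lra.
    have := Cmod_triangle_minus x (c * y)%C. rewrite Cmod_mult.
    have : Cmod c * Cmod y <= exp 2 * be by apply: Rmult_le_compat => //; exact: Cmod_ge_0. lra. }
  have Fin : forall al be, 0 <= al <= INR n ^ 2 * rn -> 0 <= be <= 4 * (INR n ^ 2 * rn) -> k0 * (al + exp 2 * be) <= Sx.
  { move=> al be Hal Hbe. rewrite /Sx -/r -/rn. have : exp 2 * be <= exp 2 * (4 * (INR n ^ 2 * rn)) by apply: Rmult_le_compat_l; lra.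
    have : 0 <= exp 2 * be by apply: Rmult_le_pos; lra. nra. }
  have N2 : 1 <= INR n ^ 2 by nra.
  have EI2 : INR (2 * n) = 2 * INR n by rewrite mult_INR.
  have EIm : INR (n - 1) <= INR n by apply: le_INR; lia.
  have EI2m : INR (2 * n - 1) <= 2 * INR n by rewrite -EI2; apply: le_INR; lia.
  have Pm := pos_INR (n - 1). have P2m := pos_INR (2 * n - 1).
  have Q1 : rn <= INR n ^ 2 * rn by nra.
  have Q2 : INR n * rn <= INR n ^ 2 * rn by apply: Rmult_le_compat_r => //; nra.
  split; [|split; [|split]].
  - rewrite /test_fun -/k0. eapply Rle_trans; first by apply: (G _ _ rn rn) => //; apply: Mono; lia.
    apply: Fin; lra.
  - rewrite d1_test_fun -/k0. eapply Rle_trans; first apply: (G _ _ (INR n * rn) (2 * INR n * rn)).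
    + apply: Rmult_le_pos; lra. + apply: Rmult_le_pos; lra.
    + rewrite Cmod_mult Cmod_RtoC_pos; last lra. apply: Rmult_le_compat_l; first lra. apply: Mono; lia.
    + rewrite Cmod_mult Cmod_RtoC_pos; last exact: pos_INR. rewrite EI2. apply: Rmult_le_compat_l; first lra. apply: Mono; lia.
    + have : 0 <= INR n * rn by apply: Rmult_le_pos; lra. move=> Q3. apply: Fin; lra.
  - rewrite d2_test_fun -/k0. eapply Rle_trans; first apply: (G _ _ (INR n * (INR n * rn)) (2 * INR n * (2 * INR n * rn))).
    + repeat apply: Rmult_le_pos; lra. + repeat apply: Rmult_le_pos; lra.
    + rewrite Cmod_mult Cmod_mult !Cmod_RtoC_pos; try lra. apply: Rmult_le_compat_l; first lra.
      apply: Rmult_le_compat => //; first exact: Cmod_ge_0. apply: Mono; lia.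
    + rewrite Cmod_mult Cmod_mult !Cmod_RtoC_pos; try exact: pos_INR. rewrite EI2. apply: Rmult_le_compat_l; first lra.
      apply: Rmult_le_compat => //; first exact: Cmod_ge_0. apply: Mono; lia.
    + have : 0 <= INR n * INR n * rn by repeat apply: Rmult_le_pos; lra. move=> Q3. apply: Fin; lra.
  - rewrite /test_fun -/k0. eapply Rle_trans; first (apply: (G _ _ 1 1); try lra; exact: Cmod_pow_le_1). nra.
Qed.

(** Discards the u'' term: at the moving points it is at most a constant times n^(a-1), which tends
    to 0. Since [ns k] tends to infinity, the pointwise decay required by [compact_test_sequence]
    also holds. *)
Lemma compact_test_points a b u phi K (E L : R) zs ns cs : 0 < a < 1 -> holo u -> selfmap phi ->
  wcomp_bounded a b u phi -> compact_op a b K -> Rbar_le (op_norm_diff a b (wcomp u phi) K) E ->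
  (forall k, inD (zs k) /\ (k + 2 <= ns k)%nat /\ Cmod (cs k) <= exp 2 /\
    L <= wt b (zs k) * Cmod (coefA u phi (zs k) * d1 (test_fun a (ns k) (cs k)) (phi (zs k)) +
                             coefB u phi (zs k) * d2 (test_fun a (ns k) (cs k)) (phi (zs k)))%C) -> L <= E.
Proof.
  move=> Ha Hu Hphi HT HK HE H.
  case: (wcomp_coef_bounded a b u phi ltac:(lra) Hu Hphi HT) => MU [HMU HU].
  have E2 := exp_pos 2.
  apply: le_epsilon => e He.
  set D := 1 + 4 * exp 2. have HD : 1 < D by rewrite /D; lra.
  have HDM : 0 <= MU * D by apply: Rmult_le_pos; lra.
  (* From [k0] on, the u'' term costs at most e. The sequences are shifted by [k0] because
     [compact_test_sequence] asks for the lower bound at every index. *)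
  case: (Rpower_neg_small (1 - a) (e / (MU * D + 1))) => [||k0 Hk0]; [lra | apply: Rdiv_lt_0_compat; lra |].
  suff : L - e <= E by lra.
  apply: (compact_test_sequence a b u phi K E (L - e) (fun k => test_fun a (ns (k0 + k)%nat) (cs (k0 + k)%nat))
    (fun k => zs (k0 + k)%nat)) => //; first lra.
  - move=> k. case: (H (k0 + k)%nat) => _ [H1 [H2 _]]. apply: test_fun_bloch => //. lia.
  - move=> z Hz e' He'. have Hpz := proj2 Hphi z Hz. rewrite /inD in Hpz. have Ppz := Cmod_ge_0 (phi z).
    case: (square_geom_small (Cmod (phi z)) (e' / (3 * (MU * D) + 1))) => [||N HN]; [lra | apply: Rdiv_lt_0_compat; lra |].
    exists N => k Hk. case: (H (k0 + k)%nat) => _ [H1 [H2 _]].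
    set n := ns (k0 + k)%nat in H1 *. set c := cs (k0 + k)%nat in H2 *.
    case: (test_fun_bounds a n c (phi z) Ha ltac:(lia) H2 (proj2 Hphi z Hz)).
    set f := test_fun a n c. set S := _ * (_ * _) => F0 [F1 [F2 _]].
    have HS : S <= D * (e' / (3 * (MU * D) + 1)).
    { rewrite /S -/D. apply: Rmult_le_compat_l; first lra.
      have := HN (n - 2)%nat ltac:(lia). have -> : INR (n - 2) + 2 = INR n by rewrite minus_INR; [simpl; ring | lia]. by []. }
    have PS : 0 <= S by have := Cmod_ge_0 (f (phi z)); lra.
    rewrite wcomp_d2 //; last exact: test_fun_holo. rewrite -/f.
    case: (HU z Hz) => U0 [U1 U2]. have W := wt_pos b z.
    have T1 := Cmod_triangle (d2 u z * f (phi z) + coefA u phi z * d1 f (phi z))%C (coefB u phi z * d2 f (phi z))%C.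
    have T2 := Cmod_triangle (d2 u z * f (phi z))%C (coefA u phi z * d1 f (phi z))%C.
    rewrite (Cmod_mult (coefB u phi z)) in T1. rewrite (Cmod_mult (d2 u z)) (Cmod_mult (coefA u phi z)) in T2.
    have Q : forall (g : R) (y : R), 0 <= g -> wt b z * g <= MU -> 0 <= y <= S -> wt b z * (g * y) <= MU * S.
    { move=> g y Hg Hw Hy. rewrite -Rmult_assoc. apply: Rmult_le_compat; try lra. apply: Rmult_le_pos; lra. }
    have Q0 := Q _ _ (Cmod_ge_0 _) U0 (conj (Cmod_ge_0 _) F0).
    have Q1 := Q _ _ (Cmod_ge_0 _) U1 (conj (Cmod_ge_0 _) F1).
    have Q2 := Q _ _ (Cmod_ge_0 _) U2 (conj (Cmod_ge_0 _) F2).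
    set t := Cmod (_ + _ + _)%C in T1 *. set t' := Cmod _ in T1 T2.
    have : wt b z * t <= wt b z * (Cmod (d2 u z) * Cmod (f (phi z)) + Cmod (coefA u phi z) * Cmod (d1 f (phi z)) + Cmod (coefB u phi z) * Cmod (d2 f (phi z))).
    { apply: Rmult_le_compat_l; lra. }
    have R1 : MU * S <= MU * (D * (e' / (3 * (MU * D) + 1))) by apply: Rmult_le_compat_l.
    have R2 : 3 * (MU * (D * (e' / (3 * (MU * D) + 1)))) <= e'.
    { apply: (Rmult_le_reg_r (3 * (MU * D) + 1)); first lra.
      have -> : 3 * (MU * (D * (e' / (3 * (MU * D) + 1)))) * (3 * (MU * D) + 1) = 3 * (MU * D) * e' by field; lra. nra. }
    lra.
  - move=> k. case: (H (k0 + k)%nat) => Hz [H1 [H2 H3]]. split => //.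
    set z := zs (k0 + k)%nat in Hz H3 *. set n := ns (k0 + k)%nat in H1 H3 *. set c := cs (k0 + k)%nat in H2 H3 *.
    case: (test_fun_bounds a n c (phi z) Ha ltac:(lia) H2 (proj2 Hphi z Hz)) => _ [_ [_ F]].
    set f := test_fun a n c in H3 F *.
    rewrite wcomp_d2 //; last exact: test_fun_holo.
    set X := (coefA u phi z * d1 f (phi z) + coefB u phi z * d2 f (phi z))%C in H3.
    have -> : (d2 u z * f (phi z) + coefA u phi z * d1 f (phi z) + coefB u phi z * d2 f (phi z) = X + d2 u z * f (phi z))%C by rewrite /X; ring.
    have T := Cmod_triangle_minus (X + d2 u z * f (phi z))%C (d2 u z * f (phi z))%C.
    have EX : (X + d2 u z * f (phi z) - d2 u z * f (phi z) = X)%C by ring.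
    rewrite EX (Cmod_mult (d2 u z)) in T.
    case: (HU z Hz) => U0 _. have W := wt_pos b z.
    have Fn : Rpower (INR n) (a - 1) <= e / (MU * D + 1).
    { have := Hk0 (n - 1)%nat ltac:(lia). have -> : INR (n - 1) + 1 = INR n by rewrite minus_INR; [simpl; ring | lia].
      have -> : - (1 - a) = a - 1 by ring. by []. }
    have Q : wt b z * (Cmod (d2 u z) * Cmod (f (phi z))) <= MU * (D * (e / (MU * D + 1))).
    { rewrite -Rmult_assoc. apply: Rmult_le_compat => //; try exact: Cmod_ge_0.
      - apply: Rmult_le_pos; [lra | exact: Cmod_ge_0].
      - apply: Rle_trans; first exact: F. apply: Rmult_le_compat_l => //. rewrite -/D; lra. }
    have R2 : MU * (D * (e / (MU * D + 1))) <= e.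
    { apply: (Rmult_le_reg_r (MU * D + 1)); first lra.
      have -> : MU * (D * (e / (MU * D + 1))) * (MU * D + 1) = MU * D * e by field; lra. nra. }
    have : wt b z * Cmod X <= wt b z * (Cmod (X + d2 u z * f (phi z))%C + Cmod (d2 u z) * Cmod (f (phi z))) by apply: Rmult_le_compat_l; lra.
    lra.
Qed.

(** Failure of the bound in each layer of width 1/(k+2) supplies a point z_k; the layer width forces
    n_k = floor(1/(1-|phi(z_k)|)) to be at least k + 2. If |phi| stays away from 1, the bound holds
    vacuously for large N and there are no such points to produce. *)
Lemma bad_points (phi Gf : C -> C) b p Lam : (forall z, inD z -> inD (phi z)) ->
  ~ (exists N, forall z, inD z -> 1 - / (INR N + 2) <= Cmod (phi z) ->
      wt b z * Cmod (Gf z) * Rpower (1 - Cmod (phi z)) (- p) <= Lam) ->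
  exists zs ns, forall k, inD (zs k) /\ (k + 2 <= ns k)%nat /\ exp (- 2) <= Cmod (phi (zs k)) ^ ns k /\
    / (1 - Cmod (phi (zs k))) <= INR (ns k) + 1 /\ 0 < 1 - Cmod (phi (zs k)) /\
    Lam <= wt b (zs k) * Cmod (Gf (zs k)) * Rpower (1 - Cmod (phi (zs k))) (- p).
Proof.
  move=> Hs H.
  have K : forall k, exists zn : C * nat, inD (fst zn) /\ (k + 2 <= snd zn)%nat /\ exp (- 2) <= Cmod (phi (fst zn)) ^ snd zn /\
    / (1 - Cmod (phi (fst zn))) <= INR (snd zn) + 1 /\ 0 < 1 - Cmod (phi (fst zn)) /\
    Lam <= wt b (fst zn) * Cmod (Gf (fst zn)) * Rpower (1 - Cmod (phi (fst zn))) (- p).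
  { move=> k. apply: NNPP => Hk. apply: H. exists k => z Hz Ht.
    apply: Rnot_lt_le => HL. apply: Hk.
    have Hp : Cmod (phi z) < 1 := Hs z Hz. set x := 1 - Cmod (phi z).
    have Pk := pos_INR k.
    have Hx : 0 < x by rewrite /x; lra.
    have Hx1 : x <= / (INR k + 2) by rewrite /x; lra.
    have Hx2 : / (INR k + 2) <= / 2 by apply: Rinv_le_contravar; lra.
    case: (floor_inv x Hx) => n [H1 H2]. exists (z, n). rewrite /= -/x.
    split; first by []. split; [|split; [|split; [|split; [by []|exact: Rlt_le]]]].
    - have Q : x * (INR k + 2) <= 1.
      { have : x * (INR k + 2) <= / (INR k + 2) * (INR k + 2) by apply: Rmult_le_compat_r; lra. rewrite Rinv_l; lra. }
      have : INR k + 2 < INR n + 1 by apply: (Rmult_lt_reg_r x) => //; lra.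
      have : INR (k + 1) = INR k + 1 by rewrite plus_INR.
      move=> E1 E2. have : INR (k + 1) < INR n by lra. move=> /INR_lt. lia.
    - have -> : Cmod (phi z) = 1 - x by rewrite /x; ring. apply: pow_one_minus_ge => //. lra.
    - apply: (Rmult_le_reg_r x) => //. rewrite Rinv_l; lra. }
  pose c k := proj1_sig (constructive_indefinite_description _ (K k)).
  exists (fun k => fst (c k)), (fun k => snd (c k)) => k.
  exact: (proj2_sig (constructive_indefinite_description _ (K k))).
Qed.

Lemma Rpower_inv_le_double x n p : 0 < x -> / x <= INR n + 1 -> (1 <= n)%nat -> 0 <= p ->
  Rpower x (- p) <= Rpower 2 p * Rpower (INR n) p.
Proof.
  move=> Hx H Hn Hp. have Pn : 1 <= INR n by exact: (le_INR 1).
  rewrite Rpower_mult_distr; try lra.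
  have -> : Rpower x (- p) = Rpower (/ x) p by rewrite /Rpower ln_Rinv //; congr exp; ring.
  apply: Rle_Rpower_l => //. split; [exact: Rinv_0_lt_compat | lra].
Qed.

(** f' is proportional to n z^(n-1) (1 - 2 c z^n), so c = 1/(2 z^n) cancels it at z. In f'' this
    leaves n(n-1) - n(2n-1) = -n^2. Writing n = m + 2 avoids truncated exponents. *)
Lemma test_fun_B_values a m (z : C) : z <> 0%C ->
  let n := (m + 2)%nat in let f := test_fun a n (/ (2 * z ^ n))%C in
  d1 f z = 0 /\ d2 f z = (- (RtoC (test_scale * Rpower (INR n) (a - 1)) * (INR n * INR n * z ^ m)))%C.
Proof.
  move=> Hz n f. have HP := Cpow_nz z m Hz.
  have N2 : RtoC 2 <> 0 by move=> E; injection E; lra.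
  have e1 : (n - 1 = S m)%nat by rewrite /n; lia. have e2 : (S m - 1 = m)%nat by lia.
  have e3 : (2 * n - 1 = S m + n)%nat by rewrite /n; lia. have e4 : (S m + n - 1 = m + n)%nat by lia.
  have En : INR (S m) = INR n - 1 by rewrite /n plus_INR S_INR /=; ring.
  have E2n : INR (2 * n) = 2 * INR n by rewrite mult_INR.
  have E2n1 : INR (S m + n) = 2 * INR n - 1 by rewrite plus_INR En; ring.
  have Ez : (z ^ n = z * z * z ^ m)%C by rewrite /n Nat.add_comm /=; ring.
  split.
  - rewrite d1_test_fun e1 e3 E2n Cpow_add_r Ez Cpow_S !RtoC_mult. field. by [].
  - rewrite d2_test_fun e1 e2 e3 e4 E2n E2n1 En Cpow_add_r Ez !RtoC_minus !RtoC_mult. field. by [].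
Qed.

(** Cancelling f'' at z requires n(n-1) = 2n(2n-1) c z^n. Then 1 - 2 c z^n = n/(2n-1), which stays
    above 1/2, so f' keeps its size. *)
Lemma test_fun_A_values a m (z : C) : z <> 0%C ->
  let n := (m + 2)%nat in
  let f := test_fun a n (RtoC ((INR n - 1) / (2 * (2 * INR n - 1))) * / z ^ n)%C in
  d2 f z = 0 /\ d1 f z = (RtoC (test_scale * Rpower (INR n) (a - 1) * (INR n / (2 * INR n - 1))) * (INR n * z ^ (S m)))%C.
Proof.
  move=> Hz n f. have HP := Cpow_nz z m Hz.
  have Pn : 2 <= INR n by apply: (le_INR 2); rewrite /n; lia.
  have N2 : RtoC 2 <> 0 by move=> E; injection E; lra.
  have N3 : (2 * INR n - 1)%C <> 0 by rewrite -RtoC_mult -RtoC_minus => E; injection E; lra.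
  have e1 : (n - 1 = S m)%nat by rewrite /n; lia. have e2 : (S m - 1 = m)%nat by lia.
  have e3 : (2 * n - 1 = S m + n)%nat by rewrite /n; lia. have e4 : (S m + n - 1 = m + n)%nat by lia.
  have En : INR (S m) = INR n - 1 by rewrite /n plus_INR S_INR /=; ring.
  have E2n : INR (2 * n) = 2 * INR n by rewrite mult_INR.
  have E2n1 : INR (S m + n) = 2 * INR n - 1 by rewrite plus_INR En; ring.
  have Ez : (z ^ n = z * z * z ^ m)%C by rewrite /n Nat.add_comm /=; ring.
  have Ec : RtoC ((INR n - 1) / (2 * (2 * INR n - 1))) = ((INR n - 1) / (2 * (2 * INR n - 1)))%C.
  { rewrite RtoC_div; last lra. by rewrite RtoC_mult !RtoC_minus RtoC_mult. }
  split.
  - rewrite /f d2_test_fun Ec e1 e2 e3 e4 E2n E2n1 En Cpow_add_r Ez !RtoC_minus !RtoC_mult. by field.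
  - rewrite /f d1_test_fun Ec e1 e3 E2n Cpow_add_r Ez Cpow_S (RtoC_mult 2) (RtoC_mult _ (INR n / _)) RtoC_div; last lra.
    rewrite RtoC_minus (RtoC_mult 2). by field.
Qed.

(** At bad points, test functions with f'' = 0 there isolate A. In 4 e^2, one factor 2 comes from
    (1-|phi|)^(-a) <= 2 n^a, another from n/(2n-1) >= 1/2, and e^2 from |phi|^(n-1) >= e^(-2). *)
Lemma compact_lower_A a b u phi K (E Lam : R) : 0 < a < 1 -> holo u -> selfmap phi ->
  wcomp_bounded a b u phi -> compact_op a b K -> Rbar_le (op_norm_diff a b (wcomp u phi) K) E ->
  4 * exp 2 * E < test_scale * Lam ->
  exists N, forall z, inD z -> 1 - / (INR N + 2) <= Cmod (phi z) ->
      wt b z * Cmod (coefA u phi z) * Rpower (1 - Cmod (phi z)) (- a) <= Lam.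
Proof.
  move=> Ha Hu Hphi HT HK HE HL. apply: NNPP => /(bad_points phi (coefA u phi) b a Lam (proj2 Hphi)) [zs [ns H]].
  have E2 := exp_pos 2. have Em2 := exp_m2. have Pm2 := exp_pos (- 2). have KP := test_scale_pos.
  suff : test_scale * Lam / (4 * exp 2) <= E.
  { move=> Q. have : test_scale * Lam / (4 * exp 2) * (4 * exp 2) <= E * (4 * exp 2) by apply: Rmult_le_compat_r; lra.
    have -> : test_scale * Lam / (4 * exp 2) * (4 * exp 2) = test_scale * Lam by field; lra. lra. }
  apply: (compact_test_points a b u phi K E _ zs ns
    (fun k => (RtoC ((INR (ns k) - 1) / (2 * (2 * INR (ns k) - 1))) * / phi (zs k) ^ ns k)%C)) => // k.
  case: (H k) => Hz [Hn [Hs [Hx [Hx0 Hbad]]]].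
  set z := zs k in Hz Hs Hx Hx0 Hbad *. set n := ns k in Hn Hs Hx *. set x := 1 - Cmod (phi z) in Hx Hx0 Hbad.
  have Pn : 2 <= INR n by apply: (le_INR 2); lia.
  have Hz0 : phi z <> 0.
  { move=> E0. move: Hs. rewrite E0 Cmod_0 pow_ne_zero; [lra | lia]. }
  have Hmod : Cmod (/ phi z ^ n)%C <= exp 2.
  { have -> : exp 2 = / exp (- 2) by rewrite -exp_Ropp; congr exp; ring.
    apply: Cmod_inv_le; first exact: exp_pos. by rewrite Cmod_pow. }
  do 2 (split; first by []). split.
  { rewrite Cmod_mult Cmod_RtoC_pos; last by apply: Rdiv_le_0_compat; lra.
    have : (INR n - 1) / (2 * (2 * INR n - 1)) <= 1.
    { apply: (Rmult_le_reg_r (2 * (2 * INR n - 1))); first lra. rewrite Rmult_1_l /Rdiv Rmult_assoc Rinv_l; lra. }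
    have : 0 <= (INR n - 1) / (2 * (2 * INR n - 1)) by apply: Rdiv_le_0_compat; lra.
    have := Cmod_ge_0 (/ phi z ^ n)%C. nra. }
  have [m Em] : exists m, n = (m + 2)%nat by exists (n - 2)%nat; lia.
  case: (test_fun_A_values a m (phi z) Hz0). rewrite -Em /= => -> ->.
  set q := Rpower (INR n) (a - 1).
  have Pq : 0 < q by exact: Rpower_pos.
  have -> : (coefA u phi z * (RtoC (test_scale * q * (INR n / (2 * INR n - 1))) * (INR n * (phi z * phi z ^ m))) + coefB u phi z * 0 =
    coefA u phi z * (RtoC (test_scale * q * (INR n / (2 * INR n - 1))) * (INR n * (phi z) ^ (S m))))%C by rewrite Cpow_S; ring.
  rewrite Cmod_mult Cmod_mult Cmod_mult Cmod_pow.
  have Pf : / 2 <= INR n / (2 * INR n - 1).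
  { apply: (Rmult_le_reg_r (2 * INR n - 1)); first lra. rewrite /Rdiv Rmult_assoc Rinv_l; lra. }
  rewrite (Cmod_RtoC_pos (test_scale * _ * _)); last by apply: Rmult_le_pos; [apply: Rmult_le_pos; lra | lra].
  rewrite (Cmod_RtoC_pos (INR n)); last lra.
  have Hpz : Cmod (phi z) < 1 := proj2 Hphi z Hz. have Ppz := Cmod_ge_0 (phi z).
  have Ht : exp (- 2) <= Cmod (phi z) ^ S m.
  { apply: Rle_trans; first exact: Hs. have -> : n = S (S m) by lia.
    rewrite -(tech_pow_Rmult _ (S m)). have : 0 <= Cmod (phi z) ^ S m by exact: pow_le. nra. }
  have Er : q * INR n = Rpower (INR n) a.
  { rewrite /q -{2}(Rpower_1 (INR n)); last lra. rewrite -Rpower_plus. congr Rpower. ring. }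
  have R1 := Rpower_inv_le_double x n a Hx0 Hx ltac:(lia) ltac:(lra).
  have R2 : Rpower 2 a <= 2 by rewrite -{2}(Rpower_1 2); [apply: Rle_Rpower; lra | lra].
  have Pna := Rpower_pos (INR n) a.
  have R3 : Rpower x (- a) <= 2 * Rpower (INR n) a by nra.
  set g := wt b z * Cmod (coefA u phi z) in Hbad.
  have Pg : 0 <= g by apply: Rmult_le_pos; [left; exact: wt_pos | exact: Cmod_ge_0].
  set t := Cmod (phi z) ^ S m in Ht *. set fr := INR n / (2 * INR n - 1) in Pf *.
  have -> : wt b z * (Cmod (coefA u phi z) * (test_scale * q * fr * (INR n * t))) = test_scale * (g * (Rpower (INR n) a * (fr * t))) by rewrite -Er /g; ring.
  have -> : test_scale * Lam / (4 * exp 2) = test_scale * (Lam * (/ 4 * exp (-2))).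
  { have -> : exp (-2) = / exp 2 by rewrite -exp_Ropp. field. lra. }
  apply: Rmult_le_compat_l; first lra.
  have S1 : Lam <= g * (2 * Rpower (INR n) a) by apply: Rle_trans; [exact: Hbad | exact: Rmult_le_compat_l].
  have S2 : / 2 * exp (-2) <= fr * t by apply: Rmult_le_compat; lra.
  have S3 : g * Rpower (INR n) a * (/ 2 * exp (-2)) <= g * Rpower (INR n) a * (fr * t).
  { apply: Rmult_le_compat_l => //. apply: Rmult_le_pos; lra. }
  have S4 : Lam * (/ 4 * exp (-2)) <= g * (2 * Rpower (INR n) a) * (/ 4 * exp (-2)) by apply: Rmult_le_compat_r; lra.
  lra.
Qed.

(** Here the test functions have f' = 0 at the bad points and isolate B; the 4 bounds 2^(a+1) in
    (1-|phi|)^(-(a+1)) <= 4 n^(a+1). *)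
Lemma compact_lower_B a b u phi K (E Lam : R) : 0 < a < 1 -> holo u -> selfmap phi ->
  wcomp_bounded a b u phi -> compact_op a b K -> Rbar_le (op_norm_diff a b (wcomp u phi) K) E ->
  4 * exp 2 * E < test_scale * Lam ->
  exists N, forall z, inD z -> 1 - / (INR N + 2) <= Cmod (phi z) ->
      wt b z * Cmod (coefB u phi z) * Rpower (1 - Cmod (phi z)) (- (a + 1)) <= Lam.
Proof.
  move=> Ha Hu Hphi HT HK HE HL. apply: NNPP => /(bad_points phi (coefB u phi) b (a + 1) Lam (proj2 Hphi)) [zs [ns H]].
  have E2 := exp_pos 2. have Em2 := exp_m2. have Pm2 := exp_pos (- 2). have KP := test_scale_pos.
  suff : test_scale * Lam / (4 * exp 2) <= E.
  { move=> Q. have : test_scale * Lam / (4 * exp 2) * (4 * exp 2) <= E * (4 * exp 2) by apply: Rmult_le_compat_r; lra.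
    have -> : test_scale * Lam / (4 * exp 2) * (4 * exp 2) = test_scale * Lam by field; lra. lra. }
  apply: (compact_test_points a b u phi K E _ zs ns
    (fun k => (/ (2 * phi (zs k) ^ ns k))%C)) => // k.
  case: (H k) => Hz [Hn [Hs [Hx [Hx0 Hbad]]]].
  set z := zs k in Hz Hs Hx Hx0 Hbad *. set n := ns k in Hn Hs Hx *. set x := 1 - Cmod (phi z) in Hx Hx0 Hbad.
  have Pn : 2 <= INR n by apply: (le_INR 2); lia.
  have Hz0 : phi z <> 0.
  { move=> E0. move: Hs. rewrite E0 Cmod_0 pow_ne_zero; [lra | lia]. }
  do 2 (split; first by []). split.
  { have -> : exp 2 = / exp (- 2) by rewrite -exp_Ropp; congr exp; ring.
    apply: Cmod_inv_le; first exact: exp_pos. rewrite Cmod_mult Cmod_pow (Cmod_RtoC_pos 2); last lra.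
    lra. }
  have [m Em] : exists m, n = (m + 2)%nat by exists (n - 2)%nat; lia.
  case: (test_fun_B_values a m (phi z) Hz0). rewrite -Em /= => -> ->.
  set q := Rpower (INR n) (a - 1).
  have Pq : 0 < q by exact: Rpower_pos.
  have -> : (coefA u phi z * 0 + coefB u phi z * - (RtoC (test_scale * q) * (INR n * INR n * phi z ^ m)) =
    - (coefB u phi z * (RtoC (test_scale * q) * (RtoC (INR n) * RtoC (INR n) * phi z ^ m))))%C by ring.
  rewrite Cmod_opp Cmod_mult Cmod_mult Cmod_mult Cmod_mult Cmod_pow.
  rewrite (Cmod_RtoC_pos (test_scale * _)); last by apply: Rmult_le_pos; lra.
  rewrite (Cmod_RtoC_pos (INR n)); last lra.
  have Hpz : Cmod (phi z) < 1 := proj2 Hphi z Hz. have Ppz := Cmod_ge_0 (phi z).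
  have Ht : exp (- 2) <= Cmod (phi z) ^ m.
  { apply: Rle_trans; first exact: Hs. rewrite Em pow_add.
    have : 0 <= Cmod (phi z) ^ m by exact: pow_le. have := pow_le_1 (Cmod (phi z)) 2 ltac:(lra). nra. }
  have Er : q * INR n * INR n = Rpower (INR n) (a + 1).
  { have -> : a + 1 = (a - 1) + 1 + 1 by ring. rewrite (Rpower_plus (a - 1 + 1)) (Rpower_plus (a - 1)) Rpower_1 -/q; lra. }
  have R1 := Rpower_inv_le_double x n (a + 1) Hx0 Hx ltac:(lia) ltac:(lra).
  have R2 : Rpower 2 (a + 1) <= 4.
  { have -> : 4 = Rpower 2 (INR 2) by rewrite Rpower_pow; lra. apply: Rle_Rpower; simpl; lra. }
  have Pna := Rpower_pos (INR n) (a + 1).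
  have R3 : Rpower x (- (a + 1)) <= 4 * Rpower (INR n) (a + 1) by nra.
  set g := wt b z * Cmod (coefB u phi z) in Hbad.
  have Pg : 0 <= g by apply: Rmult_le_pos; [left; exact: wt_pos | exact: Cmod_ge_0].
  set t := Cmod (phi z) ^ m in Ht *.
  have -> : wt b z * (Cmod (coefB u phi z) * (test_scale * q * (INR n * INR n * t))) = test_scale * (g * (Rpower (INR n) (a + 1) * t)) by rewrite -Er /g; ring.
  have -> : test_scale * Lam / (4 * exp 2) = test_scale * (Lam * (/ 4 * exp (-2))).
  { have -> : exp (-2) = / exp 2 by rewrite -exp_Ropp. field. lra. }
  apply: Rmult_le_compat_l; first lra.
  have S1 : Lam <= g * (4 * Rpower (INR n) (a + 1)) by apply: Rle_trans; [exact: Hbad | exact: Rmult_le_compat_l].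
  have S3 : g * Rpower (INR n) (a + 1) * exp (-2) <= g * Rpower (INR n) (a + 1) * t.
  { apply: Rmult_le_compat_l => //. apply: Rmult_le_pos; lra. }
  have S4 : Lam * (/ 4 * exp (-2)) <= g * (4 * Rpower (INR n) (a + 1)) * (/ 4 * exp (-2)) by apply: Rmult_le_compat_r; lra.
  lra.
Qed.

(** * Powers of phi and conclusion *)

(** Put v = n x. Then ((n+1)x)^p <= 1 + (1+v)^2 <= 4 (1 + v/2)^2 <= 4 e^v, while (1-x)^n <= e^(-v).
    The range p <= 2 covers both exponents a and a + 1. *)
Lemma power_weight_le x n p : 0 < x <= 1 -> 0 <= p <= 2 ->
  Rpower (INR n + 1) p * Rpower x p * (1 - x) ^ n <= 4.
Proof.
  move=> Hx Hp. have Pn := pos_INR n.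
  rewrite Rpower_mult_distr; try lra.
  set y := (INR n + 1) * x. have Hy : 0 < y by apply: Rmult_lt_0_compat; lra.
  have Hyp : Rpower y p <= 1 + y ^ 2.
  { case: (Rle_dec y 1) => H.
    - have := Rpower_le_1 y p ltac:(lra) ltac:(lra). nra.
    - have : Rpower y p <= Rpower y (INR 2) by apply: Rle_Rpower; simpl; lra. rewrite Rpower_pow //; lra. }
  set v := INR n * x. have Hv : 0 <= v by apply: Rmult_le_pos; lra.
  have Hyv : y <= v + 1 by rewrite /y /v; lra.
  have Et : (1 - x) ^ n <= exp (- v).
  { apply: (Rle_trans _ (exp (- x) ^ n)).
    - apply: pow_incr. have := exp_ineq1_le (- x). lra.
    - rewrite -Rpower_pow; last exact: exp_pos. rewrite /Rpower ln_exp /v. right. congr exp. ring. }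
  have Ee : 1 + v + v ^ 2 / 4 <= exp v.
  { have -> : exp v = exp (v / 2) * exp (v / 2) by rewrite -exp_plus; congr exp; field.
    have := exp_ineq1_le (v / 2). nra. }
  have E1 : exp v * exp (- v) = 1 by rewrite -exp_plus Rplus_opp_r exp_0.
  have Pv := exp_pos (- v). have Pt : 0 <= (1 - x) ^ n by apply: pow_le; lra.
  have Py := Rpower_pos y p.
  apply: (Rle_trans _ ((4 * exp v) * exp (- v))); last lra.
  apply: Rmult_le_compat => //; first lra. nra.
Qed.

(** The converse of [weight_from_powers]. Near |phi| = 1 [power_weight_le] supplies the factor 4;
    elsewhere |phi| <= r < 1, and geometric decay beats (n+1)^p, uniformly because the weighted [Gf]
    is bounded. *)
Lemma powers_from_weight p (phi Gf : C -> C) b M Lam N : 0 <= p <= 2 -> 0 < Lam -> 0 <= M -> (forall z, inD z -> inD (phi z)) ->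
  (forall z, inD z -> wt b z * Cmod (Gf z) <= M) ->
  (forall z, inD z -> 1 - / (INR N + 2) <= Cmod (phi z) ->
      wt b z * Cmod (Gf z) * Rpower (1 - Cmod (phi z)) (- p) <= Lam) ->
  exists N', forall n z, (N' <= n)%nat -> inD z -> Rpower (INR n + 1) p * (wt b z * Cmod (Gf z * phi z ^ n)%C) <= 4 * Lam.
Proof.
  move=> Hp HL HM Hs HG HW. have PN := pos_INR N.
  have Pi : 0 < / (INR N + 2) by apply: Rinv_0_lt_compat; lra.
  have Pi2 : / (INR N + 2) <= / 2 by apply: Rinv_le_contravar; lra.
  case: (square_geom_small (1 - / (INR N + 2)) (Lam / (M + 1))) => [||N' HN']; [lra | apply: Rdiv_lt_0_compat; lra |].
  exists N' => n z Hn Hz. rewrite Cmod_mult Cmod_pow. have Pn := pos_INR n.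
  have Hpz : Cmod (phi z) < 1 := Hs z Hz. have Ppz := Cmod_ge_0 (phi z).
  have Pw : 0 <= wt b z * Cmod (Gf z) by apply: Rmult_le_pos; [left; exact: wt_pos | exact: Cmod_ge_0].
  have PR := Rpower_pos (INR n + 1) p.
  have Pt : 0 <= Cmod (phi z) ^ n by exact: pow_le.
  case: (Rle_dec (1 - / (INR N + 2)) (Cmod (phi z))) => Hc.
  - have K := HW z Hz Hc. set x := 1 - Cmod (phi z) in K.
    have Hx : 0 < x <= 1 by rewrite /x; lra.
    have Q := power_weight_le x n p Hx Hp. have Ex : 1 - x = Cmod (phi z) by rewrite /x; ring. rewrite Ex in Q.
    have E : Rpower x (- p) * Rpower x p = 1 by rewrite -Rpower_plus Rplus_opp_l Rpower_O //; lra.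
    have -> : Rpower (INR n + 1) p * (wt b z * (Cmod (Gf z) * Cmod (phi z) ^ n)) =
      (wt b z * Cmod (Gf z) * Rpower x (- p)) * (Rpower (INR n + 1) p * Rpower x p * Cmod (phi z) ^ n).
    { rewrite -[LHS]Rmult_1_r -E. ring. }
    rewrite (Rmult_comm 4). have P1 := Rpower_pos x p. have P2 := Rpower_pos x (- p).
    apply: Rmult_le_compat => //; apply: Rmult_le_pos => //; try lra. apply: Rmult_le_pos; lra.
  - have Q := HN' n Hn. set r := 1 - / (INR N + 2) in Q Hc.
    have Qr : Cmod (phi z) ^ n <= r ^ n by apply: pow_incr; lra.
    have Qp : Rpower (INR n + 1) p <= (INR n + 2) ^ 2.
    { apply: (Rle_trans _ (Rpower (INR n + 1) (INR 2))); first by apply: Rle_Rpower; simpl; lra.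
      rewrite Rpower_pow; nra. }
    have S1 : Rpower (INR n + 1) p * Cmod (phi z) ^ n <= (INR n + 2) ^ 2 * r ^ n by apply: Rmult_le_compat; lra.
    have S2 : (wt b z * Cmod (Gf z)) * (Rpower (INR n + 1) p * Cmod (phi z) ^ n) <= M * (Lam / (M + 1)).
    { apply: Rmult_le_compat => //; [apply: Rmult_le_pos; lra | exact: HG | lra]. }
    have S3 : M * (Lam / (M + 1)) <= Lam.
    { apply: (Rmult_le_reg_r (M + 1)); first lra. have -> : M * (Lam / (M + 1)) * (M + 1) = M * Lam by field; lra. nra. }
    lra.
Qed.

(** * Suprema and limits superior in the extended reals *)

Lemma scaled_wsup_le c b g (M : R) : 0 < c -> (forall z, inD z -> c * (wt b z * Cmod (g z)) <= M) ->
  Rbar_le (Rbar_mult c (wsup b g)) M.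
Proof.
  move=> Hc H.
  have K : Rbar_le (wsup b g) (M / c).
  { apply: wsup_le => z Hz. apply: (Rmult_le_reg_l c) => //. have -> : c * (M / c) = M by field; lra. exact: H. }
  move: K (wsup_ge0 b g). case: (wsup b g) => [y||] //= K _.
  have : c * y <= c * (M / c) by apply: Rmult_le_compat_l; lra. have -> : c * (M / c) = M by field; lra. by [].
Qed.

Lemma Rbar_mult_pos_p_infty c : 0 < c -> Rbar_mult c p_infty = p_infty.
Proof.
  move=> Hc. rewrite /Rbar_mult /=. case: Rle_dec => H; last lra. by case: Rle_lt_or_eq_dec => // E; lra.
Qed.

Lemma Rbar_mult_nonneg c Y : 0 < c -> Rbar_le 0 Y -> Rbar_le 0 (Rbar_mult c Y).
Proof.
  move=> Hc. case: Y => [y||] // H.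
  - apply: Rmult_le_pos; [lra | exact: H].
  - by rewrite Rbar_mult_pos_p_infty.
Qed.

Lemma scaled_wsup_ge c b g (M : R) : 0 < c -> Rbar_le (Rbar_mult c (wsup b g)) M ->
  forall z, inD z -> c * (wt b z * Cmod (g z)) <= M.
Proof.
  move=> Hc H z Hz. move: H (wsup_ge0 b g) (wsup_ge b g z Hz).
  case: (wsup b g) => [y||] // H _ K; last by rewrite Rbar_mult_pos_p_infty in H.
  have H' : c * y <= M := H. have K' : wt b z * Cmod (g z) <= y := K.
  have : c * (wt b z * Cmod (g z)) <= c * y by apply: Rmult_le_compat_l; lra. lra.
Qed.

Lemma limsupRbar_le x (M : Rbar) N : (forall n, (N <= n)%nat -> Rbar_le (x n) M) -> Rbar_le (limsupRbar x) M.
Proof.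
  move=> H. rewrite /limsupRbar. rewrite {1}/Rbar_glb. case: Rbar_ex_glb => l Hl.
  apply: (Rbar_le_trans _ (Rbar_lub (fun v => exists k, (N <= k)%nat /\ v = x k))).
  - exact: (proj1 Hl _ (ex_intro _ N (eq_refl _))).
  - rewrite /Rbar_lub. case: Rbar_ex_lub => m Hm. apply: (proj2 Hm) => v [k [Hk ->]]. exact: H.
Qed.

Lemma limsupRbar_lt x (M : Rbar) : Rbar_lt (limsupRbar x) M -> exists N, forall n, (N <= n)%nat -> Rbar_le (x n) M.
Proof.
  move=> H. apply: NNPP => Hn. move: H. apply: Rbar_le_not_lt.
  rewrite /limsupRbar {1}/Rbar_glb. case: Rbar_ex_glb => l Hl. apply: (proj2 Hl) => y [N ->].
  apply: Rbar_not_lt_le => HN. apply: Hn. exists N => n Hle.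
  apply: Rbar_le_trans; last exact: (Rbar_lt_le _ _ HN).
  rewrite /Rbar_lub. case: Rbar_ex_lub => m Hm. exact: (proj1 Hm _ (ex_intro _ n (conj Hle (eq_refl _)))).
Qed.

Lemma limsupRbar_ge x (M : Rbar) : (forall n, Rbar_le M (x n)) -> Rbar_le M (limsupRbar x).
Proof.
  move=> H. rewrite /limsupRbar {1}/Rbar_glb. case: Rbar_ex_glb => l Hl. apply: (proj2 Hl) => y [N ->].
  apply: Rbar_le_trans; first exact: (H N).
  rewrite /Rbar_lub. case: Rbar_ex_lub => m Hm. exact: (proj1 Hm _ (ex_intro _ N (conj (le_n N) (eq_refl _)))).
Qed.

Lemma Rbar_max2_le x y M : Rbar_le x M -> Rbar_le y M -> Rbar_le (Rbar_max2 x y) M.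
Proof.
  move=> H1 H2. rewrite /Rbar_max2 /Rbar_lub. case: Rbar_ex_lub => m Hm. apply: (proj2 Hm) => v [->|->]; assumption.
Qed.

Lemma Rbar_max2_ge x y : Rbar_le x (Rbar_max2 x y) /\ Rbar_le y (Rbar_max2 x y).
Proof.
  rewrite /Rbar_max2 /Rbar_lub. case: Rbar_ex_lub => m Hm.
  split; apply: (proj1 Hm); [left | right]; reflexivity.
Qed.

Lemma Rbar_le_of_reals_above (x : Rbar) (y : R) : (forall e, 0 < e -> Rbar_le x (y + e)) -> Rbar_le x y.
Proof.
  case: x => [x||] // H.
  - apply: le_epsilon => e He. exact: (H e He).
  - exact: (H 1 Rlt_0_1).
Qed.

(** The zero function is an admissible test, so the supremum runs over a nonempty set of nonnegative
    norms and cannot be [m_infty]. *)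
Lemma op_norm_diff_ge0 a b T K : 0 < a -> Rbar_le 0 (op_norm_diff a b T K).
Proof.
  move=> Ha. set f := fun _ : C => RtoC 0.
  have D : forall z, inD z -> Cmod (d1 f z) <= 0.
  { move=> z _. rewrite (cdiff_d1 _ _ _ (cdiff_const 0 z)) Cmod_0. lra. }
  case: (growth_inBloch a f 0 Ha _ D) => [|B1 B2].
  { apply: cdiff_holo => z _. eexists. exact: cdiff_const. }
  rewrite /f Cmod_0 Rplus_0_l in B2.
  set y := zyg_norm b (fun z => T f z - K f z)%C.
  apply: (Rbar_le_trans _ y).
  - rewrite /y /zyg_norm. have := wsup_ge0 b (d2 (fun z => T f z - K f z)%C).
    case: wsup => [w||] //= Hw. have := Cmod_ge_0 (T f 0%C - K f 0%C)%C.
    have := Cmod_ge_0 (d1 (fun z => T f z - K f z)%C 0%C). lra.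
  - rewrite /op_norm_diff /Rbar_lub. case: Rbar_ex_lub => l Hl.
    apply: (proj1 Hl). exists f. split => //. split; last by []. apply: Rbar_le_trans; first exact: B2. rewrite /=; lra.
Qed.

Lemma quant_le_compact a b u phi K (E : R) : 0 < a < 1 -> holo u -> selfmap phi ->
  wcomp_bounded a b u phi -> compact_op a b K -> Rbar_le (op_norm_diff a b (wcomp u phi) K) E ->
  Rbar_le (quantA a b u phi) (16 * exp 2 / test_scale * E) /\ Rbar_le (quantB a b u phi) (16 * exp 2 / test_scale * E).
Proof.
  move=> Ha Hu Hphi HT HK HE.
  have KP := test_scale_pos. have E2 := exp_pos 2.
  have HE0 : 0 <= E := Rbar_le_trans 0 _ E (op_norm_diff_ge0 a b _ K (proj1 Ha)) HE.
  case: (wcomp_coef_bounded a b u phi (proj1 Ha) Hu Hphi HT) => MU [HMU HU].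
  (* The term e / 4 makes the hypothesis of the compact lower bounds strict and [Lam] positive even
     for E = 0. Returning to powers multiplies [Lam] by 4, hence the 16. *)
  have Hlam : forall e, 0 < e -> let Lam := 4 * exp 2 / test_scale * E + e / 4 in 0 < Lam /\ 4 * exp 2 * E < test_scale * Lam /\ 4 * Lam = 16 * exp 2 / test_scale * E + e.
  { move=> e He Lam.
    have P : 0 <= 4 * exp 2 / test_scale * E by apply: Rmult_le_pos => //; apply: Rdiv_le_0_compat; lra.
    split; first by rewrite /Lam; lra. split; last by rewrite /Lam; field; lra.
    have -> : test_scale * Lam = 4 * exp 2 * E + test_scale * (e / 4) by rewrite /Lam; field; lra. nra. }
  split; apply: Rbar_le_of_reals_above => e He; case: (Hlam e He) => HL0 [HL1 <-].
  - case: (compact_lower_A a b u phi K E _ Ha Hu Hphi HT HK HE HL1) => N HN.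
    case: (powers_from_weight a phi (coefA u phi) b MU _ N ltac:(lra) HL0 HMU (proj2 Hphi) (fun z Hz => proj1 (proj2 (HU z Hz))) HN) => N' HN'.
    apply: (limsupRbar_le _ _ N') => n Hn. apply: scaled_wsup_le; first exact: Rpower_pos.
    move=> z Hz. exact: HN'.
  - case: (compact_lower_B a b u phi K E _ Ha Hu Hphi HT HK HE HL1) => N HN.
    case: (powers_from_weight (a + 1) phi (coefB u phi) b MU _ N ltac:(lra) HL0 HMU (proj2 Hphi) (fun z Hz => proj2 (proj2 (HU z Hz))) HN) => N' HN'.
    apply: (limsupRbar_le _ _ N') => n Hn. apply: scaled_wsup_le; first exact: Rpower_pos.
    move=> z Hz. exact: HN'.
Qed.

Theorem theorem4p3 (a b : R) (ha : 0 < a) (ha1 : a < 1) (hb : 0 < b) :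
  exists Cst : R, 0 < Cst /\
  forall u phi : C -> C, holo u -> selfmap phi ->
    wcomp_bounded a b u phi ->
    Rbar_le (Rbar_mult (Finite (/ Cst)) (Rbar_max2 (quantA a b u phi) (quantB a b u phi)))
            (ess_norm a b (wcomp u phi)) /\
    Rbar_le (ess_norm a b (wcomp u phi))
            (Rbar_mult (Finite Cst) (Rbar_max2 (quantA a b u phi) (quantB a b u phi))).
Proof.
  have KP := test_scale_pos. have E2 := exp_pos 2.
  have Ha : 0 < a < 1 by [].
  set C1 := 16 * exp 2 / test_scale. have HC1 : 0 < C1 by apply: Rdiv_lt_0_compat; lra.
  set C2 := 15 * exp 2 + 1. have HC2 : 0 < C2 by rewrite /C2; lra.
  (* [C1] serves the lower estimate and [C2] the upper one; the sum dominates each. *)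
  exists (C1 + C2); split; first lra.
  move=> u phi Hu Hphi HT.
  set m := Rbar_max2 _ _. case: (Rbar_max2_ge (quantA a b u phi) (quantB a b u phi)). rewrite -/m => HmA HmB.
  have Hm0 : Rbar_le 0 m.
  { apply: Rbar_le_trans; last exact: HmA. apply: limsupRbar_ge => n.
    apply: Rbar_mult_nonneg; [exact: Rpower_pos | exact: wsup_ge0]. }
  split.
  - rewrite /ess_norm /Rbar_glb. case: Rbar_ex_glb => l Hl. apply: (proj2 Hl) => y [K [HK ->]].
    have P0 := op_norm_diff_ge0 a b (wcomp u phi) K ha.
    (* An infinite distance to K makes the inequality trivial, so only finite E reaches
       [quant_le_compact]. *)
    case Eop : (op_norm_diff a b (wcomp u phi) K) => [E||]; rewrite Eop in P0 => //; last first.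
    { by case: (Rbar_mult _ _). }
    have HE0 : 0 <= E := P0.
    case: (quant_le_compact a b u phi K E Ha Hu Hphi HT HK) => [|QA QB].
    { rewrite Eop. exact: Rbar_le_refl. }
    have := Rbar_max2_le _ _ _ QA QB. rewrite -/m -/C1. move: Hm0.
    case: m {HmA HmB} => [x||] // Hx0 Hx.
    have Hx' : x <= C1 * E := Hx. have Hx0' : 0 <= x := Hx0.
    change (/ (C1 + C2) * x <= E). apply: (Rmult_le_reg_l (C1 + C2)); first lra.
    rewrite -Rmult_assoc Rinv_r; nra.
  - move: Hm0 HmA HmB. case: m => [x||] // Hm0 HmA HmB; last first.
    { rewrite Rbar_mult_pos_p_infty; last lra. by case: (ess_norm _ _ _). }
    have Hx0 : 0 <= x := Hm0.
    apply: (Rbar_le_trans _ (C2 * x)); last by rewrite /=; nra.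
    apply: Rbar_le_of_reals_above => e He.
    (* The excess makes the bounds on the limits superior strict, so that they hold from some index
       on, and keeps the tolerance positive when the maximum is 0. *)
    have He' : 0 < e / C2 by apply: Rdiv_lt_0_compat.
    have -> : C2 * x + e = C2 * (x + e / C2) by field; lra.
    have Hlt : Rbar_lt x (x + e / C2) by rewrite /=; lra.
    case: (limsupRbar_lt _ _ (Rbar_le_lt_trans _ _ _ HmA Hlt)) => NA HA.
    case: (limsupRbar_lt _ _ (Rbar_le_lt_trans _ _ _ HmB Hlt)) => NB HB.
    apply: (ess_norm_upper a b u phi (x + e / C2) (NA + NB)%nat Ha Hu Hphi HT); first lra.
    + move=> n z Hn Hz. apply: (scaled_wsup_ge _ b (fun z => coefA u phi z * phi z ^ n)%C) => //; first exact: Rpower_pos.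
      apply: HA. lia.
    + move=> n z Hn Hz. apply: (scaled_wsup_ge _ b (fun z => coefB u phi z * phi z ^ n)%C) => //; first exact: Rpower_pos.
      apply: HB. lia.
Qed.
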